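(* Let $\alpha$ be a countable ordinal and let $T$ be a satisfiable $\Pi_\alpha$ sentence of $\mathcal{L}_{\omega_1\omega}$ in the language $\{\le\}$ which extends the theory of linear orders. Then there is a countable linear order $\mathcal{B}\models T$ which has a $\Pi_{\alpha+4}$ Scott sentence, and hence has Scott rank at most $\alpha+3$.
   Context: $\mathcal{L}_{\omega_1\omega}$ is the infinitary logic allowing countable conjunctions and disjunctions (formulas have finitely many free variables). Complexity classes: $\Sigma_0=\Pi_0$ are the finitary quantifier-free formulas; for $\alpha\ge 1$, a $\Sigma_\alpha$ formula has the form $\bigvee_{i}\exists\bar x_i\,\psi_i$ (countable disjunction) with each $\psi_i$ a $\Pi_\beta$ formula for some $\beta<\alpha$, and a $\Pi_\alpha$ formula has the form $\bigwedge_i\forall\bar x_i\,\psi_i$ (countable conjunction) with each $\psi_i$ a $\Sigma_\beta$ formula for some $\beta<\alpha$. A Scott sentence for a countable structure $\mathcal{A}$ is a sentence $\varphi$ of $\mathcal{L}_{\omega_1\omega}$ such that for every countable structure $\mathcal{B}$, $\mathcal{B}\models\varphi$ iff $\mathcal{B}\cong\mathcal{A}$. The Scott rank $\mathrm{SR}(\mathcal{A})$ is the least ordinal $\beta$ such that $\mathcal{A}$ has a $\Pi_{\beta+1}$ Scott sentence. ''Extends the theory of linear orders'' means every model of $T$ is a linear order. *)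

(* Defs.v *)
From mathcomp Require Import all_boot.
From mathcomp Require Import boolp classical_sets functions cardinality.
From mathcomp Require wochoice.

Set Implicit Arguments.
Unset Strict Implicit.
Unset Printing Implicit Defensive.

Local Open Scope classical_set_scope.

(* Notations for countable ordinals: [osup f] denotes the least ordinal strictly
   above all the [f n].  Every countable ordinal a > 0 is denoted by [osup f] for
   any f enumerating (with repetitions) notations for the ordinals below a.
   Notations are compared by [ole] and [olt], never by Leibniz equality: a given
   nonzero ordinal has many notations, but 0 is denoted only by [ozero]. *)
Inductive cord : Type :=
| ozero : cord
| osup : (nat -> cord) -> cord.

(* f n < osup g iff f n <= g m for some m; this is [olt] unfolded to keep the
   recursion structural. *)
Fixpoint ole (a b : cord) : Prop :=
  match a with
  | ozero => True
  | osup f => forall n,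
      match b with
      | ozero => False
      | osup g => exists m, ole (f n) (g m)
      end
  end.

Definition olt (a b : cord) : Prop :=
  match b with
  | ozero => False
  | osup g => exists m, ole a (g m)
  end.

Definition osucc (a : cord) : cord := osup (fun _ => a).

Definition oaddn (a : cord) (n : nat) : cord := iter n osucc a.

(* Formulas of L_{omega_1 omega} in the language {<=} (with equality) whose free
   variables are among x_0, ..., x_(n-1).  The quantifiers bind variable [ord0]
   and shift the others by [lift ord0].  The connectives [f_and D f] and
   [f_or D f] range over the index set [D] only, so that finite and empty ones
   are included; the values of [f] outside [D] are irrelevant. *)
Inductive formula : nat -> Type :=
| f_le n : 'I_n -> 'I_n -> formula n
| f_eq n : 'I_n -> 'I_n -> formula n
| f_not n : formula n -> formula n
| f_and n : set nat -> (nat -> formula n) -> formula n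
| f_or n : set nat -> (nat -> formula n) -> formula n
| f_all n : formula n.+1 -> formula n
| f_ex n : formula n.+1 -> formula n.

Definition sentence := formula 0.

Record structure := Structure {
  carrier :> Type;
  sle : rel carrier;
  carrier_inhabited : inhabited carrier }.

Definition env_cons (M : Type) n (x : M) (v : 'I_n -> M) (i : 'I_n.+1) : M :=
  if unlift ord0 i is Some j then v j else x.

Fixpoint sat (M : structure) n (phi : formula n) : ('I_n -> M) -> Prop :=
  match phi in formula n return ('I_n -> M) -> Prop with
  | f_le _ i j => fun v => sle (v i) (v j)
  | f_eq _ i j => fun v => v i = v j
  | f_not _ psi => fun v => ~ sat psi v
  | f_and _ D f => fun v => forall k, D k -> sat (f k) v
  | f_or _ D f => fun v => exists2 k, D k & sat (f k) v
  | f_all _ psi => fun v => forall x, sat psi (env_cons x v)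
  | f_ex _ psi => fun v => exists x, sat psi (env_cons x v)
  end.

Definition no_var (M : Type) (i : 'I_0) : M :=
  match notF (ltn_ord i) with end.

Definition models (M : structure) (phi : sentence) : Prop :=
  sat phi (@no_var M).

Inductive finitary_qf : forall n, formula n -> Prop :=
| qf_le n (i j : 'I_n) : finitary_qf (f_le i j)
| qf_eq n (i j : 'I_n) : finitary_qf (f_eq i j)
| qf_not n (phi : formula n) : finitary_qf phi -> finitary_qf (f_not phi)
| qf_and n (D : set nat) (f : nat -> formula n) :
    finite_set D -> (forall k, D k -> finitary_qf (f k)) ->
    finitary_qf (f_and D f)
| qf_or n (D : set nat) (f : nat -> formula n) :
    finite_set D -> (forall k, D k -> finitary_qf (f k)) ->
    finitary_qf (f_or D f).

Fixpoint f_alls k n : formula (k + n) -> formula n :=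
  match k return formula (k + n) -> formula n with
  | 0 => fun psi => psi
  | k'.+1 => fun psi => f_alls (f_all psi)
  end.

Fixpoint f_exs k n : formula (k + n) -> formula n :=
  match k return formula (k + n) -> formula n with
  | 0 => fun psi => psi
  | k'.+1 => fun psi => f_exs (f_ex psi)
  end.

(* Membership in the classes is syntactic.  The length [k i] of the quantified
   tuple and the bound [b i] < a may depend on the index i. *)
Inductive is_Sigma : cord -> forall n, formula n -> Prop :=
| Sigma_qf n (phi : formula n) : finitary_qf phi -> is_Sigma ozero phi
| Sigma_or a n (D : set nat) (k : nat -> nat)
    (psi : forall i, formula (k i + n)) (b : nat -> cord) :
    olt ozero a ->
    (forall i, D i -> olt (b i) a) ->
    (forall i, D i -> is_Pi (b i) (psi i)) ->
    is_Sigma a (f_or D (fun i => f_exs (psi i)))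
with is_Pi : cord -> forall n, formula n -> Prop :=
| Pi_qf n (phi : formula n) : finitary_qf phi -> is_Pi ozero phi
| Pi_and a n (D : set nat) (k : nat -> nat)
    (psi : forall i, formula (k i + n)) (b : nat -> cord) :
    olt ozero a ->
    (forall i, D i -> olt (b i) a) ->
    (forall i, D i -> is_Sigma (b i) (psi i)) ->
    is_Pi a (f_and D (fun i => f_alls (psi i))).

(* Countable includes finite. *)
Definition countable_structure (M : structure) : Prop :=
  countable [set: M].

Definition is_linear_order (M : structure) : Prop :=
  wochoice.total_order (@sle M).

Definition isomorphic (M N : structure) : Prop :=
  exists2 h : M -> N, bijective h & {mono h : x y / sle x y}.

Definition satisfiable (phi : sentence) : Prop :=
  exists M : structure, models M phi.

Definition extends_linear_orders (phi : sentence) : Prop :=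
  forall M : structure, models M phi -> is_linear_order M.

Definition is_Scott_sentence (A : structure) (phi : sentence) : Prop :=
  forall B : structure, countable_structure B ->
    (models B phi <-> isomorphic B A).

Definition has_Pi_Scott_sentence (A : structure) (a : cord) : Prop :=
  exists2 phi : sentence, is_Pi a phi & is_Scott_sentence A phi.

(* [b] denotes SR(A), the least ordinal such that A has a Pi_(b+1) Scott
   sentence. Minimality over countable ordinals is minimality over all ordinals,
   since a Pi_a formula has countably many subformulas and is thus Pi_c for a
   countable c <= a. *)
Definition is_Scott_rank (A : structure) (b : cord) : Prop :=
  has_Pi_Scott_sentence A (osucc b) /\
  (forall c, has_Pi_Scott_sentence A (osucc c) -> ole b c).

(* Main.v *)
(** The model [B] is built by forcing. Fix a countable model [A] of [T]. A condition
    names finitely many points and promises, for each gap between them, an interval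
    of [A] (or a finite sum of such intervals) whose Pi_alpha theory the gap is going to
    satisfy; it is strengthened by adding points and replacing intervals by sums
    that are larger in the back-and-forth order <=_alpha. A sufficiently generic sequence
    of conditions yields an order [B] on a set of rationals, with A <=_alpha B, hence B
    satisfies [T].

    Let x < y in [B] have the same (alpha+2)-type. The gaps ]-oo, x[ and ]x, y[ are
    generic over each other, while ]-oo, x[ and ]-oo, y[ realize the same conditions,
    so that each piece of ]x, y[ realizes only conditions realized somewhere disjoint
    from it. Mutual genericity then forces any two strengthenings of these conditions
    to be compatible: the interval is "good", and it is determined up to isomorphism
    by one condition. Comparing the final segments from [x] and [y], one finds that if
    the interval on the right of [y] is not good, then it begins with omega many
    copies of ]x, y[, and so is unchanged when ]x, y[ is added on its left.
    Hence tuples related by <=_(alpha+2) on all gaps are automorphic. By Karp's theorem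
    every tuple then has its orbit isolated by a Pi_(alpha+2) formula, and the
    back-and-forth conditions on these formulas form a Pi_(alpha+4) Scott sentence. *)

From HB Require Import structures.
From mathcomp Require Import all_boot all_order ssralg ssrnum rat.
From mathcomp Require Import boolp classical_sets functions cardinality.
Require Import Defs.

Set Implicit Arguments.
Unset Strict Implicit.
Unset Printing Implicit Defensive.

(** The level alpha+2 is the cost of one argument. An interval of [B] realizes a word when the
    letters lie below the pieces of some cut of it at level alpha; this passes from one interval to
    another along <=_(alpha+1). The pieces to be compared come from pulling a cut of an initial or
    final segment back, which takes <=_(alpha+2). The relations are not symmetric, and this shapes
    the rest. A condition lies below its interval at level alpha, but above it only at lower levels,
    so an instance of <=_alpha that holds in [B] has to be shown to be forced. For two related
    points, cuts can be pulled back only from the larger segment to the smaller one: initial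
    segments serve when the second point is on the right of the first, final segments when it is on
    the left. Hence the isolating formulas have to control both unbounded segments of every
    point. *)

(** * Ordinal notations *)

Lemma ole_refl a : ole a a.
Proof. by elim: a => [//|f IH] /= n; exists n. Qed.

Lemma ole_trans a b c : ole a b -> ole b c -> ole a c.
Proof.
elim: a b c => [//|f IH] [|g] c /= ab bc n; first by case: (ab n).
case: c bc => [|h] bc; first by have [m _] := ab n; case: (bc m).
have [m fg] := ab n; have [k gh] := bc m; exists k; exact: IH fg gh.
Qed.

Lemma olt_ole_trans a b c : olt a b -> ole b c -> olt a c.
Proof.
case: b => // g [m am]; case: c => [|h] /= H; first by case: (H m).
by have [k gh] := H m; exists k; exact: ole_trans am gh.
Qed.

Lemma ole_olt_trans a b c : ole a b -> olt b c -> olt a c.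
Proof. by case: c => // h ab [m bm]; exists m; exact: ole_trans ab bm. Qed.

Lemma ole_osup_gen a b : (forall g, b = osup g -> exists m, ole a (g m)) ->
  b <> ozero -> ole a b.
Proof.
elim: a b => // f IH [|g] // H _ n /=.
have [m fg] := H g erefl; exists m.
apply: IH; last by move=> E; move: fg; rewrite E /= => /(_ 0).
move=> h E; move: fg; rewrite E /= => /(_ n) [k fk]; by exists k.
Qed.

Lemma olt_ole a b : olt a b -> ole a b.
Proof.
case: b => // g [m am]; apply: ole_osup_gen => // h [<-]; by exists m.
Qed.

Lemma olt_trans a b c : olt a b -> olt b c -> olt a c.
Proof. by move=> ab bc; apply: ole_olt_trans (olt_ole ab) bc. Qed.

Lemma olt_osup f n : olt (f n) (osup f).
Proof. by exists n; exact: ole_refl. Qed.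

Lemma olt_osucc a : olt a (osucc a).
Proof. by exists 0; exact: ole_refl. Qed.

Lemma olt0_osup f : olt ozero (osup f). Proof. by exists 0. Qed.

Lemma ole_total a b : ole a b \/ olt b a.
Proof.
have [H|H] := pselect (ole a b); [by left | right].
elim: a b H => [|f IH] b H; first by case: H.
have /existsNP [n Hn] : ~ forall n, olt (f n) b.
  by move=> K; apply: H => n; case: b K {IH} => [|g] /(_ n).
exists n; case: b {H} Hn => [|g] //= Hn m.
have /IH : ~ ole (f n) (g m) by move=> K; apply: Hn; exists m.
by case: (f n) => [|h] //= [k Hk]; exists k.
Qed.

Lemma ole_wf_min (P : cord -> Prop) a : P a ->
  exists2 b, P b & forall c, P c -> ole b c.
Proof.
move=> Pa.
have [//|H] := pselect (exists2 b, P b & forall c, P c -> ole b c).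
suff K : forall a b, ole b a -> ~ P b by case: (K a a (ole_refl a)).
elim=> [|f IH] b ba Pb; apply: H; exists b => // c Pc; have [//|cb] := ole_total b c.
  by have := olt_ole_trans cb ba.
by have [m cm] := olt_ole_trans cb ba; case: (IH m c cm).
Qed.

(** * Sums of intervals and back-and-forth relations *)

Fixpoint all2P T U (R : T -> U -> Prop) (s : seq T) (t : seq U) : Prop :=
  match s, t with
  | [::], [::] => True
  | x :: s', y :: t' => R x y /\ all2P R s' t'
  | _, _ => False
  end.

Lemma all2P_cat T U (R : T -> U -> Prop) s1 s2 t1 t2 :
  all2P R s1 t1 -> all2P R s2 t2 -> all2P R (s1 ++ s2) (t1 ++ t2).
Proof. by elim: s1 t1 => [|x s IH] [|y t] //= [? ?] ?; split => //; apply: IH. Qed.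

Lemma all2P_catl T U (R : T -> U -> Prop) s1 s2 t :
  all2P R (s1 ++ s2) t ->
  exists t1 t2, [/\ t = t1 ++ t2, all2P R s1 t1 & all2P R s2 t2].
Proof.
elim: s1 t => [|x s IH] t /=; first by exists [::], t.
by case: t => // y t [Rxy] /IH [t1 [t2 [-> H1 H2]]]; exists (y :: t1), t2.
Qed.

Lemma all2P_impl T U (R R' : T -> U -> Prop) s t :
  (forall x y, R x y -> R' x y) -> all2P R s t -> all2P R' s t.
Proof. by move=> H; elim: s t => [|x s IH] [|y t] //= [/H ? /IH ?]. Qed.

Lemma all2P_trans T U V (R : T -> U -> Prop) (R' : U -> V -> Prop)
    (R'' : T -> V -> Prop) s t u :
  (forall x y z, R x y -> R' y z -> R'' x z) ->
  all2P R s t -> all2P R' t u -> all2P R'' s u.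
Proof.
move=> H; elim: s t u => [|x s IH] [|y t] [|z u] //= [a b] [c d]; split; first exact: H a c.
exact: IH b d.
Qed.

Lemma all2P_sym T U (R : T -> U -> Prop) s t :
  all2P R s t -> all2P (fun y x => R x y) t s.
Proof. by elim: s t => [|x s IH] [|y t] //= [? /IH]. Qed.

Lemma all2P_refl T (R : T -> T -> Prop) s : (forall x, R x x) -> all2P R s s.
Proof. by move=> H; elim: s => //= x s IH; split. Qed.

Lemma all2P_mapl T T' U (f : T' -> T) (R : T -> U -> Prop) s t :
  all2P R (map f s) t <-> all2P (fun x y => R (f x) y) s t.
Proof. by elim: s t => [|x s IH] [|y t] //=; rewrite IH. Qed.

Lemma all2P_mapr T U U' (f : U' -> U) (R : T -> U -> Prop) s t :
  all2P R s (map f t) <-> all2P (fun x y => R x (f y)) s t.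
Proof. by elim: s t => [|x s IH] [|y t] //=; rewrite IH. Qed.

Fixpoint ForallP T (P : T -> Prop) (s : seq T) : Prop :=
  if s is x :: s' then P x /\ ForallP P s' else True.

Definition nemp T (s : seq T) := ~~ nilp s.

Lemma nemp_cat T (s t : seq T) : nemp (s ++ t) = nemp s || nemp t.
Proof. by case: s. Qed.

Lemma flatten_nil T (gs : seq (seq T)) : all (@nemp T) gs -> flatten gs = [::] -> gs = [::].
Proof. by case: gs => [|[|x g] gs]. Qed.

(** The seam between [u] and [v] is a group boundary or falls inside a group. In the second case the
    tuple given by the groups does not contain the point added between the two summands. *)
Lemma flatten_eq_cat T (gs : seq (seq T)) u v :
  all (@nemp T) gs -> flatten gs = u ++ v ->
  (exists gs1 gs2, [/\ gs = gs1 ++ gs2, flatten gs1 = u & flatten gs2 = v]) \/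
  (exists gs1 g1 g2 gs2, [/\ gs = gs1 ++ (g1 ++ g2) :: gs2, nemp g1, nemp g2,
      u = flatten gs1 ++ g1 & v = g2 ++ flatten gs2]).
Proof.
elim: gs u v => [|g gs IH] u v /=.
  by case: u => // _ /= <-; left; exists [::], [::].
case/andP=> ng ngs E.
elim: g u ng E => // x g IHg [|y u] _ /= E.
  by left; exists [::], ((x :: g) :: gs).
case: E => -> E; case: g IHg E => [_|z g IHg] /= E.
  have [[gs1 [gs2 [-> <- <-]]]|[gs1 [g1 [g2 [gs2 [-> n1 n2 -> ->]]]]]] := IH _ _ ngs E.
    by left; exists ([:: y] :: gs1), gs2.
  by right; exists ([:: y] :: gs1), g1, g2, gs2.
have [[[|g' gs1] [gs2 [/= E1 <- <-]]]|[[|g' gs1] [g1 [g2 [gs2 [/= [E1 E2] n1 n2 -> ->]]]]]] := IHg _ isT E.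
- by right; exists [::], [:: y], (z :: g), gs; case: gs2 E1 => // _ _ [<- <-].
- by case: E1 => <- ->; left; exists ((y :: z :: g) :: gs1), gs2.
- by right; exists [::], (y :: g1), g2, gs; rewrite E2 E1 n2.
- by right; exists ((y :: z :: g) :: gs1), g1, g2, gs2; rewrite -E1 E2.
Qed.

(* A chain is a linear order together with virtual points, outside [cin], which
   only serve as bounds of intervals: -oo and +oo, or the rationals 0 and 1. *)
Record chain := Chain {
  pt :> Type;
  clt : pt -> pt -> Prop;
  cin : pt -> Prop;
  clt_irr : forall x, ~ clt x x;
  clt_trans : forall x y z, clt x y -> clt y z -> clt x z;
  clt_total : forall x y, [\/ clt x y, x = y | clt y x] }.

(* The letter [(x, y)] denotes the open interval from [x] to [y]. A word denotes the
   sum of its letters with one extra point between consecutive letters, so that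
   cutting a letter at a point of [cin] does not change the sum. *)
Definition letter (C : chain) := (C * C)%type.
HB.instance Definition _ C := gen_eqMixin (letter C).
Definition word C := seq (letter C).

Inductive cutw (C : chain) : word C -> word C -> Prop :=
| cut_nil : cutw [::] [::]
| cut_keep s w u : cutw w u -> cutw (s :: w) (s :: u)
| cut_at x y z w u : cin z -> clt x z -> clt z y -> cutw ((z, y) :: w) u ->
    cutw ((x, y) :: w) ((x, z) :: u).
Arguments cut_nil {C}.

Section Cuts.
Variable C : chain.
Implicit Types (w u v t : word C) (s : letter C).

Lemma cutw_refl w : cutw w w.
Proof. by elim: w => [|s w IH]; constructor. Qed.

Lemma cutw_cat w w' u u' : cutw w u -> cutw w' u' -> cutw (w ++ w') (u ++ u').
Proof.
move=> H K; elim: H => //= [s w0 u0 _|x y z w0 u0 cz xz zy _] IH; first exact: cut_keep.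
exact: cut_at.
Qed.

Lemma cutw_nill u : cutw [::] u -> u = [::].
Proof. by move=> H; inversion H. Qed.

Lemma cutw_nilr w : cutw w [::] -> w = [::].
Proof. by move=> H; inversion H. Qed.

Lemma cutw_consl s w v : cutw (s :: w) v ->
  exists v1 v2, [/\ v = v1 ++ v2, nemp v1, cutw [:: s] v1 & cutw w v2].
Proof.
move=> H; move E : (s :: w) H => w1 H.
elim: H s w E => // [s0 w0 u0 H IH s w [-> ->]|x y z w0 u0 cz xz zy H IH s w [-> ->]].
  by exists [:: s0], u0; split => //; apply: cutw_refl.
have [v1 [v2 [-> n1 H1 H2]]] := IH _ _ erefl.
by exists ((x, z) :: v1), v2; split => //; apply: cut_at.
Qed.

Lemma cutw_catl w1 w2 v : cutw (w1 ++ w2) v ->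
  exists v1 v2, [/\ v = v1 ++ v2, cutw w1 v1 & cutw w2 v2].
Proof.
elim: w1 v => [|s w1 IH] v /=; first by exists [::], v; split => //; constructor.
case/cutw_consl=> v1 [v2 [-> n1 H1 /IH [v3 [v4 [-> H3 H4]]]]].
by exists (v1 ++ v3), v4; split; rewrite ?catA //; apply: (cutw_cat H1 H3).
Qed.

Lemma cutw_unflatten w v : cutw w v ->
  exists us, [/\ v = flatten us, all (@nemp _) us & all2P (fun s u => cutw [:: s] u) w us].
Proof.
elim: w v => [|s w IH] v; first by move/cutw_nill->; exists [::].
case/cutw_consl=> v1 [v2 [-> n1 H1 /IH [us [-> n H]]]].
by exists (v1 :: us); rewrite /= n1.
Qed.

Lemma cutw_extend x z y w v1 v2 : cin z -> clt x z -> clt z y ->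
  cutw [:: (x, z)] v1 -> cutw ((z, y) :: w) v2 -> cutw ((x, y) :: w) (v1 ++ v2).
Proof.
move=> cz xz zy H K; elim: v1 x xz H => [|l v1 IH] x xz H; first by inversion H.
inversion H as [|s' w' v0 K1 E1 E2|x' y' c w' v0 cc ac cb K1 E1 E2]; subst.
  by move/cutw_nill: K1 => -> /=; apply: cut_at.
by apply: cut_at => //; [apply: clt_trans zy | apply: IH].
Qed.

Lemma cutw_trans w u v : cutw w u -> cutw u v -> cutw w v.
Proof.
move=> H; elim: H v => // [s w0 u0 _ IH v|x y z w0 u0 cz xz zy H IH v].
  by case/cutw_consl=> v1 [v2 [-> _ H1 /IH H2]]; apply: cutw_cat H1 H2.
by case/cutw_consl=> v1 [v2 [-> _ H1 /IH {}IH]]; apply: cutw_extend IH.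
Qed.

Lemma cutw_amalg w u v : cutw w u -> cutw w v -> exists2 t, cutw u t & cutw v t.
Proof.
(* The total size is the measure because, when only one side cuts the first letter, the other word
   keeps its length. *)
have [n] := ubnP (size u + size v); elim: n w u v => // n IH w u v sz H.
case: H sz => [sz /cutw_nill->|s w0 u0 H sz K|x y z w0 u0 cz xz zy H sz K].
- by exists [::]; constructor.
- inversion K as [|s' w' v0 K1|a b c w' v0 cc ac cb K1]; subst.
    have [|t t1 t2] := IH _ _ _ _ H K1.
      by move: sz; rewrite /= addnS addSn !ltnS => /ltnW.
    by exists (s :: t); apply: cut_keep.
  have [|t t1 t2] := IH _ _ _ _ (cut_keep (c, b) H) K1.
    by move: sz; rewrite /= !addnS !addSn.
  by exists ((a, c) :: t); [apply: cut_at | apply: cut_keep].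
- inversion K as [|s' w' v0 K1|a b c w' v0 cc ac cb K1]; subst.
    have [|t t1 t2] := IH _ _ _ _ H (cut_keep (z, y) K1).
      by move: sz; rewrite /= !addnS !addSn.
    by exists ((x, z) :: t); [apply: cut_keep | apply: cut_at].
  have [zc|E|cz'] := clt_total z c.
  + have [|t t1 t2] := IH _ _ _ _ H (cut_at cc zc cb K1).
      by move: sz; rewrite /= !addnS !addSn.
    by exists ((x, z) :: t); [apply: cut_keep | apply: cut_at].
  + subst c; have [|t t1 t2] := IH _ _ _ _ H K1.
      by move: sz; rewrite /= addnS addSn !ltnS => /ltnW.
    by exists ((x, z) :: t); apply: cut_keep.
  + have [|t t1 t2] := IH _ _ _ _ (cut_at cz cz' zy H) K1.
      by move: sz; rewrite /= !addnS !addSn.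
    by exists ((x, c) :: t); [apply: cut_at | apply: cut_keep].
Qed.

Lemma cutw1_cat (x y : C) (a b : word C) : cutw [:: (x, y)] (a ++ b) -> nemp a -> nemp b ->
  exists z, [/\ cin z, clt x z, clt z y, cutw [:: (x, z)] a & cutw [:: (z, y)] b].
Proof.
elim: a x => // s a IH x /= H _ nb.
inversion H as [|s' w' v0 K1 E1 E2|x' y' z w' v0 cc ac cb K1 E1 E2]; subst.
  by move/cutw_nill: K1 nb; case: a {IH H} => //; case: b.
case: a IH H K1 => [|s2 a] IH H K1 /=.
  by exists z; split => //; apply: cutw_refl.
have [z' [cz' zz' z'y H1 H2]] := IH _ K1 isT nb.
exists z'; split => //; first exact: clt_trans zz'.
exact: cut_at.
Qed.

(** Inside one letter the group boundaries are points of the chain, so they form a coarser cut. On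
    actual intervals, groups can thus be traded for letters. *)
Lemma cutw1_groups s (gs : seq (word C)) : cutw [:: s] (flatten gs) -> all (@nemp _) gs ->
  exists2 ls, cutw [:: s] ls & all2P (fun l g => cutw [:: l] g) ls gs.
Proof.
elim: gs s => [|g gs IH] s; first by move/cutw_nilr.
case: gs IH => [_|g' gs IH] /=.
  by rewrite cats0 => H _; exists [:: s]; [apply: cutw_refl | split].
case: s => x y H /andP [ng ngs].
have [||z [cz xz zy H1 H2]] := cutw1_cat H => //.
  by case/andP: ngs; case: g' {IH H}.
have [ls L1 L2] := IH _ H2 ngs.
by exists ((x, z) :: ls); [apply: cut_at | split].
Qed.

Lemma flatten_seq1 T (w : seq T) : flatten (map (fun l => [:: l]) w) = w.
Proof. by elim: w => //= s w ->. Qed.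

Lemma nemp_seq1 T (w : seq T) : all (@nemp _) (map (fun l => [:: l]) w).
Proof. by elim: w. Qed.

End Cuts.

(* [bf a w w']: every Pi_a sentence true in the sum [w] holds in the sum [w'].
   A grouping of a cut of a word is a finite tuple in the corresponding sum,
   the groups being the intervals determined by the tuple. *)
Fixpoint bf (a : cord) (C D : chain) (w : word C) (w' : word D) {struct a} : Prop :=
  match a with
  | ozero => True
  | osup f => forall n gs', all (@nemp _) gs' -> cutw w' (flatten gs') ->
      exists gs, [/\ all (@nemp _) gs, cutw w (flatten gs) &
        all2P (fun g' g => bf (f n) g' g) gs' gs]
  end.

Lemma bf_mono a b (C D : chain) (w : word C) (w' : word D) :
  ole a b -> bf b w w' -> bf a w w'.
Proof.
elim: a b C D w w' => [|f IH] b C D w w' ab; first by [].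
case: b ab => [|g] ab; first by case: (ab 0).
move=> H n gs' ng cg; have [m fg] := ab n.
have [gs [ngs cgs R]] := H m gs' ng cg; exists gs; split => //.
by apply: all2P_impl R => g1 g2; apply: IH fg.
Qed.

Lemma bf_refl a (C : chain) (w : word C) : bf a w w.
Proof.
elim: a C w => [*|f IH C w n gs ng cg]; first exact: I.
 exists gs; split => //.
by apply: all2P_refl => g; exact: IH.
Qed.

Lemma bf_trans a (C D E : chain) (w1 : word C) (w2 : word D) (w3 : word E) :
  bf a w1 w2 -> bf a w2 w3 -> bf a w1 w3.
Proof.
elim: a C D E w1 w2 w3 => [*|f IH C D E w1 w2 w3 H12 H23 n gs3 n3 c3]; first exact: I.
have [gs2 [n2 c2 R2]] := H23 n gs3 n3 c3.
have [gs1 [n1 c1 R1]] := H12 n gs2 n2 c2.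
exists gs1; split => //; apply: all2P_trans R2 R1 => x y z; exact: IH.
Qed.

Lemma cutw_flatten_groups (C : chain) (gs : seq (word C)) t : cutw (flatten gs) t ->
  exists hs, t = flatten hs /\ all2P (@cutw C) gs hs.
Proof.
elim: gs t => [|g gs IH] t /=; first by move/cutw_nill->; exists [::].
case/cutw_catl=> v1 [v2 [-> H1 /IH [hs [-> H2]]]].
by exists (v1 :: hs).
Qed.

Lemma nemp_cutw (C : chain) (g h : word C) : cutw g h -> nemp g -> nemp h.
Proof. by case. Qed.

Lemma nemp_groups (C : chain) (gs hs : seq (word C)) :
  all2P (@cutw C) gs hs -> all (@nemp _) gs -> all (@nemp _) hs.
Proof.
elim: gs hs => [|g gs IH] [|h hs] //= [c /IH H] /andP [n /H ->].
by rewrite (nemp_cutw c).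
Qed.

Lemma bf_cut a (C : chain) (w u : word C) : cutw w u -> bf a w u.
Proof.
case: a => [_|f wu n gs' ng cg]; [exact: I | exists gs'; split => //].
  exact: cutw_trans cg.
by apply: all2P_refl => x; apply: bf_refl.
Qed.

Lemma bf_uncut a (C : chain) (w u : word C) : cutw w u -> bf a u w.
Proof.
case: a => [_|f wu n gs' ng cg]; first exact: I.
have [t /cutw_flatten_groups [hs [-> H1]] H2] := cutw_amalg cg wu.
exists hs; split => //; first exact: nemp_groups ng.
by apply: all2P_impl H1 => x y; apply: bf_cut.
Qed.

(** The grouping with a single group plays the empty tuple: its answer compares the two sums in the
    other direction, at any lower level. *)
Lemma bf_drop a b (C D : chain) (w : word C) (w' : word D) : nemp w' ->
  olt b a -> bf a w w' -> bf b w' w.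
Proof.
case: a => [|f] nw; [by case | case=> m bf H].
have [|/=|gs [ng cg]] := H m [:: w']; first by rewrite /= nw.
  by rewrite cats0; apply: cutw_refl.
case: gs ng cg => [|g [|g2 gs]] ng cg /=; [by [] | | by case].
by rewrite /= cats0 in cg; case=> L _; apply: bf_trans (bf_mono bf L) (bf_uncut _ cg).
Qed.

Lemma bf_cat a (C D : chain) (w1 w2 : word C) (v1 v2 : word D) :
  bf a w1 v1 -> bf a w2 v2 -> bf a (w1 ++ w2) (v1 ++ v2).
Proof.
elim: a C D w1 w2 v1 v2 => [*|f IH C D w1 w2 v1 v2 L1 L2 n gs' ng]; first exact: I.
case/cutw_catl=> u1 [u2 [E c1 c2]].
have [[gs1 [gs2 [E0 E1 E2]]]|[gs1 [g1 [g2 [gs2 [E0 ng1 ng2 E1 E2]]]]]] := flatten_eq_cat ng E.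
  subst; move: ng; rewrite all_cat => /andP [n1 n2].
  have [hs1 [m1 d1 R1]] := L1 n gs1 n1 c1; have [hs2 [m2 d2 R2]] := L2 n gs2 n2 c2.
  exists (hs1 ++ hs2); split; first by rewrite all_cat m1.
    by rewrite flatten_cat; apply: cutw_cat.
  exact: all2P_cat.
(* The seam splits a group; the answers to its two halves are glued back into one group, compared by
   the induction hypothesis. *)
subst; move: ng; rewrite all_cat /= => /and3P [n1 _ n2].
have [||hs1 [m1 d1 R1]] := L1 n (gs1 ++ [:: g1]).
- by rewrite all_cat n1 /= ng1.
- by rewrite flatten_cat /= cats0.
have [||hs2 [m2 d2 R2]] := L2 n (g2 :: gs2) => //; first by rewrite /= ng2.
have [k1 [k2 [E3 S1 S2]]] := all2P_catl R1; subst.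
case: k2 S2 m1 d1 R1 => [[]//|h1 [|? ?] [S2 //]] _ m1 d1 _.
case: hs2 R2 m2 d2 => // h2 k2 [S3 S4] m2 d2.
exists (k1 ++ (h1 ++ h2) :: k2); split.
- move: m1 m2; rewrite !all_cat /= nemp_cat => /and3P [-> -> _] /andP [_ ->]; by [].
- move: d1 d2; rewrite !flatten_cat /= cats0 => d1 d2.
  by rewrite -catA; have := cutw_cat d1 d2; rewrite -!catA.
- by apply: all2P_cat => //=; split => //; apply: IH.
Qed.

Lemma bf_groups a (C D : chain) (gs : seq (word C)) (hs : seq (word D)) :
  all2P (fun g h => bf a g h) gs hs -> bf a (flatten gs) (flatten hs).
Proof.
elim: gs hs => [|g gs IH] [|h hs] //=; last by case=> L /IH; apply: bf_cat.
case: a => [|f] _; first exact: I.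
move=> n [|g gs] ng /cutw_nill; first by exists [::]; split => //; exact: cut_nil.
by move/(flatten_nil ng).
Qed.

Lemma bf_path (f : nat -> cord) n (C D : chain) (w : word C) (x y : D) ls :
  bf (osup f) w [:: (x, y)] -> cutw [:: (x, y)] ls ->
  exists gs, [/\ all (@nemp _) gs, cutw w (flatten gs) &
    all2P (fun l g => bf (f n) [:: l] g) ls gs].
Proof.
move=> L cl; have [||gs [ng cg R]] := L n (map (fun l => [:: l]) ls).
- exact: nemp_seq1.
- by rewrite flatten_seq1.
by exists gs; split => //; apply/all2P_mapl.
Qed.

Lemma bf_path1 a b (C D : chain) (s : letter C) (t : letter D) ls :
  olt b a -> bf a [:: s] [:: t] -> cutw [:: t] ls ->
  exists2 ks, cutw [:: s] ks & all2P (fun l k => bf b [:: l] [:: k]) ls ks.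
Proof.
case: a => [|f]; [by case | case=> n bf L cl]; case: t L cl => x y L cl.
have [gs [ng cg R]] := bf_path n L cl.
have [ks ck K] := cutw1_groups cg ng; exists ks => //.
apply: all2P_trans R (all2P_sym K) => l g k H1 H2.
exact: bf_trans (bf_mono bf H1) (bf_uncut _ H2).
Qed.

(** * Bisimilar intervals *)

Section Bisimulation.
Variable C : chain.

Definition bisim (R : C -> C -> C -> C -> Prop) := forall x y x' y', R x y x' y' ->
  (forall z, cin z -> clt x z -> clt z y -> exists z',
     [/\ cin z', clt x' z', clt z' y', R x z x' z' & R z y z' y']) /\
  (forall z', cin z' -> clt x' z' -> clt z' y' -> exists z,
     [/\ cin z, clt x z, clt z y, R x z x' z' & R z y z' y']).

(** The greatest bisimulation. Between countable intervals it amounts to isomorphism, and it spares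
    the construction of automorphisms. *)
Definition bis x y x' y' := exists2 R, bisim R & R x y x' y'.

Lemma bisim_bis : bisim bis.
Proof.
move=> x y x' y' [R HR r]; have [F G] := HR _ _ _ _ r.
by split=> z cz xz zy; [have [z' [? ? ? ? ?]] := F z cz xz zy | have [z' [? ? ? ? ?]] := G z cz xz zy];
  exists z'; split => //; exists R.
Qed.

Lemma bis_refl x y : bis x y x y.
Proof.
exists (fun x y x' y' => x = x' /\ y = y') => // a b _ _ [<- <-].
by split=> z cz az zb; exists z.
Qed.

Lemma bis_sym x y x' y' : bis x y x' y' -> bis x' y' x y.
Proof.
case=> R HR r; exists (fun a b a' b' => R a' b' a b) => // a b a' b' /HR [F G].
by split => z cz az zb; [apply: G | apply: F].
Qed.

Lemma bis_trans x y x' y' x'' y'' : bis x y x' y' -> bis x' y' x'' y'' -> bis x y x'' y''.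
Proof.
move=> H K; exists (fun a b a'' b'' => exists a' b', bis a b a' b' /\ bis a' b' a'' b''); last first.
  by exists x', y'.
move=> a b a'' b'' [a' [b' [/bisim_bis [F G] /bisim_bis [F' G']]]]; split=> z cz az zb.
  have [z' [cz' az' zb' l r]] := F z cz az zb.
  have [z'' [cz'' az'' zb'' l' r']] := F' z' cz' az' zb'.
  by exists z''; split => //; [exists a', z' | exists z', b'].
have [z' [cz' az' zb' l r]] := G' z cz az zb.
have [z'' [cz'' az'' zb'' l' r']] := G z' cz' az' zb'.
by exists z''; split => //; [exists a', z' | exists z', b'].
Qed.

Lemma bis_cat x m y x' m' y' : cin m -> cin m' -> clt x m -> clt m y ->
  clt x' m' -> clt m' y' -> bis x m x' m' -> bis m y m' y' -> bis x y x' y'.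
Proof.
move=> cm cm' xm my xm' my' B1 B2.
(* Bisimilarity up to one pair of matched inner points: after a move, the pair remains inside one of
   the two new intervals, unless the pair itself is played. *)
pose R a b a' b' := bis a b a' b' \/ exists m m',
  [/\ cin m, cin m', clt a m, clt m b & [/\ clt a' m', clt m' b', bis a m a' m' & bis m b m' b']].
exists R; last by right; exists m, m'.
move=> {x m y x' m' y' cm cm' xm my xm' my' B1 B2} x y x' y' [/bisim_bis [F G]|].
  by split=> z cz xz zy; [have [z' [? ? ? ? ?]] := F z cz xz zy | have [z' [? ? ? ? ?]] := G z cz xz zy];
    exists z'; split => //; left.
case=> m [m' [cm cm' xm my [xm' my' B1 B2]]].
have [F1 G1] := bisim_bis B1; have [F2 G2] := bisim_bis B2.
split=> z cz xz zy.
  have [zm|E|mz] := clt_total z m.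
  - have [z' [cz' xz' zy' l r]] := F1 z cz xz zm; exists z'; split => //; last 2 first.
    + by left.
    + by right; exists m, m'.
    exact: clt_trans zy' my'.
  - by subst z; exists m'; split => //; left.
  - have [z' [cz' xz' zy' l r]] := F2 z cz mz zy; exists z'; split => //; last 2 first.
    + by right; exists m, m'.
    + by left.
    exact: clt_trans xm' xz'.
have [zm|E|mz] := clt_total z m'.
- have [z' [cz' xz' zy' l r]] := G1 z cz xz zm; exists z'; split => //; last 2 first.
  + by left.
  + by right; exists m, m'.
  exact: clt_trans zy' my.
- by subst z; exists m; split => //; left.
- have [z' [cz' xz' zy' l r]] := G2 z cz mz zy; exists z'; split => //; last 2 first.
  + by right; exists m, m'.
  + by left.
  exact: clt_trans xm xz'.
Qed.

Definition shifted x y r := exists q : nat -> C, forall i,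
  [/\ cin (q i), clt x (q i), clt y (q i.+1), clt (q i) (q i.+1) & [/\ clt (q i) r,
      bis x (q i) y (q i.+1) & bis (q i) (q i.+1) (q i.+1) (q i.+2)]].

(* The isomorphism moves each [q i] to [q i.+1] and fixes every point above all of them. *)
Lemma bis_shifted x y r : shifted x y r -> bis x r y r.
Proof.
move=> S; exists (fun a b a' b' => bis a b a' b' \/ b = b' /\ shifted a a' b); last by right.
move=> {x y r S} x r y r' [/bisim_bis [F G]|[<- [q Q]]].
  by split=> z cz xz zy; [have [z' [? ? ? ? ?]] := F z cz xz zy | have [z' [? ? ? ? ?]] := G z cz xz zy];
    exists z'; split => //; left.
(* After a move below [q i], what lies on the right is again shifted, along the sequence restarted
   at [q i]. *)
have tail z z' i : cin z -> cin z' -> clt z (q i) -> clt z' (q i.+1) ->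
    bis z (q i) z' (q i.+1) -> shifted z z' r.
  move=> cz cz' zq zq' H; exists (fun k => q (i + k)) => k.
  have lt1 j : clt z (q (i + j)).
    by elim: j => [|j IH]; rewrite ?addn0 // addnS; apply: clt_trans IH _; case: (Q (i + j)).
  have lt2 j : clt z' (q (i + j).+1).
    by elim: j => [|j IH]; rewrite ?addn0 // addnS; apply: clt_trans IH _; case: (Q (i + j).+1).
  rewrite !addnS; case: (Q (i + k)) => c1 _ _ c2 [c3 _ c4]; split => //; split => //.
  elim: k {c1 c2 c3 c4} => [|k IH]; first by rewrite addn0.
  rewrite addnS; case: (Q (i + k)) => d1 _ _ d2 [d3 _ d4].
  case: (Q (i + k).+1) => e1 _ _ e2 _.
  exact: (bis_cat d1 e1 (lt1 k) d2 (lt2 k) e2 IH d4).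
split=> z cz xz zr.
  have [[i zi]|N] := pselect (exists i, clt z (q i)).
    case: (Q i) => c1 c2 c3 c4 [c5 /bisim_bis [F _] c6].
    have [z' [cz' yz' zq' l rr]] := F z cz xz zi; exists z'; split => //; last 2 first.
    + by left.
    + by right; split => //; apply: tail zq' rr.
    by apply: clt_trans zq' _; case: (Q i.+1) => _ _ _ _ [].
  have qz i : clt (q i) z.
    case: (Q i) => _ _ _ c _; have [zq|->//|qz] := clt_total z (q i.+1).
      by case: N; exists i.+1.
    exact: clt_trans c qz.
  exists z; split => //.
  - by apply: clt_trans (qz 1%N); case: (Q 0%N).
  - right; split => //; exists q => i; case: (Q i) => ? ? ? ? [? ? ?]; split => //.
  - by left; apply: bis_refl.
have [[i zi]|N] := pselect (exists i, clt z (q i.+1)).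
  case: (Q i) => c1 c2 c3 c4 [c5 /bisim_bis [_ G] c6].
  have [z' [cz' xz' zq' l rr]] := G z cz xz zi; exists z'; split => //; last 2 first.
  + by left.
  + by right; split => //; apply: tail zq' zi rr.
  exact: clt_trans zq' c5.
have qz i : clt (q i) z.
  case: (Q i) => _ _ _ c _; have [zq|->//|qz] := clt_total z (q i.+1).
    by case: N; exists i.
  exact: clt_trans c qz.
exists z; split => //.
- by apply: clt_trans (qz 0%N); case: (Q 0%N).
- right; split => //; exists q => i; case: (Q i) => ? ? ? ? [? ? ?]; split => //.
- by left; apply: bis_refl.
Qed.

(* The intervals from [x] and from [y] both start with omega many copies of the
   interval from [x] to [y], followed by the same rest. *)
Lemma bis_absorb x y r (q : nat -> C) : q 0 = y -> clt x y ->
  (forall i, [/\ cin (q i), clt (q i) (q i.+1), clt (q i) r & bis (q i) (q i.+1) x y]) ->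
  bis x r y r.
Proof.
move=> q0 xy Q; apply: bis_shifted; exists q => i.
have xq j : clt x (q j).
  by elim: j => [|j IH]; [rewrite q0 | apply: clt_trans IH _; case: (Q j)].
have yq j : clt y (q j.+1).
  by elim: j => [|j IH]; [rewrite -q0; case: (Q 0) | apply: clt_trans IH _; case: (Q j.+1)].
have step j : bis (q j) (q j.+1) (q j.+1) (q j.+2).
  by case: (Q j) (Q j.+1) => _ _ _ H [_ _ _ K]; apply: bis_trans H (bis_sym K).
case: (Q i) => c1 c2 c3 c4; split => //; split => //.
elim: i {c1 c2 c3 c4} => [|i IH]; first by rewrite q0 -q0; case: (Q 0) => _ _ _ H; rewrite {1}q0; apply: bis_sym.
case: (Q i) (Q i.+1) => d1 d2 _ _ [e1 e2 _ _].
exact: (bis_cat d1 e1 (xq i) d2 (yq i) e2 IH (step i)).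
Qed.

End Bisimulation.

(** Reversal turns absorption at the left end of an interval into absorption at its right end. *)
Definition rev_chain (C : chain) : chain :=
  @Chain C (fun x y => clt y x) (@cin C) (@clt_irr C)
    (fun x y z xy yz => clt_trans yz xy)
    (fun x y => match clt_total x y with
                | Or31 h => Or33 _ _ h | Or32 h => Or32 _ _ h | Or33 h => Or31 _ _ h end).

Lemma bis_rev (C : chain) (x y x' y' : C) : @bis (rev_chain C) y x y' x' -> bis x y x' y'.
Proof.
case=> R HR r; exists (fun a b a' b' => R b a b' a') => // a b a' b' /HR [F G].
split=> z cz az zb; [have [z' [? ? ? ? ?]] := F z cz zb az | have [z' [? ? ? ? ?]] := G z cz zb az];
  by exists z'.
Qed.

(** * The forcing relation on words *)

Section Forcing.
Variables (al : cord) (A : chain).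
Implicit Types (u v w : word A).

(* Conditions are strengthened by replacing each letter by a word in which the
   Pi_al sentences true in that letter remain true. *)
Definition ext u v := exists ts, [/\ v = flatten ts, all (@nemp _) ts &
  all2P (fun s t => bf al [:: s] t) u ts].

Lemma ext_cat u1 u2 v1 v2 : ext u1 v1 -> ext u2 v2 -> ext (u1 ++ u2) (v1 ++ v2).
Proof.
case=> [ts [-> n R]] [ts' [-> n' R']]; exists (ts ++ ts'); split.
- by rewrite flatten_cat.
- by rewrite all_cat n.
- exact: all2P_cat.
Qed.

Lemma ext_catl u1 u2 v : ext (u1 ++ u2) v ->
  exists v1 v2, [/\ v = v1 ++ v2, ext u1 v1 & ext u2 v2].
Proof.
case=> ts [-> n /all2P_catl [t1 [t2 [E R1 R2]]]]; subst.
move: n; rewrite all_cat flatten_cat => /andP [n1 n2].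
by exists (flatten t1), (flatten t2); split => //; [exists t1 | exists t2].
Qed.

Lemma ext_nil : ext [::] [::].
Proof. by exists [::]. Qed.

Lemma ext_nil_inv v : ext [::] v -> v = [::].
Proof. by case=> [[|t ts] [-> _]]. Qed.

Lemma ext1 s v : nemp v -> bf al [:: s] v -> ext [:: s] v.
Proof. by move=> n L; exists [:: v]; rewrite /= cats0 n. Qed.

Lemma ext1_inv s v : ext [:: s] v -> nemp v /\ bf al [:: s] v.
Proof.
case=> ts [->]; case: ts => [|t [|t' ts]] n [] //= L _.
by rewrite cats0; case/andP: n.
Qed.

Lemma ext_consl s u v : ext (s :: u) v ->
  exists v1 v2, [/\ v = v1 ++ v2, ext [:: s] v1 & ext u v2].
Proof. exact: (@ext_catl [:: s] u). Qed.

Lemma ext_refl u : ext u u.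
Proof.
elim: u => [|s u IH]; first exact: ext_nil.
by apply: (@ext_cat [:: s] u [:: s] u) => //; apply: ext1 => //; apply: bf_refl.
Qed.

Lemma ext_le u v : ext u v -> bf al u v.
Proof.
case=> ts [-> _ R]; rewrite -{1}(flatten_seq1 u).
by apply: bf_groups; apply/all2P_mapl.
Qed.

Lemma ext_nemp u v : ext u v -> nemp v = nemp u.
Proof. by case=> ts [-> n]; case: u ts n => [|s u] [|[|x t] ts]. Qed.

Lemma ext_trans u v w : ext u v -> ext v w -> ext u w.
Proof.
elim: u v w => [|s u IH] v w; first by move/ext_nil_inv->.
case/ext_consl=> v1 [v2 [-> H1 H2]] /ext_catl [w1 [w2 [-> K1 K2]]].
apply: (@ext_cat [:: s]); last exact: IH K2.
have [n1 L1] := ext1_inv H1; apply: ext1; first by rewrite (ext_nemp K1).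
exact: bf_trans L1 (ext_le K1).
Qed.

Lemma ext_cut u v : cutw u v -> ext u v.
Proof.
case/cutw_unflatten=> us [-> n H]; exists us; split => //.
by apply: all2P_impl H => s t; apply: bf_cut.
Qed.

Definition compat u v := exists2 t, ext u t & ext v t.

Lemma compat_sym u v : compat u v -> compat v u.
Proof. by case=> t ? ?; exists t. Qed.

Definition directed u := forall v v', ext u v -> ext u v' -> compat v v'.

Lemma directed_ext u v : directed u -> ext u v -> directed v.
Proof. by move=> d uv w w' H H'; apply: d; apply: ext_trans uv _. Qed.

Lemma directed_cat u v : directed u -> directed v -> directed (u ++ v).
Proof.
move=> du dv _ _ /ext_catl [a [b [-> H1 H2]]] /ext_catl [a' [b' [-> H1' H2']]].
have [s s1 s2] := du _ _ H1 H1'; have [t t1 t2] := dv _ _ H2 H2'.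
by exists (s ++ t); apply: ext_cat.
Qed.

(** Directedness of a concatenation does not control its parts: a common extension of two
    concatenations may be split at different places for the two. Directed parts are therefore
    required densely, for every grouping of every extension. *)
Definition locally_directed u := forall v gs, ext u v -> all (@nemp _) gs ->
  v = flatten gs -> exists2 hs, all2P ext gs hs & ForallP directed hs.

Lemma locally_directed_ext u v : locally_directed u -> ext u v -> locally_directed v.
Proof. by move=> d uv w gs H; apply: d; apply: ext_trans uv _. Qed.

Definition good u := directed u /\ locally_directed u.

Lemma good_ext u v : good u -> ext u v -> good v.
Proof.
by case=> d l uv; split; [apply: directed_ext uv | apply: locally_directed_ext uv].
Qed.

Lemma ForallP_cat T (P : T -> Prop) s t : ForallP P (s ++ t) <-> ForallP P s /\ ForallP P t.
Proof.
elim: s => [|x s IH] /=; first by split=> // -[].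
by rewrite IH; split=> [[? []]|[[]]].
Qed.

Lemma locally_directed_cat u v :
  locally_directed u -> locally_directed v -> locally_directed (u ++ v).
Proof.
move=> du dv w gs /ext_catl [a [b [-> H1 H2]]] n E.
have [[gs1 [gs2 [E0 E1 E2]]]|[gs1 [g1 [g2 [gs2 [E0 ng1 ng2 E1 E2]]]]]] :=
    flatten_eq_cat n (esym E); subst.
  move: n; rewrite all_cat => /andP [n1 n2].
  have [hs1 X1 Y1] := du _ _ H1 n1 erefl; have [hs2 X2 Y2] := dv _ _ H2 n2 erefl.
  by exists (hs1 ++ hs2); [apply: all2P_cat | apply/ForallP_cat].
move: n; rewrite all_cat /= => /and3P [n1 _ n2].
have [||hs1 X1 Y1] := du _ (gs1 ++ [:: g1]) H1.
- by rewrite all_cat n1 /= ng1.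
- by rewrite flatten_cat /= cats0.
have [||hs2 X2 Y2] := dv _ (g2 :: gs2) H2 => //; first by rewrite /= ng2.
have [k1 [k2 [E3 S1 S2]]] := all2P_catl X1; subst.
case: k2 S2 X1 Y1 => [[]//|h1 [|? ?] [S2 //]] _ _ /ForallP_cat [Y1 [Y1' _]].
case: hs2 X2 Y2 => // h2 k2 [S3 S4] /= [Y2 Y2'].
exists (k1 ++ (h1 ++ h2) :: k2).
  by apply: all2P_cat => //=; split => //; apply: ext_cat.
by apply/ForallP_cat; split => //; split => //; apply: directed_cat.
Qed.

Lemma good_cat u v : good u -> good v -> good (u ++ v).
Proof.
by case=> ? ? [? ?]; split; [apply: directed_cat | apply: locally_directed_cat].
Qed.

Lemma locally_directed_split u a b : locally_directed u -> ext u (a ++ b) ->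
  nemp a -> nemp b -> exists a' b', [/\ ext a a', ext b b', good a' & good b'].
Proof.
move=> l uab na nb.
have [||hs X Y] := l _ [:: a; b] uab; rewrite ?/= ?na ?nb ?cats0 //.
case: hs X Y => [[]|a' [[_ []]|b' [|c hs]]] [Ha [Hb //]] _ [Da [Db _]].
exists a', b'; split => //; split => //.
(* An extension of one part is completed to an extension of [u] by the other part, taken as one
   extra group whose answer is discarded. *)
- move=> w gs aw n E; have ub : ext u (w ++ b').
    by apply: ext_trans uab _; apply: ext_cat => //; apply: ext_trans aw.
  have [||hs /all2P_catl [h1 [h2 [-> X _]]] /ForallP_cat [Y _]] := l _ (gs ++ [:: b']) ub.
  - by rewrite all_cat n /= (ext_nemp Hb) nb.
  - by rewrite flatten_cat /= cats0 E.
  by exists h1.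
- move=> w gs bw n E; have ub : ext u (a' ++ w).
    by apply: ext_trans uab _; apply: ext_cat => //; apply: ext_trans bw.
  have [||hs X Y] := l _ (a' :: gs) ub.
  - by rewrite /= n andbT (ext_nemp Ha) na.
  - by rewrite /= E.
  by case: hs X Y => // h1 h2 [_ X] [_ Y]; exists h2.
Qed.

End Forcing.

(** * Finite conditions and generic sequences of conditions *)

Section Conditions.
Import Order.TTheory GRing.Theory Num.Theory.
Local Open Scope ring_scope.
Variables (al : cord) (A : chain).

(* A condition names finitely many points by rationals of ]0, 1[; the item
   [(x, s)] promises that the interval between [x] and the next key is a word
   above the letter [s]. The keys 0 and 1 stand for -oo and +oo. *)
Definition items : Type := seq (rat * letter A).
Implicit Types (p q : items) (x y z : rat).

Definition seg p x y : word A := [seq i.2 | i <- p & x <= i.1 < y].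
Definition keys p := [seq i.1 | i <- p].
Definition bd p x := (x \in keys p) || (x == 1).
Definition valid p :=
  [&& pairwise <%R (keys p), 0 \in keys p & all (fun x => 0 <= x < 1) (keys p)].

Definition extends p q := [/\ valid q, {subset keys p <= keys q} &
  forall x y, bd p x -> bd p y -> x < y -> ext al (seg p x y) (seg q x y)].

Lemma keysP p x : reflect (exists2 i, i \in p & x = i.1) (x \in keys p).
Proof. exact: mapP. Qed.

Lemma bd_le1 p x : valid p -> bd p x -> 0 <= x <= 1.
Proof.
case/and3P=> _ _ /allP H /orP [/H /andP [-> /ltW]//|/eqP->]; by rewrite lexx ler01.
Qed.

Lemma bd_extends p q x : extends p q -> bd p x -> bd q x.
Proof. by case=> _ H _ /orP [/H|] K; rewrite /bd K ?orbT. Qed.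

Lemma extends_refl p : valid p -> extends p p.
Proof. by move=> v; split=> // x y _ _ _; apply: ext_refl. Qed.

Lemma extends_trans p q r : extends p q -> extends q r -> extends p r.
Proof.
move=> pq qr; case: (pq) (qr) => _ H1 E1 [v H2 E2]; split => // [x /H1 /H2 //|x y bx by_ xy].
by apply: ext_trans (E1 _ _ bx by_ xy) (E2 _ _ _ _ xy); apply: bd_extends pq _.
Qed.

Lemma seg_consE i p x y :
  seg (i :: p) x y = if x <= i.1 < y then i.2 :: seg p x y else seg p x y.
Proof. by rewrite /seg /=; case: ifP. Qed.

Lemma seg_catE p1 p2 x y : seg (p1 ++ p2) x y = seg p1 x y ++ seg p2 x y.
Proof. by rewrite /seg filter_cat map_cat. Qed.

Lemma seg_none p x y : all (fun z => ~~ (x <= z < y)) (keys p) -> seg p x y = [::].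
Proof. by elim: p => // i p IH /= /andP [/negbTE H /IH E]; rewrite seg_consE H. Qed.

Lemma seg_all p x y : all (fun z => x <= z < y) (keys p) -> seg p x y = [seq i.2 | i <- p].
Proof. by elim: p => // i p IH /= /andP [H /IH E]; rewrite seg_consE H E. Qed.

Lemma seg_cat p x y z : pairwise <%R (keys p) -> x <= y -> y <= z ->
  seg p x z = seg p x y ++ seg p y z.
Proof.
move=> + xy yz; elim: p => // i p IH; rewrite /= => /andP [/allP a /IH E].
rewrite !seg_consE; have [yi|iy] := leP y i.1.
  have N : seg p x y = [::].
    by apply: seg_none; apply/allP => k /a ik; rewrite negb_and -!leNgt (le_trans yi (ltW ik)) orbT.
  by rewrite (le_trans xy yi) /= E N.
by rewrite (lt_le_trans iy yz) andbT /= E; case: ifP.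
Qed.

Lemma nemp_seg p x y : valid p -> bd p x -> bd p y -> x < y -> nemp (seg p x y).
Proof.
move=> v /orP [/keysP [i ip ->]|/eqP->] /(bd_le1 v) /andP [_ y1] xy; last first.
  by have := lt_le_trans xy y1; rewrite ltxx.
rewrite /nemp /nilp size_map size_filter -lt0n -has_count.
by apply/hasP; exists i; rewrite // lexx.
Qed.

Lemma pairwise_filter_lt p x y : pairwise <%R (keys p) -> forall l1 i l2,
  [seq i <- p | x <= i.1 < y] = l1 ++ i :: l2 ->
  seg p x i.1 = map snd l1 /\ seg p i.1 y = map snd (i :: l2).
Proof.
move=> pw l1 i l2 E.
have pl : pairwise <%R (keys (l1 ++ i :: l2)).
  by rewrite -E /keys pairwise_map pairwise_filter // -pairwise_map.
have /andP [xi iy] : x <= i.1 < y.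
  have : i \in [seq i <- p | x <= i.1 < y] by rewrite E mem_cat mem_head orbT.
  by rewrite mem_filter => /andP [].
have Z1 : [seq j <- p | x <= j.1 < i.1] = [seq j <- l1 ++ i :: l2 | j.1 < i.1].
  rewrite -E -filter_predI; apply: eq_filter => j /=.
  by rewrite andbA andbC; case: (ltP j.1 i.1) => //= ji; rewrite (lt_trans ji iy) !andbT.
have Z2 : [seq j <- p | i.1 <= j.1 < y] = [seq j <- l1 ++ i :: l2 | i.1 <= j.1].
  rewrite -E -filter_predI; apply: eq_filter => j /=.
  by case: (leP i.1 j.1) => //= ij; rewrite (le_trans xi ij).
move: pl; rewrite /keys map_cat /= pairwise_cat /= => /and4P [/allrelP r _ /allP a _].
have H1 j : j \in l1 -> j.1 < i.1 by move=> jl; apply: r; rewrite ?map_f ?mem_head.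
have H2 j : j \in l2 -> i.1 < j.1 by move=> jl; apply: a; rewrite map_f.
rewrite /seg Z1 Z2 !filter_cat /= ltxx lexx; split.
  rewrite (_ : [seq j <- l1 | _] = l1); last by apply/all_filterP/allP.
  rewrite (_ : [seq j <- l2 | _] = [::]) ?cats0 //.
  by apply/eqP; rewrite -size_eq0 size_filter -leqn0 leqNgt -has_count;
    apply/hasPn => j /H2 /ltW; rewrite leNgt.
rewrite (_ : [seq j <- l1 | _] = [::]) /=; last first.
  by apply/eqP; rewrite -size_eq0 size_filter -leqn0 leqNgt -has_count;
    apply/hasPn => j /H1; rewrite ltNge.
by rewrite (_ : [seq j <- l2 | _] = l2) //; apply/all_filterP/allP => j /H2 /ltW.
Qed.

Lemma seg_split p x y a b : valid p -> seg p x y = a ++ b -> nemp a -> nemp b ->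
  bd p x -> exists z, [/\ bd p z, x < z, z < y, seg p x z = a & seg p z y = b].
Proof.
move=> v; case/and3P: (v) => pw _ _ E na nb bx.
set l := [seq i <- p | x <= i.1 < y].
have El : l = take (size a) l ++ drop (size a) l by rewrite cat_take_drop.
have Ea : map snd (take (size a) l) = a by rewrite map_take -/(seg p x y) E take_size_cat.
have Eb : map snd (drop (size a) l) = b by rewrite map_drop -/(seg p x y) E drop_size_cat.
case El2 : (drop (size a) l) => [|i l2].
  by move: nb; rewrite -Eb El2.
rewrite El2 in El Eb; have [S1 S2] := pairwise_filter_lt pw El.
have : i \in l by rewrite El mem_cat mem_head orbT.
rewrite mem_filter => /andP [/andP [xi iy] ip].
exists i.1; rewrite S1 S2 Ea Eb; split => //; first by rewrite /bd /keys map_f.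
rewrite lt_neqAle xi andbT; apply: contra na => /eqP xi'.
by rewrite -Ea -S1 -xi' (_ : seg p x x = [::]) //; apply: seg_none;
  apply/allP => k _; rewrite negb_and -leNgt -ltNge; case: ltP.
Qed.

Lemma between x y n : x < y ->
  exists rs, [/\ size rs = n, pairwise <%R rs & all (fun r => x < r < y) rs].
Proof.
elim: n x => [|n IH] x xy; first by exists [::].
have [m1 m2] := midf_lt xy; have [rs [s pw a]] := IH _ m2.
exists ((x + y) / 2 :: rs); rewrite /= s pw m1 m2; split => //=.
  by rewrite andbT; apply/allP => r /(allP a) /andP [].
by apply/allP => r /(allP a) /andP [/(lt_trans m1) -> ->].
Qed.

Definition apart x y x' y' := (y' <= x) || (y <= x').

Lemma refine1 p x y s t : valid p -> bd p x -> bd p y -> x < y ->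
  seg p x y = [:: s] -> nemp t -> bf al [:: s] t ->
  exists q, [/\ extends p q, seg q x y = t &
    forall x' y', bd p x' -> bd p y' -> apart x y x' y' -> seg q x' y' = seg p x' y'].
Proof.
move=> v bx by_ xy E nt L; case/and3P: (v) => pw k0 a01.
case/orP: (bx) => [/keysP [[x0 s0] /= ip Ex]|/eqP x1]; last first.
  by have /andP [_] := bd_le1 v by_; rewrite leNgt -x1 xy.
subst x0; case/splitPr: ip v bx by_ E pw k0 a01 => p1 p2 v bx by_ E pw k0 a01.
move: (pw); rewrite /keys map_cat /= pairwise_cat /= => /and4P [/allrelP r pw1 /allP a pw2].
have H1 k : k \in keys p1 -> k < x by move=> kl; apply: r; rewrite ?mem_head.
have H2 k : k \in keys p2 -> x < k by move=> kl; apply: a.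
move: E; rewrite seg_catE seg_consE /= lexx xy /=.
rewrite seg_none /=; last by apply/allP => k /H1; rewrite negb_and -ltNge => ->.
case=> E0 E2; subst s0.
(* The segment is a single letter, so [x] is the only key of [p] from [x] up to [y], with [y]
   excluded. *)
have H2' k : k \in keys p2 -> y <= k.
  move=> kl; rewrite leNgt; apply/negP => ky.
  case/keysP: kl ky => j jp -> jy; move: (f_equal size E2).
  rewrite size_map size_filter => /eqP; rewrite -leqn0 leqNgt -has_count => /hasPn /(_ j jp).
  by rewrite jy ltW // H2 // map_f.
(* The first letter of [t] takes over the key [x]; the others get fresh rationals. *)
case: t nt L => // t0 ts _ L; have [rs [sz pwr ar]] := between (size ts) xy.
set mid := zip rs ts; have Kmid : keys mid = rs by rewrite /keys -/(unzip1 _) unzip1_zip ?sz.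
set q := p1 ++ (x, t0) :: mid ++ p2.
have Kq : keys q = keys p1 ++ x :: rs ++ keys p2.
  by rewrite /q /keys map_cat /= map_cat -/(keys mid) Kmid.
have Rb r0 : r0 \in rs -> x < r0 < y by move/(allP ar).
have /andP [_ y1] := bd_le1 v by_.
have vq : valid q.
  rewrite /valid Kq; apply/and3P; split.
  - rewrite pairwise_cat /= pairwise_cat pw1 pw2 pwr !andbT /=; apply/and3P; split.
    + apply/allrelP => k k' /H1 kx; rewrite in_cons mem_cat => /or3P [/eqP->//|/Rb /andP [xk _]|/H2 xk].
        exact: lt_trans xk.
      exact: lt_trans xk.
    + apply/allP => k; rewrite mem_cat => /orP [/Rb /andP []//|/H2 //].
    + by apply/allrelP => k k' /Rb /andP [_ ky] /H2' yk; apply: lt_le_trans yk.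
  - by move: k0; rewrite /keys map_cat /= !(mem_cat, in_cons) => /or3P [->|->|->]; rewrite ?orbT.
  - move: a01; rewrite /keys map_cat /= !all_cat /= all_cat => /and3P [-> /andP [x0 x1] ->].
    rewrite x0 x1 /= andbT; apply/allP => k /Rb /andP [xk ky].
    by rewrite (le_trans x0 (ltW xk)) (lt_le_trans ky y1).
have Sq x' y' : bd (p1 ++ (x, s) :: p2) x' -> bd (p1 ++ (x, s) :: p2) y' ->
    seg q x' y' = seg p1 x' y' ++ (if x' <= x < y' then t0 :: ts else [::]) ++ seg p2 x' y'.
  have Bl b : bd (p1 ++ (x, s) :: p2) b -> (b <= x) || (y <= b).
    rewrite /bd /keys map_cat /= mem_cat in_cons -!orbA.
    case/or4P=> [/H1 /ltW ->//|/eqP->|/H2' ->|/eqP->]; rewrite ?lexx ?y1 ?orbT //.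
  move=> /Bl bx' /Bl by'; rewrite /q seg_catE seg_consE /= seg_catE; congr (_ ++ _).
  have -> : seg mid x' y' = if x' <= x < y' then ts else [::].
    case: ifP => C.
      rewrite seg_all -/(unzip2 _) ?unzip2_zip ?sz // Kmid; apply/allP => k /Rb /andP [xk ky].
      case/andP: C => C1 C2; rewrite (le_trans C1 (ltW xk)) /=.
      by case/orP: by' => [|yy]; [rewrite leNgt C2 | apply: lt_le_trans yy].
    apply: seg_none; rewrite Kmid; apply/allP => k /Rb /andP [xk ky]; apply/negP => /andP [C1 C2].
    move/negbT: C; rewrite negb_and -leNgt -ltNge => /orP [xx'|y'x].
      by case/orP: bx' => [|yx']; [rewrite leNgt xx' | move: (le_lt_trans C1 ky); rewrite ltNge yx'].
    by move: (lt_le_trans C2 y'x); rewrite ltNge (ltW xk).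
  by case: ifP => C //; rewrite C.
exists q; split.
- split => // [k|x' y' bx' by' xy'].
    by rewrite Kq /keys map_cat /= !(mem_cat, in_cons) => /or3P [->|->|->]; rewrite ?orbT.
  rewrite Sq // seg_catE seg_consE /=; apply: ext_cat; first exact: ext_refl.
  case: ifP => _ /=; last exact: ext_refl.
  apply: (@ext_cat _ _ [:: s] _ (t0 :: ts)); last exact: ext_refl.
  exact: ext1.
- rewrite Sq // lexx xy E2 cats0 seg_none //.
  by apply/allP => k /H1; rewrite negb_and -ltNge => ->.
- move=> x' y' bx' by' ap; rewrite Sq // seg_catE seg_consE /=.
  suff -> : x' <= x < y' = false by [].
  apply/negP => /andP [C1 C2]; case/orP: ap => C.
    by move: (lt_le_trans C2 C); rewrite ltxx.
  by move: (le_lt_trans C1 xy); rewrite ltNge C.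
Qed.

Lemma refine p x y u : valid p -> bd p x -> bd p y -> x < y -> ext al (seg p x y) u ->
  exists q, [/\ extends p q, seg q x y = u &
    forall x' y', bd p x' -> bd p y' -> apart x y x' y' -> seg q x' y' = seg p x' y'].
Proof.
move=> v bx by_ xy; move E : (seg p x y) => w.
elim: w p x u E v bx by_ xy => [|s [|s' w] IH] p x u E v bx by_ xy.
- by have := nemp_seg v bx by_ xy; rewrite E.
- by case/ext1_inv=> nu L; apply: (refine1 v bx by_ xy E).
- have [z [bz xz zy E1 E2]] := seg_split (a := [:: s]) v E isT isT bx.
  case/ext_consl=> t [u' [-> H1 H2]]; have [nt L] := ext1_inv H1.
  have [q1 [pq1 F1 G1]] := refine1 v bx bz xz E1 nt L; have [vq1 _ _] := pq1.
  have E3 : seg q1 z y = s' :: w by rewrite G1 // /apart lexx orbT.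
  have [q2 [pq2 F2 G2]] :=
    IH q1 z u' E3 vq1 (bd_extends pq1 bz) (bd_extends pq1 by_) zy H2.
  have [vq2 _ _] := pq2; case/and3P: (vq2) => pw _ _.
  exists q2; split; first exact: extends_trans pq2.
    rewrite (seg_cat pw (ltW xz) (ltW zy)) F2 G2 ?F1 //; try exact: bd_extends pq1 _.
    by rewrite /apart lexx.
  move=> x' y' bx' by' ap; rewrite G2; try exact: bd_extends pq1 _.
    rewrite G1 //; move: ap => /orP [C|C]; rewrite /apart ?C //.
    by rewrite (le_trans (ltW zy) C) orbT.
  by move: ap => /orP [C|C]; rewrite /apart ?C ?orbT // (le_trans C (ltW xz)).
Qed.

(** A Rasiowa-Sikorski construction: at its turn a property is met if some extension meets it, and
    is excluded for good otherwise. Every property has turns beyond every stage, so that it can be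
    decided after the keys it mentions have entered the condition. *)
Lemma generic_sequence (T : countType) (P : T -> items -> Prop) p0 : valid p0 ->
  exists p : nat -> items, [/\ p 0%N = p0, forall n, valid (p n),
    forall n m, (n <= m)%N -> extends (p n) (p m) &
    forall i n, exists2 m, (n <= m)%N &
      P i (p m) \/ forall q, extends (p m) q -> ~ P i q].
Proof.
move=> v0.
have step n p : valid p -> exists q, extends p q /\
    forall i, unpickle (logn 2 n.+1) = Some i -> P i q \/ forall r, extends q r -> ~ P i r.
  move=> vp; case: (unpickle _) => [i|]; last by exists p; split => //; apply: extends_refl.
  have [[q [pq Pq]]|H] := pselect (exists q, extends p q /\ P i q).
    by exists q; split => // _ [<-]; left.
  exists p; split; first exact: extends_refl.
  by move=> _ [<-]; right => r pr Pr; apply: H; exists r.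
have [f Hf] : exists f : nat -> items -> items, forall n p, valid p -> extends p (f n p) /\
    forall i, unpickle (logn 2 n.+1) = Some i ->
      P i (f n p) \/ forall r, extends (f n p) r -> ~ P i r.
  have /choice [f Hf] : forall np : nat * items, exists q, valid np.2 -> extends np.2 q /\
      forall i, unpickle (logn 2 np.1.+1) = Some i -> P i q \/ forall r, extends q r -> ~ P i r.
    move=> [n p] /=; have [vp|nv] := boolP (valid p); last by exists p.
    by have [q Hq] := step n p vp; exists q.
  by exists (fun n p => f (n, p)) => n p; apply: (Hf (n, p)).
pose p := fix p n := if n is n'.+1 then f n' (p n') else p0.
have vp n : valid (p n).
  by elim: n => //= n IH; have [[]] := Hf n _ IH.
have ep n m : (n <= m)%N -> extends (p n) (p m).
  elim: m => [|m IH]; first by rewrite leqn0 => /eqP->; apply: extends_refl.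
  rewrite leq_eqVlt => /orP [/eqP->|]; first exact: extends_refl.
  by rewrite ltnS => /IH H; apply: extends_trans H _; have [] := Hf m _ (vp m).
exists p; split => // i n.
(* The exponent of 2 in [k] is the code of [i], so [p k] results from a turn of [i]; the odd factor
   makes [k] at least [n]. *)
pose k := (2 ^ pickle i * n.*2.+1)%N.
have k0 : (0 < k)%N by rewrite muln_gt0 expn_gt0.
exists k; last first.
  have [_ /(_ i)] := Hf k.-1 _ (vp k.-1).
  rewrite prednK // (_ : logn 2 k = pickle i); last first.
    by rewrite lognM ?expn_gt0 // pfactorK // logn_coprime ?addn0 // coprime2n /= odd_double.
  by rewrite pickleK => /(_ erefl); rewrite -[X in P i (p X)](prednK k0) -[X in extends (p X)](prednK k0).
rewrite /k -{1}[n]mul1n; apply: leq_mul; first by rewrite expn_gt0.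
by rewrite -addnn -addnS leq_addr.
Qed.

End Conditions.

(** * The generic order *)

Lemma all2P_Forall T U (P : T -> Prop) (R : T -> U -> Prop) s t :
  ForallP P s -> all2P R s t -> all2P (fun x y => P x /\ R x y) s t.
Proof. by elim: s t => [|x s IH] [|y t] //= [? ?] [? ?]; split => //; apply: IH. Qed.

Lemma ForallP_impl T (P Q : T -> Prop) s : (forall x, P x -> Q x) -> ForallP P s -> ForallP Q s.
Proof. by move=> H; elim: s => //= x s IH [/H ? /IH ?]. Qed.

Lemma ForallP_map T U (f : T -> U) (P : U -> Prop) s :
  ForallP P (map f s) <-> ForallP (fun x => P (f x)) s.
Proof. by elim: s => //= x s ->. Qed.

Lemma cutw1_inv (C : chain) (x y : C) ks : cutw [:: (x, y)] ks ->
  ks = [:: (x, y)] \/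
  exists z ks', [/\ cin z, clt x z, clt z y, ks = (x, z) :: ks' & cutw [:: (z, y)] ks'].
Proof.
move=> H; inversion H as [|s w u K|x' y' z w u cz xz zy K]; subst.
  by move/cutw_nill: K => ->; left.
by right; exists z, u.
Qed.

Lemma bf_split a b (C D : chain) (u : word C) (vs : seq (word D)) :
  olt b a -> all (@nemp _) vs -> bf a u (flatten vs) ->
  exists us, [/\ all (@nemp _) us, cutw u (flatten us) & all2P (fun v u => bf b v u) vs us].
Proof.
case: a => [|f]; [by case | case=> k bk nv L].
have [us [n c R]] := L k vs nv (cutw_refl _).
by exists us; split => //; apply: all2P_impl R => x y; apply: bf_mono.
Qed.

(** Requirements must form a countable type, which [cord] is not; levels below [al] are named by
    positions in its notation. *)
Definition osub (a : cord) (k : nat) := if a is osup f then f k else ozero.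

Section Requirements.
Local Open Scope ring_scope.
Variables (al : cord) (A : chain) (enum : nat -> seq (word A)).

(* A requirement is coded by a tag, two pairs of keys, and indices into [enum] and
   into the notation [al]. Tags 0 and 1 make forcing decide [bf] between [B] and
   words of [A] at the levels below [al], tags 2 to 5 make it decide the properties
   that isolate the isomorphism types of intervals. *)
Definition requirement := (nat * (rat * rat) * (rat * rat) * nat * nat * nat)%type.

Definition meets (r : requirement) (q : items A) : Prop :=
  let: (tag, (x, y), (x', y'), i, k, m) := r in
  match tag with
  | 0%N => exists gs, [/\ all (@nemp _) gs, flatten gs = seg q x y &
      all2P (fun h g => bf (osub (osub al k) m) h g) (enum i) gs]
  | 1%N => exists k gs, [/\ all (@nemp _) gs, flatten gs = seg q x y &
      ~ exists hs, [/\ all (@nemp _) hs, cutw (flatten (enum i)) (flatten hs) &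
        all2P (fun g h => bf (osub al k) g h) gs hs]]
  | 2%N => ~ compat al (seg q x y) (seg q x' y')
  | 3%N => exists gs, [/\ all (@nemp _) gs, flatten gs = seg q x y &
      ~ exists2 hs, all2P (@ext al A) gs hs & ForallP (@directed al A) hs]
  | 4%N => ext al (flatten (enum i)) (seg q x y)
  | _ => good al (seg q x y)
  end.

End Requirements.

Section Generic.
Import Order.TTheory GRing.Theory Num.Theory.
Local Open Scope ring_scope.
Variables (al : cord) (A : chain) (enum : nat -> seq (word A)).
Hypothesis enum_surj : forall g, exists n, enum n = g.
Variable p : nat -> items A.
Hypothesis vp : forall n, valid (p n).
Hypothesis ep : forall n m, (n <= m)%N -> extends al (p n) (p m).
Hypothesis gen : forall r n, exists2 m, (n <= m)%N &
  meets al enum r (p m) \/ forall q, extends al (p m) q -> ~ meets al enum r q.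

Definition gin x := 0 < x /\ exists n, x \in keys (p n).

Lemma rat_total (x y : rat) : [\/ x < y, x = y | y < x].
Proof. by case: (ltgtP x y); [constructor 1 | constructor 3 | constructor 2]. Qed.

Lemma rat_irr (x : rat) : ~ x < x. Proof. by rewrite ltxx. Qed.

Lemma rat_trans (x y z : rat) : x < y -> y < z -> x < z. Proof. exact: lt_trans. Qed.

Definition generic : chain :=
  @Chain rat (fun x y => x < y) gin rat_irr rat_trans rat_total.
Local Notation B := generic.

Definition wd n (l : letter B) := seg (p n) l.1 l.2.
Definition ok n (l : letter B) := [/\ bd (p n) l.1, bd (p n) l.2 & l.1 < l.2].

Lemma ok_le n m l : (n <= m)%N -> ok n l -> ok m l.
Proof. by move=> nm [bx by_ xy]; split => //; apply: bd_extends (ep nm) _. Qed.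

Lemma ext_wd n m l : (n <= m)%N -> ok n l -> ext al (wd n l) (wd m l).
Proof. by move=> nm [bx by_ xy]; have [_ _] := ep nm; apply. Qed.

Lemma nemp_wd n l : ok n l -> nemp (wd n l).
Proof. by case=> bx by_ xy; apply: nemp_seg. Qed.

Lemma wd_cat n x y z : x < y -> y < z -> wd n (x, z) = wd n (x, y) ++ wd n (y, z).
Proof.
by move=> xy yz; case/and3P: (vp n) => pw _ _; apply: seg_cat; rewrite ?ltW.
Qed.

Lemma gin_bd n z : gin z -> exists2 m, (n <= m)%N & bd (p m) z.
Proof.
case=> _ [k kz]; exists (maxn n k); first exact: leq_maxl.
by apply: (bd_extends (ep (leq_maxr n k))); rewrite /bd kz.
Qed.

Lemma bd_gin n x y z : bd (p n) z -> bd (p n) x -> bd (p n) y -> x < z -> z < y -> gin z.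
Proof.
move=> bz bx by_ xz zy.
have /andP [x0 _] := bd_le1 (vp n) bx; have /andP [_ y1] := bd_le1 (vp n) by_.
split; first exact: le_lt_trans xz.
by exists n; case/orP: bz => // /eqP z1; move: (lt_le_trans zy y1); rewrite z1 ltxx.
Qed.

Lemma path_bounds (x y : B) ls : x < y -> cutw [:: (x, y)] ls ->
  ForallP (fun l : letter B => [/\ x <= l.1, l.1 < l.2 & l.2 <= y]) ls.
Proof.
elim: ls x => [|l ls IH] x xy //=; case/cutw1_inv.
  by case=> -> -> /=; rewrite lexx xy.
case=> z [ks [cz xz zy [? ?] H]]; subst; split; first by rewrite /= lexx xz ltW.
have := IH z zy H; apply: ForallP_impl => l' [zl ll ly]; split => //.
exact: (le_trans (ltW xz) zl).
Qed.

Lemma path_stage n (x y : B) ls : ok n (x, y) -> cutw [:: (x, y)] ls ->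
  exists2 m, (n <= m)%N & ForallP (ok m) ls.
Proof.
elim: ls x n => [|l ls IH] x n o; first by exists n.
case/cutw1_inv=> [[-> ->]|]; first by exists n.
case=> z [ks [cz xz zy [? ?] H]]; subst.
have [m nm bz] := gin_bd n cz.
have [bx by_ _] := ok_le nm o.
have [k mk F] := IH z m (And3 bz by_ zy) H.
exists k; first exact: leq_trans mk.
by split => //; apply: (ok_le mk); split.
Qed.

Lemma wd_path n (x y : B) ls : x < y -> cutw [:: (x, y)] ls ->
  flatten (map (wd n) ls) = wd n (x, y).
Proof.
elim: ls x => [|l ls IH] x xy; first by move/cutw_nilr.
case/cutw1_inv=> [[-> ->] /=|]; first by rewrite cats0.
by case=> z [ks [cz xz zy [? ?] H]]; subst; rewrite /= (IH z zy H) -wd_cat.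
Qed.

Lemma path_of_groups n (x y : B) gs : ok n (x, y) -> all (@nemp _) gs ->
  flatten gs = wd n (x, y) ->
  exists ls, [/\ cutw [:: (x, y)] ls, map (wd n) ls = gs & ForallP (ok n) ls].
Proof.
elim: gs x => [|g gs IH] x o; first by move=> _ E; have := nemp_wd o; rewrite -E.
case/andP=> ng ngs /= E; case: (o) => bx by_ xy.
case: gs IH ngs E => [_ _|h gs IH ngs] /=.
  by rewrite cats0 => ->; exists [:: (x, y)]; split => //; apply: cutw_refl.
move=> E; have [|z [bz xz zy E1 E2]] := seg_split (vp n) (esym E) ng _ bx.
  by case/andP: ngs; case: (h).
have oz : ok n (z, y) by split.
have [ls [H1 H2 H3]] := IH z oz ngs (esym E2).
exists ((x, z) :: ls); split => /=; last by split.
  by apply: cut_at => //; apply: bd_gin bz bx by_ xz zy.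
by rewrite H2 {1}/wd E1.
Qed.

Lemma refine_wd n l u : ok n l -> ext al (wd n l) u ->
  exists q, [/\ extends al (p n) q, seg q l.1 l.2 = u &
    forall x' y', bd (p n) x' -> bd (p n) y' -> apart l.1 l.2 x' y' ->
      seg q x' y' = seg (p n) x' y'].
Proof. by case=> bx by_ xy; apply: refine. Qed.

(** A round of the game exchanges the two sides, so each half at a level rests on the other half at
    lower levels. The second half stops below [al] because strengthening a condition preserves its
    word only upwards at level [al]. *)
Lemma truth b :
  (ole b al -> forall n l, ok n l -> bf b (wd n l) [:: l]) /\
  (olt b al -> forall n l, ok n l -> bf b [:: l] (wd n l)).
Proof.
elim: b => [|g IH]; first by [].
split=> gal n [x y] o.
  move=> j gs' ng' cg'; have [ls cl R] := cutw1_groups cg' ng'.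
  have [m nm F] := path_stage o cl; case: (o) => _ _ xy.
  have gj : olt (g j) al := olt_ole_trans (olt_osup g j) gal.
  have [||us [nu cu S]] := bf_split (u := wd n (x, y)) (vs := map (wd m) ls) gj.
  - by elim: (ls) F => //= l s IHs [/nemp_wd -> /IHs].
  - by rewrite (wd_path _ xy cl); apply: ext_le; apply: ext_wd.
  exists us; split => //; move/all2P_mapl: S => /(all2P_Forall F) S.
  apply: all2P_trans (all2P_sym R) S => g' l h c [ol L].
  apply: bf_trans (bf_uncut _ c) _; apply: bf_trans L.
  exact: (proj2 (IH j)).
move=> j gs' ng' cg'; case Eal: al gal => [|f] // [k gfk].
case Ek : (f k) gfk => [|f'] gfk; first by case: (gfk 0%N).
(* [f k] bounds the current level and [f' i'] bounds the level of the answers; the positions [k] and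
   [i'] name the latter in requirement 0. *)
have [i' gj] := gfk j; have [i Ei] := enum_surj gs'.
have [m nm] := gen (0%N, (x, y), (0, 0), i, k, i') n.
have om := ok_le nm o.
have gjal : ole (g j) al.
  rewrite Eal; apply: olt_ole; exists k; rewrite Ek.
  by apply: olt_ole; exists i'.
case=> [[gs [ngs Es R]]|H].
  have [ls' [cl' El' F']] := path_of_groups om ngs Es.
  exists (map (fun l => [:: l]) ls'); split; first exact: nemp_seq1.
    by rewrite flatten_seq1.
  apply/all2P_mapr; rewrite -Ei; move: R; rewrite -El' => /all2P_mapr R.
  have {}R := all2P_sym (all2P_Forall F' (all2P_sym R)).
  apply: all2P_impl R => h l [ol]; rewrite Eal /= Ek /= => L.
  exact: bf_trans (bf_mono gj L) (proj1 (IH j) gjal _ _ ol).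
(* Below [al] the relation between the two stages can be reversed, so a cut of the later word
   answers [gs']. A cut is an extension, hence the requirement was not excluded. *)
have Lnm : bf al (wd n (x, y)) (wd m (x, y)) by apply: ext_le; apply: ext_wd.
have Lmn : bf (f k) (wd m (x, y)) (wd n (x, y)).
  by apply: bf_drop Lnm; [apply: nemp_wd | rewrite Eal; apply: olt_osup].
rewrite Ek in Lmn; have [us [nu cu R]] := Lmn i' gs' ng' cg'.
have [q [pq Eq _]] := refine_wd om (ext_cut al cu).
case: (H q pq); exists us; split => //.
by rewrite Ei Eal /= Ek.
Qed.

Lemma bf_wd n l : ok n l -> bf al (wd n l) [:: l].
Proof. by case: (truth al) => H _; apply: H; apply: ole_refl. Qed.

(** A grouping that [h] cannot answer, once met by requirement 1, would be a tuple of the generic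
    order, where the hypothesis supplies an answer. So the requirement is excluded at some stage,
    and there every grouping of a cut is answered. *)
Lemma forced n (l : letter B) (h : word A) : ok n l -> bf al h [:: l] ->
  exists2 m, (n <= m)%N & bf al h (wd m l).
Proof.
case: l => x y o L; have [a0|[f Eal]] : al = ozero \/ exists f, al = osup f.
- by case: (al) => [|f]; [left | right; exists f].
- by exists n; rewrite // a0.
have [i Ei] := enum_surj [:: h].
have [m nm H] := gen (1%N, (x, y), (0, 0), i, 0%N, 0%N) n.
have om := ok_le nm o; exists m => //.
have Eh : flatten (enum i) = h by rewrite Ei /= cats0.
case: H => [[k [gs [ngs Es N]]]|H].
  case: N; have [ls [cl El F]] := path_of_groups om ngs Es.
  rewrite Eal in L; have [us [nu cu R]] := bf_path k L cl.
  exists us; rewrite Eh; split => //; rewrite -El; apply/all2P_mapl.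
  apply: all2P_impl (all2P_Forall F R) => l u [ol Lu].
  rewrite Eal; apply: bf_trans Lu; apply: bf_mono (bf_wd ol).
  by rewrite Eal; apply: ole_trans (olt_ole (olt_osup f k)) (ole_refl _).
rewrite Eal => k gs ngs cgs; apply: contrapT => N.
have [q [pq Eq _]] := refine_wd om (ext_cut al cgs).
case: (H q pq); exists k, gs; split => // -[hs].
by rewrite Eh Eal => K; apply: N; exists hs.
Qed.

(** * Words realized by intervals of the generic order *)

Definition valid_letter l := exists n, ok n l.

Definition realizes (l : letter B) u := exists2 n, ok n l & ext al u (wd n l).

Lemma realizes_ge l u n : realizes l u ->
  exists m, [/\ (n <= m)%N, ok m l & ext al u (wd m l)].
Proof.
case=> m o H; exists (maxn n m); split; first exact: leq_maxl.
  exact: ok_le (leq_maxr _ _) o.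
by apply: ext_trans H _; apply: ext_wd => //; apply: leq_maxr.
Qed.

(** Together with [path_of_realizes] this expresses realization, a statement on the sequence of
    conditions, by the relations [bf al] between letters and pieces of a cut. That is what makes
    [realizes_le] possible. *)
Lemma realizes_path (x y : B) u ks : valid_letter (x, y) ->
  cutw [:: (x, y)] ks -> all2P (fun s k => bf al [:: s] [:: k]) u ks ->
  realizes (x, y) u.
Proof.
move=> [n o]; elim: u x n o ks => [|s u IH] x n o [|k ks] //; first by move/cutw_nilr.
case/cutw1_inv=> [[-> ->] [L]|].
  case: u IH => // IH _; have [m nm Lm] := forced o L.
  by exists m; [apply: ok_le o | apply: ext1 => //; apply: nemp_wd; apply: ok_le o].
case=> z [ks' [cz xz zy [-> ->] H]] [L R].
have [m nm bz] := gin_bd n cz; have [bx by_ xy] := ok_le nm o.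
have [k' mk Lk] := forced (And3 bx bz xz : ok m (x, z)) L.
have [k2 o2 E2] := IH z m (And3 bz by_ zy) ks' H R.
have M1 := leq_maxl k' k2; have M2 := leq_maxr k' k2; set M := maxn k' k2 in M1 M2.
have ok1 : ok k' (x, z) by apply: (ok_le mk); split.
exists M; first by apply: (ok_le (leq_trans mk M1)); split.
rewrite (wd_cat _ xz zy); apply: (@ext_cat _ _ [:: s]).
  by apply: ext_trans (ext_wd M1 ok1); apply: ext1 => //; apply: nemp_wd.
exact: ext_trans E2 (ext_wd M2 o2).
Qed.

Lemma path_of_realizes (l : letter B) u : realizes l u ->
  exists2 ls, cutw [:: l] ls & all2P (fun s k => bf al [:: s] [:: k]) u ls.
Proof.
case: l => x y [n o [ts [E nts R]]].
have [ls [cl El F]] := path_of_groups o nts (esym E); exists ls => //.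
rewrite -El in R; have R' := all2P_sym (all2P_Forall F (all2P_sym (proj1 (all2P_mapr _ _ _ _) R))).
by apply: all2P_impl R' => s k [ol L]; apply: bf_trans L (bf_wd ol).
Qed.

Lemma realizes_le (l l' : letter B) u : valid_letter l -> valid_letter l' ->
  bf (osucc al) [:: l] [:: l'] -> realizes l' u -> realizes l u.
Proof.
case: l => x y v v' L /path_of_realizes [ls cl R].
have [ks ck S] := bf_path1 (olt_osucc al) L cl.
apply: (realizes_path v ck); apply: all2P_trans R S => a b c; exact: bf_trans.
Qed.

(** At every later stage the condition can still be extended to one above [u], so requirement 4
    cannot be excluded. *)
Lemma realizes_compat n (l : letter B) u : ok n l ->
  (forall m, (n <= m)%N -> compat al u (wd m l)) -> realizes l u.
Proof.
case: l => x y o H; have [i Ei] := enum_surj [:: u].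
have Eu : flatten (enum i) = u by rewrite Ei /= cats0.
have [m nm [K|K]] := gen (4%N, (x, y), (0, 0), i, 0%N, 0%N) n; have om := ok_le nm o.
  by exists m => //; rewrite /= Eu in K.
have [t ut wt] := H m nm; have [q [pq Eq _]] := refine_wd om wt.
by case: (K q pq); rewrite /= Eu Eq.
Qed.

Definition apartl (l k : letter B) := apart l.1 l.2 k.1 k.2.

(* Disjoint intervals are generic over each other: if one realizes what the other
   does, then all further refinements must be compatible. *)
Lemma directed_apart (l k : letter B) : valid_letter l -> valid_letter k -> apartl l k ->
  (forall u, realizes k u -> realizes l u) ->
  exists n, [/\ ok n l, ok n k, directed al (wd n l) & directed al (wd n k)].
Proof.
case: l k => x y [x' y'] [n1 o1] [n2 o2] ap H.
set l := (x, y) in o1 H *; set k := (x', y') in o2 H *.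
have {}o1 := ok_le (leq_maxl n1 n2) o1; have {}o2 := ok_le (leq_maxr n1 n2) o2.
have [m nm K] := gen (2%N, l, k, 0%N, 0%N, 0%N) (maxn n1 n2).
have {}o1 := ok_le nm o1; have {}o2 := ok_le nm o2.
have [M [mM oM EM]] : exists M, [/\ (m <= M)%N, ok M l & ext al (wd m k) (wd M l)].
  by apply: realizes_ge; apply: H; exists m => //; apply: ext_refl.
(* Requirement 2 is not met, as [wd M l] extends both words; hence no extension makes them
   incompatible. The intervals being disjoint, [u] and [v] can be put in one extension. *)
have {K} C u v : ext al (wd m l) u -> ext al (wd m k) v -> compat al u v.
  case: K => [K|K]; first by case: K; exists (wd M l) => //; apply: ext_wd.
  move=> lu kv; have [q1 [pq1 E1 A1]] := refine_wd o1 lu.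
  have [bx by_ xy] := o1; have [bx' by' xy'] := o2; have [vq1 _ _] := pq1.
  have b1 : bd q1 x' := bd_extends pq1 bx'.
  have b2 : bd q1 y' := bd_extends pq1 by'.
  have kv' : ext al (seg q1 x' y') v by rewrite A1.
  have [q2 [pq2 E2 A2]] := refine vq1 b1 b2 xy' kv'.
  apply: contrapT => N; apply: (K q2); first exact: extends_trans pq2.
  rewrite /= A2 ?E1 ?E2 //; try exact: bd_extends pq1 _.
  by case/orP: ap => ap; rewrite /apart ap ?orbT.
have dl : directed al (wd M l).
  move=> u v Mu Mv; apply: compat_sym; apply: C; first by apply: ext_trans Mv; apply: ext_wd.
  exact: ext_trans EM Mu.
exists M; split => //; first exact: ok_le o2.
apply: (directed_ext (u := wd m k)); last exact: ext_wd.
(* Both extensions on the side of [k] are joined to the word of [l], which is already known to be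
   directed. *)
move=> u v ku kv; have [t t1 t2] := C _ _ (ext_wd mM o1) ku.
have [t' t1' t2'] := C _ _ (ext_wd mM o1) kv.
have [r r1 r2] := dl _ _ t1 t1'.
by exists r; [apply: ext_trans t2 r1 | apply: ext_trans t2' r2].
Qed.

Definition goodl (l : letter B) := exists2 n, ok n l & good al (wd n l).

Lemma goodl_ge l n : goodl l -> exists m, [/\ (n <= m)%N, ok m l & good al (wd m l)].
Proof.
case=> m o H; exists (maxn n m); split; first exact: leq_maxl.
  exact: ok_le (leq_maxr _ _) o.
by apply: good_ext H _; apply: ext_wd => //; apply: leq_maxr.
Qed.

Lemma path_letters_valid (l : letter B) ls : valid_letter l -> cutw [:: l] ls ->
  ForallP valid_letter ls.
Proof.
case: l => x y [n o] c; have [m _ F] := path_stage o c.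
by apply: ForallP_impl F => k ok_k; exists m.
Qed.

Lemma directed_stage (ls : seq (letter B)) n :
  ForallP (fun l => exists2 m, ok m l & directed al (wd m l)) ls ->
  exists2 m, (n <= m)%N & ForallP (fun l => ok m l /\ directed al (wd m l)) ls.
Proof.
elim: ls => [|l ls IH] /=; first by exists n.
case=> [[k ok_k dk] /IH [m nm F]]; exists (maxn m k); first exact: leq_trans (leq_maxl _ _).
split; first split.
- exact: ok_le (leq_maxr _ _) ok_k.
- by apply: directed_ext dk _; apply: ext_wd => //; apply: leq_maxr.
apply: ForallP_impl F => l' [ol dl]; split; first exact: ok_le (leq_maxl _ _) ol.
by apply: directed_ext dl _; apply: ext_wd => //; apply: leq_maxl.
Qed.

(** By [directed_apart] every piece of every cut becomes directed. A grouping without directed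
    extensions, if met by requirement 3, would be such a cut; so the requirement is excluded, which
    is local directedness. *)
Lemma goodlI (l : letter B) : valid_letter l ->
  (forall ls, cutw [:: l] ls -> exists ks, all2P (fun l k => [/\ valid_letter k, apartl l k &
     forall u, realizes k u -> realizes l u]) ls ks) -> goodl l.
Proof.
case: l => x y; set l := (x, y) => vl H.
have D ls : cutw [:: l] ls -> ForallP (fun l => exists2 m, ok m l & directed al (wd m l)) ls.
  move=> c; have [ks R] := H ls c; have := path_letters_valid vl c.
  elim: ls ks R {c} => [|a ls IH] [|b ks] //= [[vb ap R] S] [va F]; split; last exact: IH S F.
  by have [m [o _ d _]] := directed_apart va vb ap R; exists m.
have [[n o d] _] := D [:: l] (cutw_refl _).
have [m nm K] := gen (3%N, l, (0, 0), 0%N, 0%N, 0%N) n.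
have om := ok_le nm o; exists m => //; split; first by apply: directed_ext d (ext_wd nm o).
case: K => [[gs [ngs Es N]]|K].
  case: N; have [ls [cl El F]] := path_of_groups om ngs Es.
  have [M mM FM] := directed_stage m (D ls cl).
  exists (map (wd M) ls); last by apply/ForallP_map; apply: ForallP_impl FM => ? [].
  rewrite -El; apply/all2P_mapl/all2P_mapr.
  by elim: (ls) F => //= a s IHs [oa /IHs F]; split => //; apply: ext_wd.
move=> v gs wv ngs Ev; have [q [pq Eq _]] := refine_wd om wv.
apply: contrapT => N; apply: (K q pq); exists gs; split => //; by rewrite Eq.
Qed.


(** Local directedness extends both parts to good words at any later stage, so requirement 5 cannot
    be excluded for either of them. *)
Lemma goodl_points (x y z : B) v : realizes (x, y) v -> good al v ->
  gin z -> x < z -> z < y ->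
  exists n, [/\ ok n (x, z), ok n (z, y), good al (wd n (x, z)), good al (wd n (z, y)) &
    ext al v (wd n (x, y))].
Proof.
case=> n0 o0 E0 gv gz xz zy; have [n n0n bz] := gin_bd n0 gz.
have [bx by_ xy] := ok_le n0n o0.
have E k : (n <= k)%N -> ext al v (wd k (x, z) ++ wd k (z, y)).
  move=> nk; rewrite -wd_cat //; apply: ext_trans E0 _; apply: ext_wd => //; exact: leq_trans nk.
have o1 : ok n (x, z) by split.
have o2 : ok n (z, y) by split.
have S k : (n <= k)%N -> exists a b, [/\ ext al (wd k (x, z)) a, ext al (wd k (z, y)) b,
    good al a & good al b].
  move=> nk; apply: locally_directed_split (E k nk) _ _; first by case: gv.
    by apply: nemp_wd; apply: ok_le o1.
  by apply: nemp_wd; apply: ok_le o2.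
have [m nm K] := gen (5%N, (x, z), (0, 0), 0%N, 0%N, 0%N) n.
have [m' mm' K'] := gen (5%N, (z, y), (0, 0), 0%N, 0%N, 0%N) m.
have nm' := leq_trans nm mm'.
have g1 : good al (wd m (x, z)).
  case: K => // K; have [a [_ [Ha _ ga _]]] := S m nm.
  have [q [pq Eq _]] := refine_wd (ok_le nm o1) Ha.
  by case: (K q pq); rewrite /= Eq.
have g2 : good al (wd m' (z, y)).
  case: K' => // K'; have [_ [b [_ Hb _ gb]]] := S m' nm'.
  have [q [pq Eq _]] := refine_wd (ok_le nm' o2) Hb.
  by case: (K' q pq); rewrite /= Eq.
exists m'; split => //; [exact: ok_le o1 | exact: ok_le o2 | |].
  by apply: good_ext g1 _; apply: ext_wd => //; apply: ok_le o1.
by rewrite (wd_cat _ xz zy); apply: E.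
Qed.

Lemma realizes_cat (x y : B) a b : realizes (x, y) (a ++ b) -> nemp a -> nemp b ->
  exists z, [/\ gin z, x < z, z < y, realizes (x, z) a & realizes (z, y) b].
Proof.
case=> n o /ext_catl [a' [b' [E Ea Eb]]] na nb; case: (o) => bx by_ xy.
have [||z [bz xz zy E1 E2]] := seg_split (vp n) E _ _ bx.
- by rewrite (ext_nemp Ea).
- by rewrite (ext_nemp Eb).
exists z; split => //; first exact: bd_gin bz bx by_ xz zy.
  by exists n; [split | rewrite /wd E1].
by exists n; [split | rewrite /wd E2].
Qed.

Lemma goodl_transfer (x y x' y' z : B) v : good al v -> realizes (x, y) v ->
  realizes (x', y') v -> gin z -> x < z -> z < y ->
  exists z' a b, [/\ gin z', x' < z', z' < y', good al a /\ good al b &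
    [/\ realizes (x, z) a, realizes (z, y) b, realizes (x', z') a & realizes (z', y') b]].
Proof.
move=> gv R R' gz xz zy; have [n [o1 o2 g1 g2 E]] := goodl_points R gv gz xz zy.
have [n' o' E'] := R'.
have : realizes (x', y') (wd n (x, y)).
  apply: (realizes_compat o') => m n'm; have [d _] := gv; apply: d => //.
  by apply: ext_trans E' _; apply: ext_wd.
rewrite (wd_cat _ xz zy) => /realizes_cat [||z' [gz' xz' zy' ra rb]]; try exact: nemp_wd.
exists z', (wd n (x, z)), (wd n (z, y)); split => //; split => //.
  by exists n => //; apply: ext_refl.
by exists n => //; apply: ext_refl.
Qed.

Lemma bis_good (l l' : letter B) v : good al v -> realizes l v -> realizes l' v ->
  bis l.1 l.2 l'.1 l'.2.
Proof.
case: l l' => x y [x' y'] gv r r'.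
exists (fun x y x' y' => exists v, [/\ good al v, realizes (x, y) v & realizes (x', y') v]);
  last by exists v.
move=> {x y x' y' v gv r r'} x y x' y' [v [gv r r']]; split=> z cz xz zy.
  have [z' [a [b [gz' xz' zy' [ga gb] [r1 r2 r3 r4]]]]] := goodl_transfer gv r r' cz xz zy.
  by exists z'; split => //; [exists a | exists b].
have [z' [a [b [gz' xz' zy' [ga gb] [r1 r2 r3 r4]]]]] := goodl_transfer gv r' r cz xz zy.
by exists z'; split => //; [exists a | exists b].
Qed.

Lemma goodl_realizes l : goodl l -> exists2 v, good al v & realizes l v.
Proof. by case=> n o g; exists (wd n l) => //; exists n => //; apply: ext_refl. Qed.

Lemma goodl_sub (x y x' y' : B) : goodl (x, y) -> valid_letter (x', y') ->
  x <= x' -> y' <= y -> goodl (x', y').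
Proof.
have subl a b z : goodl (a, b) -> gin z -> a < z -> z < b -> goodl (a, z) /\ goodl (z, b).
  case/goodl_realizes=> v gv r gz az zb.
  by have [n [o1 o2 g1 g2 _]] := goodl_points r gv gz az zb; split; exists n.
move=> g [n o'] xx' yy'; have [m [nm o gm]] := goodl_ge n g.
have [bx' by' xy'] := ok_le nm o'; have [bx by_ xy] := o.
have {}g : goodl (x', y).
  case: (ltgtP x x') xx' => // [xx' _|<- //].
  have x'y := lt_le_trans xy' yy'; have gx' := bd_gin bx' bx by_ xx' x'y.
  by case: (subl _ _ _ g gx' xx' x'y).
case: (ltgtP y' y) yy' => // [yy' _|-> //].
by have gy' := bd_gin by' bx' by_ xy' yy'; case: (subl _ _ _ g gy' xy' yy').
Qed.

Lemma goodl_cat (x z y : B) : goodl (x, z) -> goodl (z, y) -> goodl (x, y).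
Proof.
move=> g1 g2; have [n [_ o1 h1]] := goodl_ge 0%N g1; have [m [nm o2 h2]] := goodl_ge n g2.
have [bx bz xz] := ok_le nm o1; have [_ by_ zy] := o2.
exists m; first by split => //=; apply: lt_trans zy.
rewrite (wd_cat _ xz zy); apply: good_cat => //; apply: good_ext h1 _; exact: ext_wd.
Qed.

Lemma all2P_Forall2 T U (P : T -> Prop) (Q : U -> Prop) (R : T -> U -> Prop) s t :
  ForallP P s -> ForallP Q t -> all2P R s t -> all2P (fun x y => [/\ P x, Q y & R x y]) s t.
Proof. by elim: s t => [|x s IH] [|y t] //= [? ?] [? ?] [? ?]; split => //; apply: IH. Qed.

Lemma ForallP_and T (P Q : T -> Prop) s : ForallP P s -> ForallP Q s -> ForallP (fun x => P x /\ Q x) s.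
Proof. by elim: s => //= x s IH [? ?] [? ?]; split => //; apply: IH. Qed.

Lemma bd0 n : bd (p n) 0.
Proof. by case/and3P: (vp n) => _ k _; rewrite /bd k. Qed.

Lemma bd1 n : bd (p n) 1.
Proof. by rewrite /bd eqxx orbT. Qed.

Lemma gin_lt1 z : gin z -> z < 1.
Proof. by case=> _ [n zn]; case/and3P: (vp n) => _ _ /allP /(_ z zn) /andP []. Qed.

Lemma valid_gin (x y : B) : gin x \/ x = 0 -> gin y \/ y = 1 -> x < y -> valid_letter (x, y).
Proof.
move=> Hx Hy xy; have [n bx] : exists n, bd (p n) x.
  by case: Hx => [/(gin_bd 0%N) [n _ b]|->]; [exists n | exists 0%N; apply: bd0].
have [m nm by_] : exists2 m, (n <= m)%N & bd (p m) y.
  by case: Hy => [/(gin_bd n) //|->]; exists n => //; apply: bd1.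
by exists m; split => //; apply: bd_extends (ep nm) _.
Qed.

(** * Good intervals between matched points and their absorption *)

(** A cut of [(a, y)], preceded by [(0, a)], is a cut of [(0, y)]. Pulled back to [(0, a)], it
    matches every piece of [(a, y)] with an interval on the left of [a], hence disjoint from it; the
    answer [k0] to [(0, a)] itself is dropped. *)
Lemma goodl_left (a y : B) : gin a -> gin y -> a < y ->
  bf (osucc (osucc al)) [:: (0, a) : letter B] [:: (0, y) : letter B] -> goodl (a, y).
Proof.
move=> ga gy ay L; have [a0 _] := ga.
have v1 : valid_letter (a, y) by apply: valid_gin; auto.
have v2 : valid_letter (0, a) by apply: valid_gin; auto.
apply: goodlI => // ls cl.
have [ks ck R] := bf_path1 (olt_osucc (osucc al)) L (@cut_at B 0 y a [::] ls ga a0 ay cl).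
have Fl := ForallP_and (path_letters_valid v1 cl) (path_bounds ay cl).
have Fk := ForallP_and (path_letters_valid v2 ck) (path_bounds a0 ck).
case: ks R Fk {ck} => // k0 ks [_ R] [_ Fk]; exists ks.
apply: all2P_impl (all2P_Forall2 Fl Fk R) => -[l1 l2] [k1 k2] [[vl [/= b1 b2 b3]] [vk [/= c1 c2 c3]] K].
split => //; first by rewrite /apartl /apart /= (le_trans c3 b1).
by move=> u; apply: realizes_le K.
Qed.

Lemma goodl_right (y a : B) : gin a -> gin y -> y < a ->
  bf (osucc (osucc al)) [:: (a, 1) : letter B] [:: (y, 1) : letter B] -> goodl (y, a).
Proof.
move=> ga gy ya L; have a1 := gin_lt1 ga.
have v1 : valid_letter (y, a) by apply: valid_gin; auto.
have v2 : valid_letter (a, 1) by apply: valid_gin; auto.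
apply: goodlI => // ls cl.
have c : cutw [:: (y, 1) : letter B] (ls ++ [:: (a, 1) : letter B]).
  by apply: (@cutw_extend B y a 1) => //; apply: cutw_refl.
have [ks ck R] := bf_path1 (olt_osucc (osucc al)) L c.
have Fl := ForallP_and (path_letters_valid v1 cl) (path_bounds ya cl).
have Fk := ForallP_and (path_letters_valid v2 ck) (path_bounds a1 ck).
have [ks1 [ks2 [E R1 _]]] := all2P_catl R; exists ks1.
move: Fk; rewrite E => /ForallP_cat [Fk _].
apply: all2P_impl (all2P_Forall2 Fl Fk R1) => -[l1 l2] [k1 k2] [[vl [/= b1 b2 b3]] [vk [/= c1 c2 c3]] K].
split => //; first by rewrite /apartl /apart /= (le_trans b3 c1) orbT.
by move=> u; apply: realizes_le K.
Qed.

Lemma iterate_choice (P : rat -> Prop) (Q : rat -> rat -> Prop) x0 : P x0 ->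
  (forall x, P x -> exists2 y, P y & Q x y) ->
  exists q : nat -> rat, [/\ q 0%N = x0, forall i, P (q i) & forall i, Q (q i) (q i.+1)].
Proof.
move=> P0 step; have /choice [f Hf] : forall x, exists y, P x -> P y /\ Q x y.
  move=> x; have [Px|nP] := pselect (P x); last by exists x.
  by have [y Py Qy] := step x Px; exists y.
have Pi i : P (iter i f x0) by elim: i => //= i IH; case: (Hf _ IH).
by exists (fun i => iter i f x0); split => // i; case: (Hf _ (Pi i)).
Qed.

(* If [(y, 1)] realizes whatever [(x, 1)] does, then [(y, 1)] always starts with
   a copy of [(x, y)], and what follows this copy is as generic as [(y, 1)]. *)
Lemma absorb_right (x y : B) : gin y -> x < y -> goodl (x, y) ->
  bf (osucc al) [:: (y, 1) : letter B] [:: (x, 1) : letter B] ->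
  exists q : nat -> rat, q 0%N = y /\
    forall i, [/\ gin (q i), q i < q i.+1, goodl (q i, q i.+1) & bis (q i : B) (q i.+1) x y].
Proof.
move=> gy xy g L; have y1 := gin_lt1 gy; have x1 := lt_trans xy y1.
have [n0 o0 _] := g; have [bx by_ _] := o0.
have oV : ok n0 (y, 1) by split => //; apply: bd1.
have oW : ok n0 (x, 1) by split => //; apply: bd1.
have [m n0m K] := gen (2%N, (x, 1), (y, 1), 0%N, 0%N, 0%N) n0.
case: K => [[]|K].
  have /(realizes_ge m) [M [mM oM EM]] : realizes (y, 1) (wd m (x, 1)).
    apply: realizes_le L _; [by exists n0 | by exists n0 |].
    by exists m; [apply: ok_le oW | apply: ext_refl].
  by exists (wd M (y, 1)) => //; apply: ext_wd => //; apply: ok_le oV.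
have [m' [mm' o' g']] := goodl_ge m g.
have n0m' := leq_trans n0m mm'.
set d := wd m' (x, y) in g'; set v := wd m' (y, 1).
(* Requirement 2, applied here to overlapping intervals, is excluded from stage [m] on. Refining
   [(y, 1)] alone leaves [d] in place, so [d ++ v'] and [v'] are compatible. *)
have H v' : ext al v v' -> compat al (d ++ v) v'.
  move=> vv'; have [q [pq Eq Aq]] := refine_wd (ok_le n0m' oV) vv'.
  have : compat al (seg q x 1) (seg q y 1).
    by apply: contrapT; apply: (K q); apply: extends_trans pq; apply: ep.
  case: (pq) => /and3P [pw _ _] _ _; rewrite (seg_cat pw (ltW xy) (ltW y1)) Eq.
  case: o' => bx' by' _; rewrite Aq //; last by rewrite /apart lexx.
  case=> t t1 t2; exists t => //; apply: ext_trans t1; apply: ext_cat => //; exact: ext_refl.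
pose P c := gin c /\ realizes (c, 1) v.
pose Q c c' := c < c' /\ realizes (c, c') d.
have P0 : P y.
  by split => //; exists m'; [apply: ok_le oV | apply: ext_refl].
have step c : P c -> exists2 c', P c' & Q c c'.
  move=> [gc [n o E]]; have : realizes (c, 1) (d ++ v).
    apply: (realizes_compat o) => k nk; apply: H; apply: ext_trans E _; exact: ext_wd.
  case/realizes_cat=> [||c' [gc' cc' c1 r1 r2]]; try by apply: nemp_wd => //; apply: ok_le oV.
  by exists c'.
have [q [q0 Pq Qq]] := iterate_choice P0 step.
exists q; split => // i; have [gi _] := Pq i; have [li ri] := Qq i; split => //.
  by case: ri => k ok_k Ek; exists k => //; apply: good_ext Ek.
apply: (@bis_good (q i, q i.+1) (x, y) d g' ri).
by exists m' => //; apply: ext_refl.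
Qed.

Lemma absorb_left (x y : B) : gin x -> x < y -> goodl (x, y) ->
  bf (osucc al) [:: (0, x) : letter B] [:: (0, y) : letter B] ->
  exists q : nat -> rat, q 0%N = x /\
    forall i, [/\ gin (q i), q i.+1 < q i, goodl (q i.+1, q i) & bis (q i.+1 : B) (q i) x y].
Proof.
move=> gx xy g L; have [x0 _] := gx; have y0 := lt_trans x0 xy.
have [n0 o0 _] := g; have [bx by_ _] := o0.
have oV : ok n0 (0, x) by split => //; apply: bd0.
have oW : ok n0 (0, y) by split => //; apply: bd0.
have [m n0m K] := gen (2%N, (0, y), (0, x), 0%N, 0%N, 0%N) n0.
case: K => [[]|K].
  have /(realizes_ge m) [M [mM oM EM]] : realizes (0, x) (wd m (0, y)).
    apply: realizes_le L _; [by exists n0 | by exists n0 |].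
    by exists m; [apply: ok_le oW | apply: ext_refl].
  by exists (wd M (0, x)) => //; apply: ext_wd => //; apply: ok_le oV.
have [m' [mm' o' g']] := goodl_ge m g.
have n0m' := leq_trans n0m mm'.
set d := wd m' (x, y) in g'; set v := wd m' (0, x).
have H v' : ext al v v' -> compat al (v ++ d) v'.
  move=> vv'; have [q [pq Eq Aq]] := refine_wd (ok_le n0m' oV) vv'.
  have : compat al (seg q 0 y) (seg q 0 x).
    by apply: contrapT; apply: (K q); apply: extends_trans pq; apply: ep.
  case: (pq) => /and3P [pw _ _] _ _; rewrite (seg_cat pw (ltW x0) (ltW xy)) Eq.
  case: o' => bx' by' _; rewrite Aq //; last by rewrite /apart lexx orbT.
  case=> t t1 t2; exists t => //; apply: ext_trans t1; apply: ext_cat => //; exact: ext_refl.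
pose P c := gin c /\ realizes (0, c) v.
pose Q c c' := c' < c /\ realizes (c', c) d.
have P0 : P x.
  by split => //; exists m'; [apply: ok_le oV | apply: ext_refl].
have step c : P c -> exists2 c', P c' & Q c c'.
  move=> [gc [n o E]]; have : realizes (0, c) (v ++ d).
    apply: (realizes_compat o) => k nk; apply: H; apply: ext_trans E _; exact: ext_wd.
  case/realizes_cat=> [||c' [gc' cc' c1 r1 r2]]; try by apply: nemp_wd => //; apply: ok_le oV.
  by exists c'.
have [q [q0 Pq Qq]] := iterate_choice P0 step.
exists q; split => // i; have [gi _] := Pq i; have [li ri] := Qq i; split => //.
  by case: ri => k ok_k Ek; exists k => //; apply: good_ext Ek.
apply: (@bis_good (q i.+1, q i) (x, y) d g' ri).
by exists m' => //; apply: ext_refl.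
Qed.

(** Finitely many copies of [(x, y)] form a good interval. If they reached [r], then [(y, r)] would
    be good; so all the copies fit below [r], where one more can be absorbed. *)
Lemma bis_shift_right (x y r : B) : gin y -> x < y -> goodl (x, y) ->
  bf (osucc al) [:: (y, 1) : letter B] [:: (x, 1) : letter B] ->
  valid_letter (y, r) -> ~ goodl (y, r) -> bis x r y r.
Proof.
move=> gy xy g L v N; have [q [q0 Q]] := absorb_right gy xy g L.
have gq i : goodl (y, q i.+1).
  elim: i => [|i IH]; first by rewrite -{1}q0; case: (Q 0%N).
  by apply: goodl_cat IH _; case: (Q i.+1).
apply: (@bis_absorb B x y r q q0 xy) => i; have [gi li gi' bi] := Q i; split => //.
rewrite /= ltNge; apply/negP => rq; apply: N.
apply: goodl_sub (gq i) v _ _ => //; exact: le_trans rq (ltW li).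
Qed.

Lemma bis_shift_left (r x y : B) : gin x -> x < y -> goodl (x, y) ->
  bf (osucc al) [:: (0, x) : letter B] [:: (0, y) : letter B] ->
  valid_letter (r, x) -> ~ goodl (r, x) -> bis r y r x.
Proof.
move=> gx xy g L v N; have [q [q0 Q]] := absorb_left gx xy g L.
have gq i : goodl (q i.+1, x).
  elim: i => [|i IH]; first by case: (Q 0%N); rewrite q0.
  by apply: goodl_cat _ IH; case: (Q i.+1).
apply: bis_rev; apply: (@bis_absorb (rev_chain B) y x r q q0 xy) => i.
have [gi li gi' bi] := Q i; split => //; last exact: (@bis_rev (rev_chain B)).
rewrite /= ltNge; apply/negP => rq; apply: N.
apply: goodl_sub (gq i) v _ _ => //; exact: le_trans (ltW li) rq.
Qed.

(** Equality is the case of the bounds 0 and 1, which are not points of the order. *)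
Definition matched (a y : B) := a = y \/
  [/\ gin a, gin y, bf (osucc (osucc al)) [:: (0, a) : letter B] [:: (0, y) : letter B] &
      bf (osucc (osucc al)) [:: (a, 1) : letter B] [:: (y, 1) : letter B]].

Let lt_osucc2 : olt (osucc al) (osucc (osucc al)) := olt_osucc (osucc al).

Lemma bis_left_end (a y b : B) : matched a y -> valid_letter (a, b) -> ~ goodl (a, b) ->
  [/\ valid_letter (y, b), ~ goodl (y, b) & bis a b y b].
Proof.
case=> [<- v N|]; first by split => //; apply: bis_refl.
case=> ga gy Ll Lr v N; have [n [ba bb ab]] := v.
case: (ltgtP a y) => [ay|ya|E].
- have g := goodl_left ga gy ay Ll.
  have yb : y < b.
    by rewrite ltNge; apply/negP => b_y; apply: N; apply: goodl_sub g v _ _.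
  have v' : valid_letter (y, b).
    have [m nm by_] := gin_bd n gy; exists m; split => //; exact: bd_extends (ep nm) bb.
  have N' : ~ goodl (y, b) by move=> g'; apply: N; apply: goodl_cat g g'.
  (* Here the final segments are compared against the direction of the hypothesis, at the price of
     one level. *)
  split => //; apply: bis_shift_right => //; exact: bf_drop lt_osucc2 Lr.
- have g := goodl_right ga gy ya Lr.
  have yb := lt_trans ya ab.
  have v' : valid_letter (y, b).
    have [m nm by_] := gin_bd n gy; exists m; split => //; exact: bd_extends (ep nm) bb.
  split => //.
    by move=> g'; apply: N; apply: goodl_sub g' v (ltW ya) _.
  apply: bis_sym; apply: bis_shift_right => //.
  exact: bf_mono (olt_ole lt_osucc2) Lr.
- by rewrite -E; split => //; apply: bis_refl.
Qed.

Lemma bis_right_end (a b d : B) : matched b d -> valid_letter (a, b) -> ~ goodl (a, b) ->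
  bis a b a d.
Proof.
case=> [<- v N|]; first exact: bis_refl.
case=> gb gd Ll Lr v N; have [n [ba bb ab]] := v.
case: (ltgtP b d) => [b_d|db|E].
- have g := goodl_left gb gd b_d Ll.
  by apply: bis_sym; apply: bis_shift_left => //; apply: bf_mono (olt_ole lt_osucc2) Ll.
- have g := goodl_right gb gd db Lr.
  have ad : a < d.
    by rewrite ltNge; apply/negP => da; apply: N; apply: goodl_sub g v da _.
  apply: bis_shift_left => //; first exact: bf_drop lt_osucc2 Ll.
    have [m nm by_] := gin_bd n gd; exists m; split => //; exact: bd_extends (ep nm) ba.
  by move=> g'; apply: N; apply: goodl_cat g' g.
- by rewrite -E; apply: bis_refl.
Qed.

(* If [(a, b)] is good, its isomorphism type is determined by any of the words it
   realizes. Otherwise the intervals between matched ends are good, and so [(a, b)]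
   absorbs them at both ends. *)
Lemma bis_gap (a b y d : B) : valid_letter (a, b) -> valid_letter (y, d) ->
  matched a y -> matched b d ->
  bf (osucc (osucc al)) [:: (a, b) : letter B] [:: (y, d) : letter B] -> bis a b y d.
Proof.
move=> v v' may mbd L.
have [g|N] := pselect (goodl (a, b)).
  have [u gu r] := goodl_realizes g; apply: (@bis_good (a, b) (y, d) u) => //.
  by apply: realizes_le v' v _ r; apply: bf_drop lt_osucc2 L.
have [vy Ny by_] := bis_left_end may v N.
exact: bis_trans by_ (bis_right_end mbd vy Ny).
Qed.

End Generic.

(** * Definability *)

Lemma sat_exs (M : structure) k n (psi : formula (k + n)) (v : 'I_n -> M) :
  sat (f_exs psi) v <-> exists2 e : 'I_(k + n) -> M, (forall i, e (rshift k i) = v i) & sat psi e.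
Proof.
elim: k n psi v => [|k IH] n psi v.
  split=> [H|[e E H]].
    by exists v => // i; congr (v _); apply: val_inj.
  suff <- : e = v by []; apply: funext => i.
  by rewrite -E; congr (e _); apply: val_inj.
have S i : rshift k.+1 i = lift ord0 (rshift k i : 'I_(k + n)) by apply: val_inj.
split=> [/= /IH [e E [x H]]|[e E H]].
  exists (env_cons x e) => // i.
  by rewrite S /env_cons liftK E.
apply/IH; exists (fun i => e (lift ord0 i)) => [i|]; first by rewrite -E S.
exists (e ord0); suff -> : env_cons (e ord0) (fun i => e (lift ord0 i)) = e by [].
apply: funext => i; rewrite /env_cons.
by case: unliftP => [j ->|->].
Qed.

Lemma sat_alls (M : structure) k n (psi : formula (k + n)) (v : 'I_n -> M) :
  sat (f_alls psi) v <-> forall e : 'I_(k + n) -> M, (forall i, e (rshift k i) = v i) -> sat psi e.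
Proof.
elim: k n psi v => [|k IH] n psi v.
  split=> [H e E|H].
    suff -> : e = v by []; apply: funext => i.
    by rewrite -E; congr (e _); apply: val_inj.
  by apply: H => i; congr (v _); apply: val_inj.
have S i : rshift k.+1 i = lift ord0 (rshift k i : 'I_(k + n)) by apply: val_inj.
split=> [/= /IH H e E|H].
  have /= := H (fun i => e (lift ord0 i)) _ (e ord0); set e' := env_cons _ _.
  suff -> : e' = e by apply => i; rewrite -E S.
  apply: funext => i; rewrite /e' /env_cons.
  by case: unliftP => [j ->|->].
apply/IH => e E x; apply: H => i.
by rewrite S /env_cons liftK E.
Qed.

Scheme is_Sigma_mut := Minimality for is_Sigma Sort Prop
with is_Pi_mut := Minimality for is_Pi Sort Prop.
Combined Scheme Sigma_Pi_mut from is_Sigma_mut, is_Pi_mut.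

Lemma olt0 a b : olt b a -> olt ozero a.
Proof. by case: a => // f _; exists 0. Qed.

Lemma is_Sigma_inv a n (phi : formula n) : is_Sigma a phi -> olt ozero a ->
  exists (D : set nat) (k : nat -> nat) (psi : forall i, formula (k i + n)) b,
    [/\ phi = f_or D (fun i => f_exs (psi i)), forall i, D i -> olt (b i) a &
        forall i, D i -> is_Pi (b i) (psi i)].
Proof. by case=> [? ? ? []|a0 m D k psi b _ H K _]; exists D, k, psi, b. Qed.

Lemma is_Pi_inv a n (phi : formula n) : is_Pi a phi -> olt ozero a ->
  exists (D : set nat) (k : nat -> nat) (psi : forall i, formula (k i + n)) b,
    [/\ phi = f_and D (fun i => f_alls (psi i)), forall i, D i -> olt (b i) a &
        forall i, D i -> is_Sigma (b i) (psi i)].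
Proof. by case=> [? ? ? []|a0 m D k psi b _ H K _]; exists D, k, psi, b. Qed.

Definition relation n := forall M : structure, ('I_n -> M) -> Prop.

Definition Sigma_def a n (P : relation n) :=
  exists2 phi : formula n, is_Sigma a phi & forall M v, sat phi v <-> P M v.
Definition Pi_def a n (P : relation n) :=
  exists2 phi : formula n, is_Pi a phi & forall M v, sat phi v <-> P M v.

Lemma Sigma_def_iff a n (P Q : relation n) : (forall M v, P M v <-> Q M v) ->
  Sigma_def a P -> Sigma_def a Q.
Proof. by move=> E [phi H K]; exists phi => // M v; rewrite K. Qed.

Lemma Pi_def_iff a n (P Q : relation n) : (forall M v, P M v <-> Q M v) ->
  Pi_def a P -> Pi_def a Q.
Proof. by move=> E [phi H K]; exists phi => // M v; rewrite K. Qed.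

(* Out of its index set, a family of matrices is filled with the formula [x_0 <= x_0]. *)
Definition triv n : formula (1 + n) := f_le ord0 ord0.

Lemma family_choice a n (D : set nat) (Cl : cord -> forall m, formula m -> Prop)
    (R : nat -> forall k, formula (k + n) -> Prop) :
  (forall i, D i -> exists k (psi : formula (k + n)) b,
     [/\ olt b a, Cl b _ psi & R i k psi]) ->
  exists (k : nat -> nat) (psi : forall i, formula (k i + n)) b,
    [/\ forall i, D i -> olt (b i) a, forall i, D i -> Cl (b i) _ (psi i) &
        forall i, D i -> R i (k i) (psi i)].
Proof.
move=> H; have /choice [F HF] : forall i, exists t : {k & formula (k + n)} * cord,
    D i -> [/\ olt t.2 a, Cl t.2 _ (projT2 t.1) & R i (projT1 t.1) (projT2 t.1)].
  move=> i; have [Di|nD] := pselect (D i).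
    by have [k [psi [b K]]] := H i Di; exists (existT _ k psi, b).
  by exists (existT (fun k => formula (k + n)) 1 (triv n), ozero).
exists (fun i => projT1 (F i).1), (fun i => projT2 (F i).1), (fun i => (F i).2).
by split=> i /HF [].
Qed.

Lemma Sigma_def_all a b k n (Q : relation (k + n)) : olt b a -> Sigma_def b Q ->
  Pi_def a (fun M (v : 'I_n -> M) =>
    forall e : 'I_(k + n) -> M, (forall i, e (rshift k i) = v i) -> Q M e).
Proof.
move=> ba [psi H K].
exists (f_and [set 0] (fun i => f_alls (k := k) psi)).
  apply: (@Pi_and a n [set 0] (fun _ => k) (fun _ => psi) (fun _ => b)) => //.
  exact: olt0 ba.
move=> M v /=; split=> [/(_ 0 erefl) /sat_alls S e E|S i _].
  by apply/K/S.
by apply/sat_alls => e E; apply/K/S.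
Qed.

Lemma Pi_def_ex a b k n (Q : relation (k + n)) : olt b a -> Pi_def b Q ->
  Sigma_def a (fun M (v : 'I_n -> M) =>
    exists2 e : 'I_(k + n) -> M, (forall i, e (rshift k i) = v i) & Q M e).
Proof.
move=> ba [psi H K].
exists (f_or [set 0] (fun i => f_exs (k := k) psi)).
  apply: (@Sigma_or a n [set 0] (fun _ => k) (fun _ => psi) (fun _ => b)) => //.
  exact: olt0 ba.
move=> M v /=; split=> [[i _] /sat_exs [e E S]|[e E S]].
  by exists e => //; apply/K.
by exists 0 => //; apply/sat_exs; exists e => //; apply/K.
Qed.

Lemma Pi_def_Sigma a b n (P : relation n) : olt b a -> Pi_def b P -> Sigma_def a P.
Proof.
move=> ba H; apply: Sigma_def_iff (Pi_def_ex (k := 0) (n := n) ba H) => M v.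
have E0 i : rshift 0 i = i :> 'I_(0 + n) by apply: val_inj.
split=> [[e E He]|Pv]; last by exists v => // i; rewrite E0.
by suff <- : e = v by []; apply: funext => i; rewrite -E E0.
Qed.

Lemma qf_Pi_def n (phi : formula n) (P : relation n) : finitary_qf phi ->
  (forall M v, sat phi v <-> P M v) -> Pi_def ozero P.
Proof. by move=> q H; exists phi => //; constructor. Qed.

Lemma Sigma_def_mono a b n (P : relation n) : olt ozero b -> ole b a ->
  Sigma_def b P -> Sigma_def a P.
Proof.
move=> b0 ba [phi H K]; exists phi => //.
have [D [k [psi [c [-> L S]]]]] := is_Sigma_inv H b0.
apply: (@Sigma_or a n D k psi c) => //; first exact: olt_ole_trans ba.
by move=> i /L ci; apply: olt_ole_trans ba.
Qed.

Lemma Pi_def_mono a b n (P : relation n) : olt ozero b -> ole b a ->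
  Pi_def b P -> Pi_def a P.
Proof.
move=> b0 ba [phi H K]; exists phi => //.
have [D [k [psi [c [-> L S]]]]] := is_Pi_inv H b0.
apply: (@Pi_and a n D k psi c) => //; first exact: olt_ole_trans ba.
by move=> i /L ci; apply: olt_ole_trans ba.
Qed.

(** A conjunction of countable conjunctions is again one, indexed by codes of pairs. Level 0 has
    only finite conjunctions. *)
Lemma Pi_def_conj a n (T : countType) (P : T -> relation n) : olt ozero a ->
  (forall t, Pi_def a (P t)) -> Pi_def a (fun M v => forall t, P t M v).
Proof.
move=> a0 H.
have /choice [phi Hphi] : forall t, exists phi : formula n, is_Pi a phi /\
    forall M v, sat phi v <-> P t M v by move=> t; have [phi ? ?] := H t; exists phi.
pose dec i := if unpickle i is Some (t, j) then Some (t : T, j : nat) else None.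
have inv t : exists F : set nat * (nat -> formula n), phi t = f_and F.1 F.2 /\
    forall j, F.1 j -> exists k (psi : formula (k + n)) b,
      [/\ olt b a, is_Sigma b psi & F.2 j = f_alls psi].
  have [D [k [psi [b [E L S]]]]] := is_Pi_inv (proj1 (Hphi t)) a0.
  exists (D, fun i => f_alls (psi i)); split => // j Dj.
  by exists (k j), (psi j), (b j); split => //; [apply: L | apply: S].
have [F HF] := choice inv.
pose D i := if dec i is Some (t, j) then (F t).1 j else False.
have [|k [psi [b [L S E]]]] := @family_choice a n D is_Sigma
    (fun i k psi => if dec i is Some (t, j) then (F t).2 j = f_alls psi else True).
  move=> i; rewrite /D; case: (dec i) => // -[t j] /(proj2 (HF t)) [k [psi [b [? ? ?]]]].
  by exists k, psi, b.
exists (f_and D (fun i => f_alls (psi i))); first exact: (@Pi_and a n D k psi b).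
move=> M v /=; split=> [H1 t|H1 i Di].
  apply/(proj2 (Hphi t)); rewrite (proj1 (HF t)) /= => j Fj.
  have Ei : dec (pickle (t, j)) = Some (t, j) by rewrite /dec pickleK.
  have Di : D (pickle (t, j)) by rewrite /D Ei.
  by have := E _ Di; rewrite Ei => ->; apply: H1.
have Ei := E i Di; move: Di Ei; rewrite /D; case: (dec i) => // -[t j] Fj <-.
by have /(proj2 (Hphi t)) := H1 t; rewrite (proj1 (HF t)) /=; apply.
Qed.

Lemma neg_def :
  (forall a n (phi : formula n), is_Sigma a phi ->
     exists2 phi', is_Pi a phi' & forall M v, sat (M := M) phi' v <-> ~ sat phi v) /\
  (forall a n (phi : formula n), is_Pi a phi ->
     exists2 phi', is_Sigma a phi' & forall M v, sat (M := M) phi' v <-> ~ sat phi v).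
Proof.
apply: Sigma_Pi_mut.
- move=> n phi q; exists (f_not phi) => //; constructor; exact: qf_not.
- move=> a n D k psi b a0 L _ IH.
  have [|k' [psi' [b' [L' S' R]]]] := @family_choice a n D is_Sigma
      (fun i k' psi' => forall M v, sat (M := M) (f_alls psi') v <-> ~ sat (f_exs (psi i)) v).
    move=> i Di; have [chi c1 c2] := IH i Di; exists (k i), chi, (b i); split => //; first exact: L.
    move=> M v; split=> [/sat_alls H /sat_exs [e E K]|H]; first by have /c2 := H e E.
    by apply/sat_alls => e E; apply/c2 => K; apply: H; apply/sat_exs; exists e.
  exists (f_and D (fun i => f_alls (psi' i))); first exact: (@Pi_and a n D k' psi' b').
  move=> M v /=; split=> [H [i Di]|H i Di]; first by apply/R => //; apply: H.
  by apply/R => // K; apply: H; exists i.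
- move=> n phi q; exists (f_not phi) => //; constructor; exact: qf_not.
- move=> a n D k psi b a0 L _ IH.
  have [|k' [psi' [b' [L' S' R]]]] := @family_choice a n D is_Pi
      (fun i k' psi' => forall M v, sat (M := M) (f_exs psi') v <-> ~ sat (f_alls (psi i)) v).
    move=> i Di; have [chi c1 c2] := IH i Di; exists (k i), chi, (b i); split => //; first exact: L.
    move=> M v; split=> [/sat_exs [e E /c2 K] /sat_alls H|H]; first by apply: K; apply: H.
    apply/sat_exs; apply: contrapT => N; apply: H; apply/sat_alls => e E.
    by apply: contrapT => K; apply: N; exists e => //; apply/c2.
  exists (f_or D (fun i => f_exs (psi' i))); first exact: (@Sigma_or a n D k' psi' b').
  move=> M v /=; split=> [[i Di /R] H K|/existsNP [i /not_implyP [Di H]]].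
    by apply: H => //; apply: K.
  by exists i => //; apply/R.
Qed.

Lemma Pi_def_neg a n (P : relation n) : Pi_def a P -> Sigma_def a (fun M v => ~ P M v).
Proof.
case=> phi H K; have [phi' H' K'] := proj2 neg_def _ _ _ H.
by exists phi' => // M v; rewrite K' K.
Qed.

Lemma Sigma_def_neg a n (P : relation n) : Sigma_def a P -> Pi_def a (fun M v => ~ P M v).
Proof.
case=> phi H K; have [phi' H' K'] := proj1 neg_def _ _ _ H.
by exists phi' => // M v; rewrite K' K.
Qed.

Lemma Sigma_def_disj a n (T : countType) (P : T -> relation n) : olt ozero a ->
  (forall t, Sigma_def a (P t)) -> Sigma_def a (fun M v => exists t, P t M v).
Proof.
move=> a0 H; apply: Sigma_def_iff (Pi_def_neg (Pi_def_conj a0 (fun t => Sigma_def_neg (H t)))).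
by move=> M v; split=> [/existsNP [t /contrapT Pt]|[t Pt] K]; [exists t | apply: (K t)].
Qed.

Lemma Sigma_def_or a n (P Q : relation n) : olt ozero a -> Sigma_def a P -> Sigma_def a Q ->
  Sigma_def a (fun M v => P M v \/ Q M v).
Proof.
move=> a0 HP HQ.
have := @Sigma_def_disj a n bool (fun t => if t then P else Q) a0.
case=> [[] //|phi H K]; exists phi => // M v; rewrite K.
by split=> [[[] ?]|[?|?]]; [left|right|exists true|exists false].
Qed.

(** * Renaming of free variables *)

Definition up n m (f : 'I_n -> 'I_m) (i : 'I_n.+1) : 'I_m.+1 :=
  if unlift ord0 i is Some j then lift ord0 (f j) else ord0.

Fixpoint rename n (phi : formula n) : forall m, ('I_n -> 'I_m) -> formula m :=
  match phi in formula n return forall m, ('I_n -> 'I_m) -> formula m with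
  | f_le _ i j => fun m f => f_le (f i) (f j)
  | f_eq _ i j => fun m f => f_eq (f i) (f j)
  | f_not _ psi => fun m f => f_not (rename psi f)
  | f_and _ D F => fun m f => f_and D (fun i => rename (F i) f)
  | f_or _ D F => fun m f => f_or D (fun i => rename (F i) f)
  | f_all _ psi => fun m f => f_all (rename psi (up f))
  | f_ex _ psi => fun m f => f_ex (rename psi (up f))
  end.

Lemma env_cons_up (M : Type) n m (f : 'I_n -> 'I_m) (x : M) v :
  (fun i => env_cons x v (up f i)) = env_cons x (fun i => v (f i)).
Proof.
apply: funext => i; rewrite /env_cons /up.
by case: (unlift ord0 i) => [j|]; rewrite ?liftK ?unlift_none.
Qed.

Lemma sat_rename (M : structure) n (phi : formula n) m (f : 'I_n -> 'I_m) (v : 'I_m -> M) :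
  sat (rename phi f) v <-> sat phi (fun i => v (f i)).
Proof.
elim: phi m f v => //= {n}.
- by move=> n psi IH m f v; rewrite IH.
- by move=> n D F IH m f v; split=> H k Dk; apply/IH; apply: H.
- by move=> n D F IH m f v; split=> -[k Dk H]; exists k => //; apply/IH.
- by move=> n psi IH m f v; split=> H x; have := H x; rewrite IH env_cons_up.
- by move=> n psi IH m f v; split=> -[x H]; exists x; move: H; rewrite IH env_cons_up.
Qed.

Fixpoint upn k n m (f : 'I_n -> 'I_m) : 'I_(k + n) -> 'I_(k + m) :=
  match k return 'I_(k + n) -> 'I_(k + m) with 0 => f | k'.+1 => up (@upn k' n m f) end.

Lemma rename_exs k n m (psi : formula (k + n)) (f : 'I_n -> 'I_m) :
  rename (f_exs psi) f = f_exs (rename psi (@upn k n m f)).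
Proof. by elim: k psi => //= k IH psi; rewrite IH. Qed.

Lemma rename_alls k n m (psi : formula (k + n)) (f : 'I_n -> 'I_m) :
  rename (f_alls psi) f = f_alls (rename psi (@upn k n m f)).
Proof. by elim: k psi => //= k IH psi; rewrite IH. Qed.

Lemma finitary_qf_rename n (phi : formula n) : finitary_qf phi ->
  forall m (f : 'I_n -> 'I_m), finitary_qf (rename phi f).
Proof. by elim=> /= *; constructor; auto. Qed.

Lemma class_rename :
  (forall a n (phi : formula n), is_Sigma a phi ->
     forall m (f : 'I_n -> 'I_m), is_Sigma a (rename phi f)) /\
  (forall a n (phi : formula n), is_Pi a phi ->
     forall m (f : 'I_n -> 'I_m), is_Pi a (rename phi f)).
Proof.
apply: Sigma_Pi_mut.
- by move=> n phi q m f; constructor; apply: finitary_qf_rename.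
- move=> a n D k psi b a0 L _ IH m f /=.
  rewrite (_ : (fun i => _) = fun i => f_exs (rename (psi i) (@upn (k i) n m f))); last first.
    by apply: funext => i; rewrite rename_exs.
  by apply: (@Sigma_or a m D k _ b) => // i Di; apply: IH.
- by move=> n phi q m f; constructor; apply: finitary_qf_rename.
- move=> a n D k psi b a0 L _ IH m f /=.
  rewrite (_ : (fun i => _) = fun i => f_alls (rename (psi i) (@upn (k i) n m f))); last first.
    by apply: funext => i; rewrite rename_alls.
  by apply: (@Pi_and a m D k _ b) => // i Di; apply: IH.
Qed.

Lemma Sigma_def_rename a n m (f : 'I_n -> 'I_m) (P : relation n) : Sigma_def a P ->
  Sigma_def a (fun M (v : 'I_m -> M) => P M (fun i => v (f i))).
Proof.
case=> phi H K; exists (rename phi f); first exact: (proj1 class_rename).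
by move=> M v; rewrite sat_rename K.
Qed.

(** * Transfer of Pi formulas along the back-and-forth relations *)

(** The common presentation of the given order with two added ends and of the generic order among
    the rationals. *)
Record rep (M : structure) (C : chain) := Rep {
  emb :> M -> C;
  lo : C;
  hi : C;
  emb_in : forall x, cin (emb x);
  emb_surj : forall c, cin c -> exists x, emb x = c;
  emb_inj : forall x y, emb x = emb y -> x = y;
  emb_le : forall x y, sle x y <-> emb x = emb y \/ clt (emb x) (emb y);
  lo_emb : forall x, clt lo (emb x);
  emb_hi : forall x, clt (emb x) hi;
  lo_hi : clt lo hi }.

(** [c] and [d] correspond as right ends of letters at the same position. *)
Fixpoint inz (C D : chain) (c : C) (d : D) (w : word C) (w' : word D) : Prop :=
  match w, w' with
  | s :: u, s' :: u' => (s.2 = c /\ s'.2 = d) \/ inz c d u u'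
  | _, _ => False
  end.

Fixpoint inr_ends (C : chain) (c : C) (w : word C) : Prop :=
  if w is s :: u then s.2 = c \/ inr_ends c u else False.

Section Words.
Variables C D : chain.

Lemma inz_catl (c : C) (d : D) (w1 : word C) (w1' : word D) w2 w2' : inz c d w1 w1' -> inz c d (w1 ++ w2) (w1' ++ w2').
Proof. by elim: w1 w1' => [|s w IH] [|s' w'] //= [?|/IH]; [left|right]. Qed.

Lemma inz_catr (R : letter C -> letter D -> Prop) (c : C) (d : D) (w1 : word C) (w1' : word D) w2 w2' :
  all2P R w1 w1' -> inz c d w2 w2' -> inz c d (w1 ++ w2) (w1' ++ w2').
Proof. by elim: w1 w1' => [|s w IH] [|s' w'] //= [_ /IH H] /H; right. Qed.

Lemma inz_last (R : letter C -> letter D -> Prop) s s' (w : word C) (w' : word D) : cutw [:: s] w -> cutw [:: s'] w' ->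
  all2P R w w' -> inz s.2 s'.2 w w'.
Proof.
elim: w s s' w' => [|t w IH] s s' [|t' w'] //=; first by move/cutw_nilr.
case: s s' => x y [x' y'] H H' [_ S].
inversion H as [|s0 w0 u0 K|a c z w0 u0 cz xz zy K]; subst.
  move/cutw_nill: K S => -> S; case: w' S H' => // _ H'.
  inversion H' as [|s0 w0 u0 K|a c z w0 u0 cz xz zy K]; subst; first by left.
  by move/cutw_nilr: K.
inversion H' as [|s0 w0 u0 K'|a' c' z' w0 u0 cz' xz' zy' K']; subst.
  by move/cutw_nill: K' S => ->; case: w {H IH} K => // /cutw_nilr.
by right; apply: IH K K' S.
Qed.

Lemma inr_inz (R : letter C -> letter D -> Prop) c (w : word C) (w' : word D) : all2P R w w' -> inr_ends c w ->
  exists d, inz c d w w'.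
Proof.
elim: w w' => [|s w IH] [|s' w'] //= [_ S] [E|/(IH _ S) [d H]]; last by exists d; right.
by exists s'.2; left.
Qed.

End Words.

Lemma inr_cutw (C : chain) (c : C) w u : cutw w u -> inr_ends c w -> inr_ends c u.
Proof.
move=> H; elim: H => //= [s w0 u0 _ IH [|/IH]|x y z w0 u0 _ _ _ _ IH K]; auto.
Qed.

Lemma insert_point (C : chain) (c : C) w x y : cutw [:: (x, y)] w -> cin c -> clt x c ->
  clt c y -> exists2 u, cutw w u & inr_ends c u.
Proof.
move=> H cc; elim: w x H => [|s w IH] x; first by move/cutw_nilr.
move=> H xc cy; inversion H as [|s0 w0 u0 K|a b z w0 u0 cz xz zy K]; subst.
  move/cutw_nill: K => ->; exists [:: (x, c); (c, y)]; last by left.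
  by apply: cut_at => //; apply: cutw_refl.
have [cz'|E|zc] := clt_total c z.
- exists ((x, c) :: (c, z) :: w); last by left.
  by apply: cut_at => //; apply: cutw_refl.
- by exists ((x, z) :: w); [apply: cutw_refl | left].
- have [u wu cu] := IH z K zc cy.
  by exists ((x, z) :: u); [apply: cut_keep | right].
Qed.

Section Paths.
Variables C D : chain.

Lemma path_inz (c : C) (d : D) x y x' y' w w' : cutw [:: (x, y)] w -> cutw [:: (x', y')] w' ->
  clt x y -> clt x' y' -> inz c d w w' ->
  [/\ clt x c, clt x' d & (c = y /\ d = y') \/ (cin c /\ cin d)] \/ ~ size w = size w'.
Proof.
move=> H H' xy xy'; have [E|N] := pselect (size w = size w'); last by right.
move=> Z; left; elim: w x x' w' H H' xy xy' E Z => [|s w IH] x x' [|s' w'] //.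
move=> H H' xy xy' [E].
inversion H as [|s0 w0 u0 K|a b z w0 u0 cz xz zy K]; subst.
  move/cutw_nill: K E => -> /esym/size0nil E; subst.
  inversion H' as [|s0 w0 u0 K'|a' b' z' w0 u0 cz' xz' zy' K']; subst; last by move/cutw_nilr: K'.
  by case=> //= -[<- <-]; split => //; left.
inversion H' as [|s0 w0 u0 K'|a' b' z' w0 u0 cz' xz' zy' K']; subst.
  by move/cutw_nill: K' E => -> /size0nil E; subst; move/cutw_nilr: K.
case=> [/= [<- <-]|Z]; first by split => //; right.
have [h1 h2 h3] := IH z z' w' K K' zy zy' E Z.
by split => //; [apply: clt_trans xz h1 | apply: clt_trans xz' h2].
Qed.

Lemma inz_order (c1 c2 : C) (d1 d2 : D) x y x' y' w w' :
  cutw [:: (x, y)] w -> cutw [:: (x', y')] w' -> clt x y -> clt x' y' ->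
  size w = size w' -> inz c1 d1 w w' -> inz c2 d2 w w' ->
  [\/ c1 = c2 /\ d1 = d2, clt c1 c2 /\ clt d1 d2 | clt c2 c1 /\ clt d2 d1].
Proof.
elim: w x x' w' => [|s w IH] x x' [|s' w'] // H H' xy xy' [E].
inversion H as [|s0 w0 u0 K|a b z w0 u0 cz xz zy K]; subst.
  move/cutw_nill: K E => -> /esym/size0nil -> /=.
  by case=> // -[<- <-] [] // [<- <-]; constructor 1.
inversion H' as [|s0 w0 u0 K'|a' b' z' w0 u0 cz' xz' zy' K']; subst.
  by move/cutw_nill: K' E => -> /size0nil E; subst; move/cutw_nilr: K.
case=> [/= [<- <-]|Z1] [/= [<- <-]|Z2].
- by constructor 1.
- by have [[h1 h2 _]|//] := path_inz K K' zy zy' Z2; constructor 2.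
- by have [[h1 h2 _]|//] := path_inz K K' zy zy' Z1; constructor 3.
- exact: IH K K' zy zy' E Z1 Z2.
Qed.

End Paths.

Lemma all2P_size T U (R : T -> U -> Prop) s t : all2P R s t -> size s = size t.
Proof. by elim: s t => [|x s IH] [|y t] //= [_ /IH ->]. Qed.

Lemma bf_step a b (C D : chain) (w : word C) (w' u' : word D) :
  all2P (fun s s' => bf a [:: s] [:: s']) w w' -> olt b a -> cutw w' u' ->
  exists u, [/\ cutw w u, all2P (fun s' s => bf b [:: s'] [:: s]) u' u &
    forall c c', inz c c' w w' -> inz c' c u' u].
Proof.
move=> R ba; elim: w w' R u' => [|s w IH] [|s' w'] //=.
  by move=> _ u' /cutw_nill ->; exists [::]; split => //; constructor.
case=> L R u' /cutw_consl [v1 [v2 [-> n1 H1 /(IH _ R) [u [cu Ru Z]]]]].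
have [ks ck K] := bf_path1 ba L H1.
exists (ks ++ u); split.
- exact: (cutw_cat ck cu).
- exact: all2P_cat.
- move=> c c' [[<- <-]|/Z H]; first by apply: inz_catl; apply: inz_last H1 ck K.
  exact: inz_catr K H.
Qed.

(** At level 0 [bf] says nothing; quantifier-free formulas are preserved because the positions of
    the cut points already fix the order of the tuples. *)
Definition sim b (M N : structure) (C D : chain) (r : rep M C) (r' : rep N D) n
    (v : 'I_n -> M) (v' : 'I_n -> N) :=
  exists w w', [/\ cutw [:: (lo r, hi r)] w, cutw [:: (lo r', hi r')] w',
    all2P (fun s s' => bf b [:: s] [:: s']) w w' & forall i, inz (r (v i)) (r' (v' i)) w w'].

Lemma sim_order b (M N : structure) (C D : chain) (r : rep M C) (r' : rep N D) n
    (v : 'I_n -> M) (v' : 'I_n -> N) i j : sim b r r' v v' ->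
  (sle (v i) (v j) = sle (v' i) (v' j)) /\ (v i = v j <-> v' i = v' j).
Proof.
case=> w [w' [H H' R Z]].
have irr (E : chain) (x y : E) : clt x y -> x <> y.
  by move=> xy E0; move: xy; rewrite E0; apply: clt_irr.
have asym (E : chain) (x y : E) : clt x y -> ~ clt y x.
  by move=> xy yx; apply: (clt_irr (clt_trans xy yx)).
have eqE (x y : M) : x = y <-> r x = r y by split=> [->//|/emb_inj].
have eqE' (x y : N) : x = y <-> r' x = r' y by split=> [->//|/emb_inj].
have bool (p q : bool) : (p <-> q) -> p = q by move=> H0; apply/idP/idP => /H0.
have [[e e']|[l l']|[l l']] := inz_order H H' (lo_hi r) (lo_hi r') (all2P_size R) (Z i) (Z j).
- split; last by rewrite eqE eqE' e e'.
  by apply: bool; rewrite (emb_le r) (emb_le r') e e'; split; left.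
- split; first by apply: bool; rewrite (emb_le r) (emb_le r'); split; right.
  by rewrite eqE eqE'; split=> E; [case: (irr _ _ _ l E) | case: (irr _ _ _ l' E)].
- split; last by rewrite eqE eqE'; split=> E; [case: (irr _ _ _ l (esym E)) | case: (irr _ _ _ l' (esym E))].
  apply: bool; rewrite (emb_le r) (emb_le r'); split=> -[E|K].
  + by case: (irr _ _ _ l (esym E)).
  + by case: (asym _ _ _ l K).
  + by case: (irr _ _ _ l' (esym E)).
  + by case: (asym _ _ _ l' K).
Qed.

Lemma insert_points (M : structure) (C : chain) (r : rep M C) k (e : 'I_k -> M) w :
  cutw [:: (lo r, hi r)] w -> exists2 u, cutw w u & forall i, inr_ends (r (e i)) u.
Proof.
elim: k e w => [|k IH] e w H; first by exists w; [apply: cutw_refl | case].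
have [u wu U] := IH (fun i => e (lift ord0 i)) w H.
have [t ut T] := insert_point (cutw_trans H wu) (emb_in r (e ord0)) (lo_emb r _) (emb_hi r _).
exists t; first exact: cutw_trans ut.
by move=> i; case: (unliftP ord0 i) => [j ->|->] //; apply: inr_cutw ut _.
Qed.

Lemma sim_step a b (M N : structure) (C D : chain) (r : rep M C) (r' : rep N D) k n
    (v : 'I_n -> M) (v' : 'I_n -> N) (e' : 'I_(k + n) -> N) :
  sim a r r' v v' -> olt b a -> (forall i, e' (rshift k i) = v' i) ->
  exists2 e : 'I_(k + n) -> M, (forall i, e (rshift k i) = v i) & sim b r' r e' e.
Proof.
case=> w [w' [H H' R Z]] ba E.
have [u' wu' U'] := insert_points e' H'.
have [u [cu Ru Zu]] := bf_step R ba wu'.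
have Hu := cutw_trans H cu; have Hu' := cutw_trans H' wu'.
have sz := all2P_size Ru.
have /choice [e He] : forall i, exists x : M, inz (r' (e' i)) (r x) u' u.
  move=> i; have [c Zc] := inr_inz Ru (U' i).
  have [[_ _ K]|//] := path_inz Hu' Hu (lo_hi r') (lo_hi r) Zc.
  case: K => [[E1 _]|[_ /(emb_surj r) [x Ex]]]; last by exists x; rewrite Ex.
  by have := emb_hi r' (e' i); rewrite E1 => /clt_irr.
exists e; last by exists u', u.
move=> i; apply: (@emb_inj _ _ r).
have K := Zu _ _ (Z i); rewrite -E in K.
have [[_ //]|[l _]|[l _]] := inz_order Hu' Hu (lo_hi r') (lo_hi r) sz (He (rshift k i)) K.
  by case: (clt_irr l).
by case: (clt_irr l).
Qed.

Lemma qf_invariant n (phi : formula n) : finitary_qf phi -> forall (M N : structure)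
    (v : 'I_n -> M) (v' : 'I_n -> N),
  (forall i j, sle (v i) (v j) = sle (v' i) (v' j)) ->
  (forall i j, v i = v j <-> v' i = v' j) -> sat phi v <-> sat phi v'.
Proof.
elim=> {n phi} /=.
- by move=> n i j M N v v' L _; rewrite L.
- by move=> n i j M N v v' _ E.
- by move=> n phi _ IH M N v v' L E; rewrite (IH _ _ _ _ L E).
- by move=> n D f _ _ IH M N v v' L E; split=> H k Dk; apply/(IH k Dk _ _ _ _ L E); apply: H.
- by move=> n D f _ _ IH M N v v' L E; split=> -[k Dk H]; exists k => //;
    apply/(IH k Dk _ _ _ _ L E).
Qed.

Lemma sim_preserves :
  (forall a n (phi : formula n), is_Sigma a phi ->
     forall M N (C D : chain) (r : rep M C) (r' : rep N D) (v : 'I_n -> M) (v' : 'I_n -> N),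
     sim a r' r v' v -> sat phi v -> sat phi v') /\
  (forall a n (phi : formula n), is_Pi a phi ->
     forall M N (C D : chain) (r : rep M C) (r' : rep N D) (v : 'I_n -> M) (v' : 'I_n -> N),
     sim a r r' v v' -> sat phi v -> sat phi v').
Proof.
apply: Sigma_Pi_mut.
- move=> n phi q M N C D r r' v v' S.
  suff [] : sat phi v' <-> sat phi v by [].
  by apply: (qf_invariant q) => i j; have [] := sim_order i j S.
- move=> a n D k psi b a0 L _ IH M N C E r r' v v' S [i Di /sat_exs [e He K]].
  have [e' He' S'] := sim_step S (L i Di) He.
  by exists i => //; apply/sat_exs; exists e' => //; apply: IH S' K.
- move=> n phi q M N C D r r' v v' S.
  suff [] : sat phi v <-> sat phi v' by [].
  by apply: (qf_invariant q) => i j; have [] := sim_order i j S.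
- move=> a n D k psi b a0 L _ IH M N C E r r' v v' S H i Di.
  apply/sat_alls => e' He'; have [e He S'] := sim_step S (L i Di) He'.
  by apply: IH S' _ => //; move/sat_alls: (H i Di); apply.
Qed.

Lemma bf_models a (M N : structure) (C D : chain) (r : rep M C) (r' : rep N D) (T : sentence) :
  is_Pi a T -> bf a [:: (lo r, hi r) : letter C] [:: (lo r', hi r') : letter D] ->
  models M T -> models N T.
Proof.
move=> H L; apply: (proj2 sim_preserves _ _ _ H _ _ _ _ r r').
exists [:: (lo r, hi r)], [:: (lo r', hi r')]; split => //; try exact: cutw_refl.
by case.
Qed.

(** * Scott sentences *)

Section BackAndForth.
Variables (M N : structure) (s : nat -> M) (t : nat -> N).
Hypothesis s_surj : forall x, exists n, s n = x.
Hypothesis t_surj : forall y, exists n, t n = y.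
(** The arity [k + 0] is that of a matrix whose closure by [f_alls] is a sentence. *)
Variable G : forall k, ('I_(k + 0) -> M) -> ('I_(k + 0) -> N) -> Prop.
Hypothesis G0 : exists a x, @G 0 a x.
Hypothesis G_forth : forall k a x, @G k a x -> forall b, exists y, @G k.+1 (env_cons b a) (env_cons y x).
Hypothesis G_back : forall k a x, @G k a x -> forall y, exists b, @G k.+1 (env_cons b a) (env_cons y x).
Hypothesis G_atom : forall k a x, @G k a x -> forall i j,
  sle (a i) (a j) = sle (x i) (x j) /\ (a i = a j <-> x i = x j).

Let state := {k : nat & (('I_(k + 0) -> M) * ('I_(k + 0) -> N))%type}.
Let Gs (S : state) := @G (projT1 S) (projT2 S).1 (projT2 S).2.
Let pairs (S : state) m n := exists i, (projT2 S).1 i = m /\ (projT2 S).2 i = n.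

Lemma back_and_forth : isomorphic N M.
Proof.
have consE T k (x : T) (a : 'I_k -> T) : env_cons x a ord0 = x.
  by rewrite /env_cons unlift_none.
have consS T k (x : T) (a : 'I_k -> T) i : env_cons x a (lift ord0 i) = a i.
  by rewrite /env_cons liftK.
have step n (S : state) : Gs S -> exists S' : state, [/\ Gs S',
    forall m y, pairs S m y -> pairs S' m y, exists y, pairs S' (s n) y &
    exists m, pairs S' m (t n)].
  case: S => k [a x] /= g; have [y g1] := G_forth g (s n).
  have [b g2] := G_back g1 (t n).
  exists (existT _ k.+2 (env_cons b (env_cons (s n) a), env_cons (t n) (env_cons y x))).
  split=> //=.
  - by move=> m z [i [<- <-]]; exists (lift ord0 (lift ord0 i)); rewrite /= !consS.
  - by exists y, (lift ord0 ord0); rewrite /= !consS !consE.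
  - by exists b, ord0; rewrite /= !consE.
have [a0 [x0 g0]] := G0.
pose S0 : state := existT _ 0 (a0, x0).
have /choice [F HF] : forall nS : nat * state, exists S' : state, Gs nS.2 -> [/\ Gs S',
    forall m y, pairs nS.2 m y -> pairs S' m y, exists y, pairs S' (s nS.1) y &
    exists m, pairs S' m (t nS.1)].
  move=> [n S] /=; have [g|ng] := pselect (Gs S); last by exists S.
  by have [S' H] := step n S g; exists S'.
pose st := fix st n := if n is n'.+1 then F (n', st n') else S0.
have g n : Gs (st n) by elim: n => //= n IH; case: (HF (n, st n) IH).
pose P m y := exists n, pairs (st n) m y.
have mono n n' m y : n <= n' -> pairs (st n) m y -> pairs (st n') m y.
  move=> le_n H; rewrite -(subnK le_n); elim: (n' - n) => // d IH.
  by rewrite addSn /=; have [_ K _ _] := HF (d + n, st (d + n)) (g (d + n)); apply: K.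
have atom m y m' y' : P m y -> P m' y' -> sle m m' = sle y y' /\ (m = m' <-> y = y').
  case=> n1 H1 [n2 H2].
  have [i [<- <-]] := mono _ _ _ _ (leq_maxl n1 n2) H1.
  have [j [<- <-]] := mono _ _ _ _ (leq_maxr n1 n2) H2.
  exact: G_atom (g _) i j.
have totM m : exists y, P m y.
  have [n <-] := s_surj m; have [_ _ [y H] _] := HF (n, st n) (g n).
  by exists y, n.+1.
have totN y : exists m, P m y.
  have [n <-] := t_surj y; have [_ _ _ [m H]] := HF (n, st n) (g n).
  by exists m, n.+1.
have [h Hh] := choice totN; have [h' Hh'] := choice totM.
exists h; last by move=> x y; have [] := atom _ _ _ _ (Hh x) (Hh y).
exists h' => [y|m].
  by have [_ E] := atom _ _ _ _ (Hh y) (Hh' (h y)); apply/esym/E.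
by have [_ E] := atom _ _ _ _ (Hh (h' m)) (Hh' m); apply/E.
Qed.

End BackAndForth.

Lemma sat_iso (M N : structure) (h : N -> M) n (phi : formula n) (v : 'I_n -> N) :
  bijective h -> {mono h : x y / sle x y} -> sat phi v <-> sat phi (fun i => h (v i)).
Proof.
move=> [h' hK h'K] hm; elim: phi v => {n} /=.
- by move=> n i j v; rewrite hm.
- by move=> n i j v; split=> [->//|/(can_inj hK)].
- by move=> n psi IH v; rewrite IH.
- by move=> n D F IH v; split=> H k Dk; apply/IH; apply: H.
- by move=> n D F IH v; split=> -[k Dk H]; exists k => //; apply/IH.
- have E n (x : N) (v : 'I_n -> N) :
      (fun i => h (env_cons x v i)) = env_cons (h x) (fun i => h (v i)).
    by apply: funext => i; rewrite /env_cons; case: (unlift _ _).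
  move=> n psi IH v; split=> H x; last by apply/IH; rewrite E.
  by have := H (h' x); rewrite IH E h'K.
- have E n (x : N) (v : 'I_n -> N) :
      (fun i => h (env_cons x v i)) = env_cons (h x) (fun i => h (v i)).
    by apply: funext => i; rewrite /env_cons; case: (unlift _ _).
  move=> n psi IH v; split=> [[x]|[x H]]; first by rewrite IH E; exists (h x).
  by exists (h' x); rewrite IH E h'K.
Qed.

Definition rel_order n (P : 'I_n -> 'I_n -> Prop) : relation n :=
  fun M v => forall i j, sle (v i) (v j) <-> P i j.

Lemma lit_qf n (i j : 'I_n) (P : Prop) : exists2 phi : formula n, finitary_qf phi &
  forall (M : structure) v, sat (M := M) phi v <-> (sle (v i) (v j) <-> P).
Proof.
have [p|np] := pselect P.
  by exists (f_le i j) => [|M v /=]; [constructor | split=> // -[_]; apply].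
exists (f_not (f_le i j)) => [|M v /=]; first by do 2 constructor.
by split=> [H|[H _] /H //]; split.
Qed.

Lemma eq_qf n (i j : 'I_n) (P : Prop) : exists2 phi : formula n, finitary_qf phi &
  forall (M : structure) v, sat (M := M) phi v <-> (v i = v j <-> P).
Proof.
have [p|np] := pselect P.
  by exists (f_eq i j) => [|M v /=]; [constructor | split=> // -[_]; apply].
exists (f_not (f_eq i j)) => [|M v /=]; first by do 2 constructor.
by split=> [H|[H _] /H //]; split.
Qed.

Lemma qf_Sigma_def a n (phi : formula n) (P : relation n) : finitary_qf phi ->
  (forall M v, sat phi v <-> P M v) -> olt ozero a -> Sigma_def a P.
Proof. by move=> q H a0; apply: Pi_def_Sigma a0 (qf_Pi_def q H). Qed.

Lemma Sigma_def_Pi a b n (P : relation n) : olt b a -> Sigma_def b P -> Pi_def a P.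
Proof.
move=> ba H; have K := Sigma_def_neg H.
have := Pi_def_neg (Sigma_def_neg H) => L.
apply: Pi_def_iff (Sigma_def_neg (Pi_def_Sigma ba K)) => M v.
by split=> [/contrapT//|Pv N]; apply: N.
Qed.

Lemma Pi_def_and a n (P Q : relation n) : olt ozero a -> Pi_def a P -> Pi_def a Q ->
  Pi_def a (fun M v => P M v /\ Q M v).
Proof.
move=> a0 HP HQ.
have := @Pi_def_conj a n bool (fun t => if t then P else Q) a0.
case=> [[] //|phi H K]; exists phi => // M v; rewrite K.
by split=> [H0|[? ?] []//]; split; [apply: (H0 true) | apply: (H0 false)].
Qed.

Lemma no_var_eq (M : Type) (v w : 'I_0 -> M) : v = w.
Proof. by apply: funext => i; have := ltn_ord i. Qed.

Lemma countable_surj (M : structure) : countable_structure M ->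
  exists s : nat -> M, forall x, exists n, s n = x.
Proof.
have [x0] := carrier_inhabited M; move=> /pcard_leTP [f].
exists (fun n => if pselect (exists y, f y = n) is left P then projT1 (cid P) else x0).
move=> y; exists (f y); case: pselect => [P|[]]; last by exists y.
by case: (cid P) => z /= /(inj (f := f)); apply; rewrite in_setT.
Qed.

Section ScottSentence.
Variables (M : structure) (s : nat -> M) (g : cord).
Hypothesis s_surj : forall x, exists n, s n = x.
Hypothesis g0 : olt ozero g.
(** [E] stands for lying in the same automorphism orbit; bisimilarity of the gaps will take its
    place. *)
Variable E : forall k, ('I_k -> M) -> ('I_k -> M) -> Prop.
Hypothesis E_iso : forall k (a : 'I_k -> M), exists phi : formula k,
  [/\ is_Pi g phi, sat phi a & forall x, sat phi x -> E a x].
Hypothesis E_sym : forall k (a x : 'I_k -> M), E a x -> E x a.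
Hypothesis E_forth : forall k (a x : 'I_k -> M), E a x ->
  forall b, exists y, E (env_cons b a) (env_cons y x).
Hypothesis E_atom : forall k (a x : 'I_k -> M), E a x -> forall i j,
  sle (a i) (a j) = sle (x i) (x j) /\ (a i = a j <-> x i = x j).

Lemma E_sat k (phi : formula k) (a x : 'I_k -> M) : E a x -> sat phi a <-> sat phi x.
Proof.
elim: phi a x => {k} /=.
- by move=> n i j a x /E_atom /(_ i j) [->].
- by move=> n i j a x /E_atom /(_ i j) [_].
- by move=> n psi IH a x /IH ->.
- by move=> n D F IH a x e; split=> H k Dk; apply/(IH k _ _ e); apply: H.
- by move=> n D F IH a x e; split=> -[k Dk H]; exists k => //; apply/(IH k _ _ e).
- move=> n psi IH a x e; split=> H b.
    by have [y e'] := E_forth (E_sym e) b; apply/(IH _ _ e'); apply: H.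
  by have [y e'] := E_forth e b; apply/(IH _ _ e'); apply: H.
- move=> n psi IH a x e; split=> -[b H].
    by have [y e'] := E_forth e b; exists y; apply/(IH _ _ e').
  by have [y e'] := E_forth (E_sym e) b; exists y; apply/(IH _ _ e').
Qed.

Definition theta k (a : 'I_k -> M) : formula k := projT1 (cid (E_iso a)).

Lemma thetaP k (a : 'I_k -> M) :
  [/\ is_Pi g (theta a), sat (theta a) a & forall x, sat (theta a) x -> E a x].
Proof. exact: (projT2 (cid (E_iso a))). Qed.

Lemma theta_def k (a : 'I_k -> M) : Pi_def g (fun N v => sat (M := N) (theta a) v).
Proof. by exists (theta a) => //; case: (thetaP a). Qed.

(** Lists of indices code the tuples of all lengths, which makes the axioms below countable
    conjunctions. *)
Definition tup k (t : seq nat) : 'I_k -> M := fun i => s (nth 0 t i).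

Lemma tup_surj k (a : 'I_k -> M) : exists t, tup t = a.
Proof.
have /choice [c Hc] := s_surj.
exists [seq c (a i) | i <- enum 'I_k]; apply: funext => i.
by rewrite /tup (nth_map i) ?size_enum_ord // nth_ord_enum Hc.
Qed.

Let G := osucc (osucc g).
Let og : olt g (osucc g) := olt_osucc g.
Let oG : olt (osucc g) G := olt_osucc _.
Let s0 : olt ozero (osucc g) := olt_trans g0 og.
Let G0 : olt ozero G := olt_trans s0 oG.

Definition ext_tup k N (v : 'I_0 -> N) (e : 'I_(k + 0) -> N) : Prop :=
  forall i, e (rshift k i) = v i.

(** The implication has a Sigma_(g+1) matrix: the negated premise is Sigma_g, and the conclusion
    quantifies a Pi_g formula existentially. The universal quantifier over [e] gives Pi_(g+2). *)
Let forth_axiom : relation 0 := fun N v => forall u : nat * seq nat * nat,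
  forall e : 'I_(u.1.1 + 0) -> N, ext_tup v e ->
    ~ sat (theta (@tup (u.1.1 + 0) u.1.2)) e \/
    exists y, sat (theta (env_cons (s u.2) (@tup (u.1.1 + 0) u.1.2))) (env_cons y e).

(** The new element belongs to the universally quantified tuple, so the conclusion is only a
    countable disjunction over the elements of [M]. *)
Let back_axiom : relation 0 := fun N v => forall u : nat * seq nat,
  forall e : 'I_(u.1.+1 + 0) -> N, ext_tup v e ->
    ~ sat (theta (@tup (u.1 + 0) u.2)) (fun i => e (lift ord0 i)) \/
    exists b : nat, sat (theta (env_cons (s b) (@tup (u.1 + 0) u.2) : 'I_(u.1.+1 + 0) -> M)) e.

Let atom_axiom : relation 0 := fun N v => forall u : nat * seq nat,
  forall ij : 'I_(u.1 + 0) * 'I_(u.1 + 0), forall e : 'I_(u.1 + 0) -> N, ext_tup v e ->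
    ~ sat (theta (@tup (u.1 + 0) u.2)) e \/
    ((sle (e ij.1) (e ij.2) <-> sle (@tup (u.1 + 0) u.2 ij.1) (@tup (u.1 + 0) u.2 ij.2))).

Let eq_axiom : relation 0 := fun N v => forall u : nat * seq nat,
  forall ij : 'I_(u.1 + 0) * 'I_(u.1 + 0), forall e : 'I_(u.1 + 0) -> N, ext_tup v e ->
    ~ sat (theta (@tup (u.1 + 0) u.2)) e \/
    ((e ij.1 = e ij.2 <-> @tup (u.1 + 0) u.2 ij.1 = @tup (u.1 + 0) u.2 ij.2)).

Let neg_theta k (a : 'I_k -> M) :
  Sigma_def (osucc g) (fun N v => ~ sat (M := N) (theta a) v).
Proof. exact: Sigma_def_mono g0 (olt_ole og) (Pi_def_neg (theta_def a)). Qed.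

Let forth_def : Pi_def G forth_axiom.
Proof.
apply: (Pi_def_conj G0) => -[[k t] b] /=.
apply: (Sigma_def_all (k := k) (n := 0) oG
  (Q := fun N e => ~ sat (theta (@tup (k + 0) t)) e \/
    exists y, sat (theta (env_cons (s b) (@tup (k + 0) t))) (env_cons y e))).
apply: (Sigma_def_or s0 (neg_theta _)).
apply: Sigma_def_iff (Pi_def_ex (k := 1) (n := k + 0) og (theta_def (env_cons (s b) (@tup (k + 0) t)))).
move=> N e; have S i : rshift 1 i = lift ord0 i :> 'I_(1 + (k + 0)) by apply: val_inj.
split=> [[e' Ee H]|[y H]].
  exists (e' ord0); suff -> : env_cons (e' ord0) e = e' by [].
  by apply: funext => i; rewrite /env_cons; case: unliftP => [j ->|->] //; rewrite -Ee S.
by exists (env_cons y e) => // i; rewrite S /env_cons liftK.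
Qed.

Let back_def : Pi_def G back_axiom.
Proof.
apply: (Pi_def_conj G0) => -[k t] /=.
apply: (Sigma_def_all (k := k.+1) (n := 0) oG
  (Q := fun N (e : 'I_(k.+1 + 0) -> N) =>
    ~ sat (theta (@tup (k + 0) t)) (fun i => e (lift ord0 i)) \/
    exists b : nat, sat (theta (env_cons (s b) (@tup (k + 0) t) : 'I_(k.+1 + 0) -> M)) e)).
apply: (Sigma_def_or s0).
  exact: (Sigma_def_rename (m := k.+1 + 0) (lift ord0) (neg_theta (@tup (k + 0) t))).
apply: (Sigma_def_disj s0) => b; exact: Pi_def_Sigma og (theta_def _).
Qed.

Let atom_def : Pi_def G atom_axiom.
Proof.
apply: (Pi_def_conj G0) => -[k t] /=; apply: (Pi_def_conj G0) => -[i j] /=.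
apply: (Sigma_def_all (k := k) (n := 0) oG
  (Q := fun N e => ~ sat (theta (@tup (k + 0) t)) e \/
    (sle (e i) (e j) <-> sle (@tup (k + 0) t i) (@tup (k + 0) t j)))).
apply: (Sigma_def_or s0 (neg_theta _)).
have [phi q H] := lit_qf i j (sle (@tup (k + 0) t i) (@tup (k + 0) t j)).
exact: qf_Sigma_def q H s0.
Qed.

Let eq_def : Pi_def G eq_axiom.
Proof.
apply: (Pi_def_conj G0) => -[k t] /=; apply: (Pi_def_conj G0) => -[i j] /=.
apply: (Sigma_def_all (k := k) (n := 0) oG
  (Q := fun N e => ~ sat (theta (@tup (k + 0) t)) e \/
    (e i = e j <-> @tup (k + 0) t i = @tup (k + 0) t j))).
apply: (Sigma_def_or s0 (neg_theta _)).
have [phi q H] := eq_qf i j (@tup (k + 0) t i = @tup (k + 0) t j).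
exact: qf_Sigma_def q H s0.
Qed.

Lemma Scott_sentence : has_Pi_Scott_sentence M (osucc (osucc g)).
Proof.
have [Phi HPhi SPhi] := Pi_def_and G0
  (Pi_def_mono g0 (olt_ole (olt_trans og oG)) (theta_def (@no_var M)))
  (Pi_def_and G0 (Pi_def_and G0 forth_def back_def) (Pi_def_and G0 atom_def eq_def)).
exists Phi => // N cN.
have MPhi : models M Phi.
  apply/SPhi; split; first by case: (thetaP (@no_var M)).
  split; split.
  - move=> [[k t] b] /= e _; have [H|] := pselect (sat (theta (@tup (k + 0) t)) e); last by left.
    right; have [_ _ /(_ e H) He] := thetaP (@tup (k + 0) t).
    have [y Ey] := E_forth He (s b); exists y; apply/(E_sat _ Ey).
    by case: (thetaP (env_cons (s b) (@tup (k + 0) t))).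
  - move=> [k t] /= e _; set e' := fun i => e (lift ord0 i).
    have [H|] := pselect (sat (theta (@tup (k + 0) t)) e'); last by left.
    right; have [_ _ /(_ e' H) He] := thetaP (@tup (k + 0) t).
    have [b Eb] := E_forth (E_sym He) (e ord0); have [n sn] := s_surj b; exists n.
    have Ee : env_cons (e ord0) e' = e.
      by apply: funext => i; rewrite /env_cons; case: unliftP => [j ->|->].
    rewrite Ee in Eb; rewrite sn; apply/(E_sat _ Eb).
    by case: (thetaP (env_cons b (@tup (k + 0) t))).
  - move=> [k t] [i j] /= e _; have [H|] := pselect (sat (theta (@tup (k + 0) t)) e); last by left.
    have [_ _ K] := thetaP (@tup (k + 0) t); have [Ea _] := E_atom (K e H) i j.
    by right; rewrite Ea.
  - move=> [k t] [i j] /= e _; have [H|] := pselect (sat (theta (@tup (k + 0) t)) e); last by left.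
    have [_ _ K] := thetaP (@tup (k + 0) t); have [_ Ea] := E_atom (K e H) i j.
    by right; rewrite Ea.
split=> [/SPhi [H1 [[Hf Hb] [Ha He]]]|[h hb hm]]; last first.
  by apply/(sat_iso _ _ hb hm); rewrite (no_var_eq (fun i => h (no_var N i)) (@no_var M)).
have [t t_surj] := countable_surj cN.
apply: (@back_and_forth M N s t s_surj t_surj (fun k a x => sat (theta a) x)).
- exists (@no_var M), (@no_var N); exact: H1.
- move=> k a x H b; have [u Eu] := tup_surj a; have [n <-] := s_surj b; subst a.
  have X : ext_tup (@no_var N) x by move=> o; have := ltn_ord o.
  by have [//|] := Hf (k, u, n) x X.
- move=> k a x H y; have [u Eu] := tup_surj a; subst a.
  have X : ext_tup (@no_var N) (env_cons y x : 'I_(k.+1 + 0) -> N).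
    by move=> o; have := ltn_ord o.
  have [N1|[b Hb1]] := Hb (k, u) _ X; last by exists (s b).
  case: N1; rewrite /= (_ : (fun i => _) = x) //.
  by apply: funext => i; rewrite /env_cons liftK.
- move=> k a x H i j; have [u Eu] := tup_surj a; subst a.
  have X : ext_tup (@no_var N) x by move=> o; have := ltn_ord o.
  have [//|L] := Ha (k, u) (i, j) x X; have [//|L'] := He (k, u) (i, j) x X.
  split; first by apply/idP/idP => /L.
  by split=> /L'.
Qed.

End ScottSentence.

(** * Isolating formulas for the back-and-forth relations *)

Section Representation.
Variables (M : structure) (C : chain) (r : rep M C).

Definition bnd n (e : 'I_n -> M) (k : 'I_n + bool) : C :=
  match k with inl i => r (e i) | inr b => if b then hi r else lo r end.

(** All pairs of bounds are compared, not only neighbours: the segments from [lo] and up to [hi] are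
    the ones that make points [matched]. *)
Definition sim2 b n (e e' : 'I_n -> M) := forall k l,
  (clt (bnd e k) (bnd e l) <-> clt (bnd e' k) (bnd e' l)) /\
  (clt (bnd e k) (bnd e l) ->
   bf b [:: (bnd e k, bnd e l) : letter C] [:: (bnd e' k, bnd e' l) : letter C]).

Definition bisim_env n (e e' : 'I_n -> M) := forall k l,
  (clt (bnd e k) (bnd e l) <-> clt (bnd e' k) (bnd e' l)) /\
  (clt (bnd e k) (bnd e l) -> bis (bnd e k) (bnd e l) (bnd e' k) (bnd e' l)).

Lemma clt_asym (x y : C) : clt x y -> ~ clt y x.
Proof. by move=> xy yx; apply: (clt_irr (clt_trans xy yx)). Qed.

Lemma emb_lt x y : clt (r x) (r y) <-> ~ sle y x.
Proof.
rewrite (emb_le r); split=> [xy [E|/clt_asym //]|N].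
  by move: xy; rewrite E => /clt_irr.
by have [//|E|yx] := clt_total (r x) (r y); case: N; [left | right].
Qed.

Lemma bnd_lo n (e : 'I_n -> M) k : ~ clt (bnd e k) (lo r).
Proof.
case: k => [i|[]] /=; [apply: clt_asym; apply: lo_emb | apply: clt_asym; apply: lo_hi |].
exact: clt_irr.
Qed.

Lemma bnd_hi n (e : 'I_n -> M) k : ~ clt (hi r) (bnd e k).
Proof.
case: k => [i|[]] /=; [apply: clt_asym; apply: emb_hi | exact: clt_irr |].
apply: clt_asym; apply: lo_hi.
Qed.

Lemma order_bnd n (e e' : 'I_n -> M) :
  (forall i j, sle (e' i) (e' j) <-> sle (e i) (e j)) ->
  forall k l, clt (bnd e k) (bnd e l) <-> clt (bnd e' k) (bnd e' l).
Proof.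
move=> H [i|b] [j|c] /=.
- by rewrite !emb_lt H.
- by case: c; split=> [K|K]; try (exact: emb_hi); [case: (clt_asym K) | case: (clt_asym K)];
    apply: lo_emb.
- by case: b; split=> [K|K]; try (exact: lo_emb); [case: (clt_asym K) | case: (clt_asym K)];
    apply: emb_hi.
- by [].
Qed.

Lemma bnd_in n (e : 'I_n -> M) k x y : clt x (bnd e k) -> clt (bnd e k) y ->
  (exists i, y = bnd e i) -> (exists i, x = bnd e i) -> cin (bnd e k).
Proof.
case: k => [i|b] /= xk ky [i1 E1] [i2 E2]; first exact: emb_in.
case: b xk ky => xk ky; first by move: ky; rewrite E1 => /bnd_hi.
by move: xk; rewrite E2 => /bnd_lo.
Qed.

Lemma path_points (x y : C) ls : cutw [:: (x, y)] ls -> exists K (z : 'I_K -> M),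
  ForallP (fun l : letter C => (l.1 = x \/ exists i, l.1 = r (z i)) /\
                               (l.2 = y \/ exists i, l.2 = r (z i))) ls.
Proof.
elim: ls x => [|l ls IH] x; first by move/cutw_nilr.
case/cutw1_inv=> [[-> ->]|[c [ks [cc xc cy [El Els] H]]]].
  have [m] := carrier_inhabited M; exists 0, (fun _ => m) => /=; split=> //; split; by left.
subst; have [K [z F]] := IH c H; have [p Ep] := emb_surj r cc.
have E0 : r (env_cons p z ord0) = c by rewrite /env_cons unlift_none.
have ES i : env_cons p z (lift ord0 i) = z i by rewrite /env_cons liftK.
exists K.+1, (env_cons p z); split=> /=.
  by split; [left | right; exists ord0].
apply: ForallP_impl F => l [H1 H2]; split.
  by right; case: H1 => [->|[i ->]]; [exists ord0 | exists (lift ord0 i); rewrite ES].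
by case: H2 => [->|[i ->]]; [left | right; exists (lift ord0 i); rewrite ES].
Qed.

Lemma sim2_path b n (e e' : 'I_n -> M) k l ls : sim2 b e e' ->
  clt (bnd e k) (bnd e l) -> cutw [:: (bnd e k, bnd e l)] ls ->
  ForallP (fun l => (exists i, l.1 = bnd e i) /\ exists i, l.2 = bnd e i) ls ->
  exists2 ks, cutw [:: (bnd e' k, bnd e' l)] ks &
    all2P (fun s t => bf b [:: s] [:: t]) ls ks.
Proof.
move=> S; elim: ls k => [|s ls IH] k kl; first by move/cutw_nilr.
case/cutw1_inv=> [[-> ->] _|[c [ks [cc xc cy [Es Els] H]]]].
  exists [:: (bnd e' k, bnd e' l)]; first exact: cutw_refl.
  by split=> //; have [_] := S k l; apply.
subst; case=> -[_ [m /= Em]] F; subst c.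
have [us cu R] := IH m cy H F.
have km : clt (bnd e' k) (bnd e' m) by have [<-] := S k m.
have ml : clt (bnd e' m) (bnd e' l) by have [<-] := S m l.
exists ((bnd e' k, bnd e' m) :: us); last by split=> //; have [_] := S k m; apply.
apply: cut_at => //.
by apply: (bnd_in km ml); [exists l | exists k].
Qed.

Lemma bf_of_paths f (x y x' y' : C) :
  (forall m ls, cutw [:: (x', y')] ls -> exists2 ks, cutw [:: (x, y)] ks &
    all2P (fun s t => bf (f m) [:: s] [:: t]) ls ks) ->
  bf (osup f) [:: (x, y) : letter C] [:: (x', y') : letter C].
Proof.
move=> H m gs' ng cg; have [ls cl R] := cutw1_groups cg ng.
have [ks ck S] := H m ls cl; exists (map (fun k => [:: k]) ks).
split; [exact: nemp_seq1 | by rewrite flatten_seq1 |].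
apply/all2P_mapr; apply: all2P_trans (all2P_sym R) S => g l k c L.
exact: bf_trans (bf_uncut _ c) L.
Qed.

Lemma order_def a n (P : 'I_n -> 'I_n -> Prop) : olt ozero a -> Pi_def a (rel_order P).
Proof.
move=> a0; have : Pi_def a (fun M v => forall ij : 'I_n * 'I_n, sle (v ij.1) (v ij.2) <-> P ij.1 ij.2).
  apply: (Pi_def_conj a0) => -[i j] /=; have [phi q H] := lit_qf i j (P i j).
  by apply: Sigma_def_Pi a0 _; exists phi => //; constructor.
by apply: Pi_def_iff => N v; split=> [H i j|H [i j]]; [apply: (H (i, j)) | apply: H].
Qed.

Lemma order_def0 n (P : 'I_n.+1 -> 'I_n.+1 -> Prop) : Pi_def ozero (rel_order P).
Proof.
have /choice [F HF] : forall ij : nat * nat, exists phi : formula n.+1, finitary_qf phi /\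
    forall (N : structure) v, sat (M := N) phi v <->
      (sle (v (inord ij.1)) (v (inord ij.2)) <-> P (inord ij.1) (inord ij.2)).
  by move=> [i j]; have [phi ? ?] := @lit_qf n.+1 (inord i) (inord j) (P (inord i) (inord j)); exists phi.
pose phi : formula n.+1 := f_and `I_n.+1 (fun i => f_and `I_n.+1 (fun j => F (i, j))).
apply: (@qf_Pi_def _ phi).
  apply: qf_and => [|i _]; first exact: finite_II.
  apply: qf_and => [|j _]; first exact: finite_II.
  by case: (HF (i, j)).
move=> N v; split=> [H i j|H i _ j _].
  have /(proj2 (HF (nat_of_ord i, nat_of_ord j))) := H i (ltn_ord i) j (ltn_ord j).
  by rewrite /= !inord_val.
by apply/(proj2 (HF (i, j))); apply: H.
Qed.

(** Each unrelated [e'] is excluded by a formula true at [e], and there are countably many [e']. If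
    some cut of a gap of [e'] has no answer at [e], the formula says that no extension of the tuple
    resembles, one level down, [e'] together with the points of this cut. *)
Lemma isolate (s : nat -> M) (s_surj : forall x, exists n, s n = x) g n (e : 'I_n -> M) :
  (g = ozero -> 0 < n) ->
  exists phi : formula n, [/\ is_Pi g phi, sat phi e & forall e', sat phi e' -> sim2 g e e'].
Proof.
pose P k (e : 'I_k -> M) (i j : 'I_k) : Prop := sle (e i) (e j).
have PO n' (e0 e' : 'I_n' -> M) : rel_order (P n' e0) e' ->
    forall k l, clt (bnd e0 k) (bnd e0 l) <-> clt (bnd e' k) (bnd e' l).
  by move=> H; apply: order_bnd => i j; apply: H.
elim: g n e => [|f IH] n e n0.
  case: n e n0 => [|n] e; first by move=> /(_ erefl).
  move=> _; have [phi H K] := order_def0 (P n.+1 e); exists phi; split => //.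
    by apply/K => i j.
  by move=> e' /K /PO H' k l; split.
have g0 := olt0_osup f.
have key (e' : 'I_n -> M) : exists Q : relation n, [/\ Pi_def (osup f) Q, Q M e &
    rel_order (P n e) e' -> Q M e' -> sim2 (osup f) e e'].
  have [S|N] := pselect (sim2 (osup f) e e').
    by exists (rel_order (P n e)); split => //; apply: order_def.
  have [O|NO] := pselect (rel_order (P n e) e'); last first.
    by exists (rel_order (P n e)); split => //; apply: order_def.
  have [m [ls' [k [l [kl cl NP]]]]] : exists m ls' k l, [/\ clt (bnd e k) (bnd e l),
      cutw [:: (bnd e' k, bnd e' l)] ls' & forall ls, cutw [:: (bnd e k, bnd e l)] ls ->
      ~ all2P (fun s t => bf (f m) [:: s] [:: t]) ls' ls].
    apply: contrapT => K; apply: N => k l; split; first exact: PO.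
    move=> kl; apply: bf_of_paths => m ls cl; apply: contrapT => X; apply: K.
    exists m, ls, k, l; split => // ks ck R; apply: X; by exists ks.
  have kl' : clt (bnd e' k) (bnd e' l) by apply/(PO _ _ _ O).
  have [K [z F]] := path_points cl; have [x0] := carrier_inhabited M.
  (* The dummy entry [x0] keeps the tuple nonempty, as the induction hypothesis demands at level
     0. *)
  pose e2 (i : 'I_(K.+1 + n)) := match fintype.split i with inl j => env_cons x0 z j | inr j => e' j end.
  have e2r i : e2 (rshift K.+1 i) = e' i by rewrite /e2 (unsplitK (inr i)).
  have e2l i : e2 (lshift n (lift ord0 i)) = z i.
    by rewrite /e2 (unsplitK (inl _)) /env_cons liftK.
  pose sh (q : 'I_n + bool) : 'I_(K.+1 + n) + bool :=
    match q with inl i => inl (rshift K.+1 i) | inr b => inr b end.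
  have shE q : bnd e2 (sh q) = bnd e' q by case: q => [i|b] //=; rewrite e2r.
  have [|psi [Hpsi s2 Spsi]] := IH m _ e2; first by [].
  pose Q : relation n := fun N v => forall u : 'I_(K.+1 + n) -> N,
    (forall i, u (rshift K.+1 i) = v i) -> ~ sat psi u.
  exists Q; split.
  - apply: (Sigma_def_all (k := K.+1) (olt_osup f m) (Q := fun N u => ~ sat psi u)).
    by apply: Pi_def_neg; exists psi.
  (* A tuple over [e] satisfying [psi] would carry [ls'] to an answer in the gap of [e], against
     [NP]. *)
  - move=> u Eu /Spsi S.
    have shE' q : bnd u (sh q) = bnd e q by case: q => [i|b] //=; rewrite Eu.
    have [|||ks ck R] := @sim2_path (f m) _ e2 u (sh k) (sh l) ls' S; rewrite ?shE //.
      apply: ForallP_impl F => t [H1 H2]; split.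
        by case: H1 => [->|[i ->]]; [exists (sh k); rewrite shE | exists (inl (lshift n (lift ord0 i))); rewrite /= e2l].
      by case: H2 => [->|[i ->]]; [exists (sh l); rewrite shE | exists (inl (lshift n (lift ord0 i))); rewrite /= e2l].
    by rewrite !shE' in ck; case: (NP ks ck R).
  - by move=> _ /(_ e2 e2r).
have /choice [Q HQ] := key.
have DQ := Pi_def_conj (P := fun t : seq nat => Q (tup s t)) g0
  (fun t => let: And3 h _ _ := HQ (tup s t) in h).
have [phi H K] := Pi_def_and g0 (order_def (P n e) g0) DQ.
exists phi; split => //.
  apply/K; split; first by move=> i j.
  by move=> t; case: (HQ (tup s t)).
move=> e' /K [O HH]; have [t Et] := tup_surj s_surj e'.
by case: (HQ (tup s t)) (HH t) => _ _; rewrite Et => /(_ O); apply.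
Qed.

Lemma bisim_env_sym n (e e' : 'I_n -> M) : bisim_env e e' -> bisim_env e' e.
Proof.
move=> H k l; have [E B] := H k l; split; first by rewrite E.
by move=> kl; apply: bis_sym; apply: B; apply/E.
Qed.

Lemma bnd_eq n (e e' : 'I_n -> M) k l : bisim_env e e' -> bnd e k = bnd e l -> bnd e' k = bnd e' l.
Proof.
move=> H E; have [kl|//|lk] := clt_total (bnd e' k) (bnd e' l).
  by have [[_ /(_ kl) h] _] := H k l; rewrite E in h; case: (clt_irr h).
by have [[_ /(_ lk) h] _] := H l k; rewrite E in h; case: (clt_irr h).
Qed.

Lemma bisim_env_atom n (e e' : 'I_n -> M) : bisim_env e e' -> forall i j,
  sle (e i) (e j) = sle (e' i) (e' j) /\ (e i = e j <-> e' i = e' j).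
Proof.
move=> H i j; split.
  apply/idP/idP => L; apply: contrapT => /emb_lt K.
    by have [[_ /(_ K) /emb_lt]] := H (inl j) (inl i).
  by have [[/(_ K) /emb_lt]] := H (inl j) (inl i).
split=> E; apply: (@emb_inj _ _ r).
  by apply: (bnd_eq (k := inl i) (l := inl j) H); rewrite /= E.
by apply: (bnd_eq (k := inl i) (l := inl j) (bisim_env_sym H)); rewrite /= E.
Qed.

Lemma exists_max (lt : C -> C -> Prop) (T : finType) (h : T -> C) (P : T -> Prop) (t0 : T) :
  (forall x, ~ lt x x) -> (forall x y z, lt x y -> lt y z -> lt x z) -> P t0 ->
  exists2 t, P t & forall u, P u -> ~ lt (h t) (h u).
Proof.
move=> irr tr P0.
suff [t [Pt H]] : exists t, P t /\ forall u, u \in enum T -> P u -> ~ lt (h t) (h u).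
  by exists t => // u; apply: H; rewrite mem_enum.
elim: (enum T) => [|a l [t [Pt IH]]]; first by exists t0.
have [[Pa ta]|N] := pselect (P a /\ lt (h t) (h a)).
  exists a; split=> // u; rewrite in_cons => /orP [/eqP-> _|ul Pu]; first exact: irr.
  by move=> au; apply: (IH u ul Pu); apply: tr au.
exists t; split=> // u; rewrite in_cons => /orP [/eqP-> Pa|]; last exact: IH.
by move=> ta; apply: N.
Qed.

(** A point that is not yet a bound is answered in the gap between its nearest bounds [k0] and [l0].
    Intervals to farther bounds are glued from these by [bis_cat]. *)
Lemma bisim_env_forth n (e e' : 'I_n -> M) : bisim_env e e' -> forall b,
  exists d, bisim_env (env_cons b e) (env_cons d e').
Proof.
move=> H b.
have old d (e0 : 'I_n -> M) i : bnd (env_cons d e0) (inl (lift ord0 i)) = bnd e0 (inl i).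
  by rewrite /= /env_cons liftK.
have new d (e0 : 'I_n -> M) : bnd (env_cons d e0) (inl ord0) = r d.
  by rewrite /= /env_cons unlift_none.
have oldb d (e0 : 'I_n -> M) c : bnd (env_cons d e0) (inr c) = bnd e0 (inr c) by [].
have bndP d d' (Q : C -> C -> C -> C -> Prop) :
    (forall k l, Q (bnd e k) (bnd e l) (bnd e' k) (bnd e' l)) ->
    (forall k, Q (bnd e k) (r b) (bnd e' k) (r d)) -> (forall l, Q (r b) (bnd e l) (r d) (bnd e' l)) ->
    Q (r b) (r b) (r d) (r d) -> d = d' -> forall k l,
    Q (bnd (env_cons b e) k) (bnd (env_cons b e) l) (bnd (env_cons d' e') k) (bnd (env_cons d' e') l).
  move=> Q1 Q2 Q3 Q4 <- k l.
  have dest k' : (exists k0, bnd (env_cons b e) k' = bnd e k0 /\ bnd (env_cons d e') k' = bnd e' k0) \/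
     (bnd (env_cons b e) k' = r b /\ bnd (env_cons d e') k' = r d).
    case: k' => [i|c]; last by left; exists (inr c).
    case: (unliftP ord0 i) => [j ->|->]; first by left; exists (inl j); rewrite !old.
    by right; rewrite !new.
  by case: (dest k) => [[k0 [-> ->]]|[-> ->]]; case: (dest l) => [[l0 [-> ->]]|[-> ->]].
pose X (x y x' y' : C) := (clt x y <-> clt x' y') /\ (clt x y -> bis x y x' y').
have [[k0 Ek0]|N] := pselect (exists k, r b = bnd e k).
  have [d Ed] : exists d, r d = bnd e' k0.
    apply: (@emb_surj _ _ r); apply: (@bnd_in _ e' k0 (lo r) (hi r)); last 2 first.
    - by exists (inr true).
    - by exists (inr false).
    - by have [/= <- _] := H (inr false) k0; rewrite -Ek0; apply: lo_emb.
    - by have [/= <- _] := H k0 (inr true); rewrite -Ek0; apply: emb_hi.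
  exists d; move=> k l; refine (@bndP d d X _ _ _ _ erefl k l) => {k l}; rewrite ?Ek0 ?Ed.
  - by move=> k l; apply: H.
  - by move=> k; apply: H.
  - by move=> k; apply: H.
  - by apply: H.
have lt_bnd k : clt (bnd e k) (r b) \/ clt (r b) (bnd e k).
  by have [h|h|h] := clt_total (bnd e k) (r b); [left | case: N; exists k | right].
have [k0 Pk Mk] := @exists_max (fun x y => clt x y) _ (bnd e) (fun k => clt (bnd e k) (r b))
  (inr false) (@clt_irr C) (@clt_trans C) (lo_emb r b).
have [l0 Pl Ml] := @exists_max (fun x y => clt y x) _ (bnd e) (fun k => clt (r b) (bnd e k))
  (inr true) (@clt_irr C) (fun x y z xy yz => clt_trans yz xy) (emb_hi r b).
have kl0 := clt_trans Pk Pl.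
have [F _] := bisim_bis (proj2 (H k0 l0) kl0).
have [z' [cz' kz zl bl br]] := F _ (emb_in r b) Pk Pl.
have [d Ed] := emb_surj r cz'; subst z'.
have kl0' : clt (bnd e' k0) (bnd e' l0) by apply/(proj1 (H k0 l0)).
have L k : clt (bnd e k) (r b) -> clt (bnd e' k) (r d) /\ bis (bnd e k) (r b) (bnd e' k) (r d).
  move=> kb; have [h|h|h] := clt_total (bnd e k) (bnd e k0); last by case: (Mk k kb).
    have h' : clt (bnd e' k) (bnd e' k0) by apply/(proj1 (H k k0)).
    split; first exact: clt_trans kz.
    apply: (@bis_cat _ _ (bnd e k0) _ _ (bnd e' k0)) => //; last exact: (proj2 (H k k0)).
      by apply: (bnd_in h kl0); [exists l0 | exists k].
    by apply: (bnd_in h' kl0'); [exists l0 | exists k].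
  by rewrite h (bnd_eq H h).
have U l : clt (r b) (bnd e l) -> clt (r d) (bnd e' l) /\ bis (r b) (bnd e l) (r d) (bnd e' l).
  move=> bl0; have [h|h|h] := clt_total (bnd e l0) (bnd e l); last by case: (Ml l bl0).
    have h' : clt (bnd e' l0) (bnd e' l) by apply/(proj1 (H l0 l)).
    split; first exact: clt_trans h'.
    apply: (@bis_cat _ _ (bnd e l0) _ _ (bnd e' l0)) => //; last exact: (proj2 (H l0 l)).
      by apply: (bnd_in kl0 h); [exists l | exists k0].
    by apply: (bnd_in kl0' h'); [exists l | exists k0].
  by rewrite -h -(bnd_eq H h).
exists d => k l; refine (@bndP d d X _ _ _ _ erefl k l) => {k l}.
- by move=> k l; apply: H.
- move=> k; have [h|h] := lt_bnd k; first by have [h1 h2] := L k h; split.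
  have [h1 _] := U k h; split=> [|h2]; last by case: (clt_asym h h2).
  by split=> h2; [case: (clt_asym h h2) | case: (clt_asym h1 h2)].
- move=> k; have [h|h] := lt_bnd k; last by have [h1 h2] := U k h; split.
  have [h1 _] := L k h; split=> [|h2]; last by case: (clt_asym h h2).
  by split=> h2; [case: (clt_asym h h2) | case: (clt_asym h1 h2)].
- by split=> [|/clt_irr //]; split=> /clt_irr.
Qed.

End Representation.

(** * Countable models *)

Definition substructure (M : structure) (S : M -> Prop) (h : inhabited {x : M | S x}) :=
  Structure (fun x y : {x : M | S x} => sle (sval x) (sval y)) h.

Section Skolem.
Variables (M : structure) (m0 : M).

Definition closed_under (W : nat -> seq M -> M) (S : M -> Prop) :=
  forall k l, ForallP S l -> S (W k l).

Definition skolemizes n (phi : formula n) (W : nat -> seq M -> M) :=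
  forall S (h : inhabited {x : M | S x}), closed_under W S ->
  forall v : 'I_n -> substructure h, sat phi v <-> sat phi (fun i => sval (v i)).

Let merge (W : nat -> nat -> seq M -> M) k : seq M -> M :=
  if unpickle k is Some (i, j) then W i j else fun _ => m0.

Lemma closed_merge W S : closed_under (merge W) S -> forall i, closed_under (W i) S.
Proof. by move=> H i j l /(H (pickle (i, j))); rewrite /merge pickleK. Qed.

Lemma sval_cons (S : M -> Prop) n (x : {x : M | S x}) (v : 'I_n -> {x : M | S x}) :
  (fun i => sval (env_cons x v i)) = env_cons (sval x) (fun i => sval (v i)).
Proof. by apply: funext => i; rewrite /env_cons; case: unlift. Qed.

Lemma ForallP_vals (S : M -> Prop) n (v : 'I_n -> {x : M | S x}) s :
  ForallP S [seq sval (v i) | i <- s].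
Proof. by elim: s => //= i s IH; split=> //; apply: svalP. Qed.

Lemma nth_vals n (v : 'I_n -> M) : (fun i : 'I_n => nth m0 [seq v j | j <- enum 'I_n] i) = v.
Proof. by apply: funext => i; rewrite (nth_map i) ?size_enum_ord // nth_ord_enum. Qed.

(** At a quantifier, function 0 yields a witness or a counterexample and the others serve the
    matrix; at a connective, countably many families are merged through codes of pairs. *)
Lemma skolem_functions n (phi : formula n) : exists W, skolemizes phi W.
Proof.
elim: phi => {n} [n i j|n i j|n psi [W IH]|n D F IH|n D F IH|n psi [W IH]|n psi [W IH]].
- by exists (fun _ _ => m0).
- exists (fun _ _ => m0) => S h _ v /=; split=> [->//|E].
  by case: (v i) (v j) E => x Sx [y Sy] /= E; subst; congr exist; apply: Prop_irrelevance.
- by exists W => S h C v /=; rewrite (IH S h C).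
- have [W HW] := choice IH; exists (merge W) => S h C v /=.
  by split=> H k Dk; apply/(HW k S h (closed_merge C k)); apply: H.
- have [W HW] := choice IH; exists (merge W) => S h C v /=.
  by split=> -[k Dk H]; exists k => //; apply/(HW k S h (closed_merge C k)).
- have /choice [w Hw] : forall v : 'I_n -> M, exists x,
      sat psi (env_cons x v) -> forall y, sat psi (env_cons y v).
    move=> v; have [[x Nx]|N] := pselect (exists x, ~ sat psi (env_cons x v)); first by exists x.
    by exists m0 => _ y; apply: contrapT => Ny; apply: N; exists y.
  exists (fun k l => if k is k'.+1 then W k' l else w (fun i => nth m0 l i)) => S h C v /=.
  have IHS := IH S h (fun k => C k.+1).
  split=> H x; last by apply/IHS; rewrite sval_cons.
  have /= Sw := C 0 _ (ForallP_vals v (enum 'I_n)).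
  rewrite nth_vals in Sw; apply: Hw.
  by have /IHS := H (exist _ _ Sw); rewrite sval_cons.
- have /choice [w Hw] : forall v : 'I_n -> M, exists x,
      (exists y, sat psi (env_cons y v)) -> sat psi (env_cons x v).
    move=> v; have [[x Px]|N] := pselect (exists x, sat psi (env_cons x v)); first by exists x.
    by exists m0 => H; case: N.
  exists (fun k l => if k is k'.+1 then W k' l else w (fun i => nth m0 l i)) => S h C v /=.
  have IHS := IH S h (fun k => C k.+1).
  split=> [[x /IHS]|H]; first by rewrite sval_cons; exists (sval x).
  have /= Sw := C 0 _ (ForallP_vals v (enum 'I_n)).
  rewrite nth_vals in Sw; exists (exist _ _ Sw); apply/IHS; rewrite sval_cons.
  exact: Hw.
Qed.

End Skolem.

Lemma countable_model (T : sentence) : satisfiable T ->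
  exists2 A : structure, models A T & exists s : nat -> A, forall x, exists n, s n = x.
Proof.
case=> M MT; have [m0] := carrier_inhabited M; have [W HW] := skolem_functions m0 T.
(* The closure of [m0] under the Skolem functions consists of the values of terms, and terms are
   trees labelled by numbers, hence countably many. *)
pose eval := fix eval (t : GenTree.tree nat) : M :=
  if t is GenTree.Node k ts then W k (map eval ts) else m0.
pose S x := exists t, eval t = x.
have h : inhabited {x | S x} by constructor; exists m0, (GenTree.Leaf 0).
have cS : closed_under W S.
  move=> k l Sl; suff [ts <-] : exists ts, map eval ts = l by exists (GenTree.Node k ts).
  elim: l Sl => [_|x l IH /= [[t <-] /IH [ts <-]]]; first by exists [::].
  by exists (t :: ts).
exists (substructure h).
  by apply/(HW _ h cS); rewrite (no_var_eq (fun i => _) (@no_var M)).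
exists (fun n => exist S _ (ex_intro _ (odflt (GenTree.Leaf 0) (unpickle n)) erefl)).
case=> x [t Et]; subst x; exists (pickle t); apply: eq_exist; rewrite pickleK //.
Qed.

(** * Linear orders as chains *)

Inductive ends (T : Type) := Bot | Mid of T | Top.
Arguments Bot {T}.
Arguments Top {T}.

Section LinearOrder.
Variable A : structure.
Hypothesis lin : is_linear_order A.

Definition ends_lt (x y : ends A) : Prop :=
  match x, y with
  | Bot, Bot => False
  | Bot, _ => True
  | Mid a, Mid b => ~ sle b a
  | Mid _, Top => True
  | _, _ => False
  end.

Lemma not_sle (a b : A) : ~ sle b a -> sle a b.
Proof. by case: lin => _ /(_ a b) /orP []. Qed.

Lemma ends_irr x : ~ ends_lt x x.
Proof. by case: x => //= a; apply; case: lin => -[[r _] _] _; apply: r. Qed.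

Lemma ends_trans x y z : ends_lt x y -> ends_lt y z -> ends_lt x z.
Proof.
case: x y z => [|a|] [|b|] [|c|] //= /not_sle ab nbc ca; apply: nbc.
by case: lin => -[[_ t] _] _; apply: t ca ab.
Qed.

Lemma ends_total x y : [\/ ends_lt x y, x = y | ends_lt y x].
Proof.
case: x y => [|a|] [|b|] /=; try by [constructor 1 | constructor 2 | constructor 3].
have [ba|nba] := pselect (sle b a); last by constructor 1.
have [ab|nab] := pselect (sle a b); last by constructor 3.
by constructor 2; congr Mid; case: lin => -[_ anti] _; apply: anti; rewrite ab.
Qed.

Definition order_chain : chain :=
  @Chain (ends A) ends_lt (fun x => exists a, Mid a = x) ends_irr ends_trans ends_total.

Lemma order_rep : exists r : rep A order_chain, lo r = Bot /\ hi r = Top.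
Proof.
have in_ a : @cin order_chain (Mid a) by exists a.
have le_ (a b : A) : sle a b <-> Mid a = Mid b \/ ends_lt (Mid a) (Mid b).
  split=> [ab|[[<-]|/not_sle //]]; last by case: lin => -[[r _] _] _; apply: r.
  have [H|H|H] := ends_total (Mid a) (Mid b); [by right | by left | by case: H].
by exists (@Rep A order_chain (@Mid A) Bot Top in_ (fun c h => h) (fun a b E => let: erefl := E in erefl)
  le_ (fun _ => I) (fun _ => I) I).
Qed.

Lemma order_enum (s : nat -> A) : (forall x, exists n, s n = x) ->
  exists enum : nat -> seq (word order_chain), forall g, exists n, enum n = g.
Proof.
move=> s_surj.
pose pe (n : nat) : ends A := if n is n'.+1 then (if n' is m.+1 then Mid (s m) else Top) else Bot.
have pe_surj x : exists n, pe n = x.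
  by case: x => [|a|]; [exists 0 | have [n <-] := s_surj a; exists n.+2 | exists 1].
pose dec (t : seq (seq (nat * nat))) : seq (word order_chain) :=
  map (map (fun l => (pe l.1, pe l.2))) t.
exists (fun n => dec (odflt [::] (unpickle n))) => g.
suff [t <-] : exists t, dec t = g by exists (pickle t); rewrite pickleK.
elim: g => [|w g [t <-]]; first by exists [::].
suff [u <-] : exists u, map (fun l : nat * nat => (pe l.1, pe l.2) : letter order_chain) u = w by exists (u :: t).
elim: w => [|[x y] w [u <-]]; first by exists [::].
have [i <-] := pe_surj x; have [j <-] := pe_surj y.
by exists ((i, j) :: u).
Qed.

End LinearOrder.

(** * The generic model *)

Section GenericModel.
Import Order.TTheory GRing.Theory Num.Theory.
Local Open Scope ring_scope.
Variables (al : cord) (A : chain) (enum : nat -> seq (word A)).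
Hypothesis enum_surj : forall g, exists n, enum n = g.
Variable p : nat -> items A.
Hypothesis vp : forall n, valid (p n).
Hypothesis ep : forall n m, (n <= m)%N -> extends al (p n) (p m).
Hypothesis gen : forall r n, exists2 m, (n <= m)%N &
  meets al enum r (p m) \/ forall q, extends al (p m) q -> ~ meets al enum r q.
Hypothesis inh : inhabited {x : rat | gin p x}.

Definition generic_model : structure :=
  Structure (fun x y : {x : rat | gin p x} => sval x <= sval y) inh.
Local Notation B := generic_model.

Lemma generic_linear : is_linear_order B.
Proof.
split; last by move=> x y; apply: le_total.
split; last by move=> [x gx] [y gy] /= /le_anti E; apply: eq_exist.
by split=> [x|y x z]; [apply: lexx | apply: le_trans].
Qed.

Lemma generic_countable : countable_structure B.
Proof.
apply/countable_injP; exists (fun x : B => pickle (sval x)) => -[x gx] [y gy] _ _ /=.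
by move=> E; apply: eq_exist; apply: (pcan_inj (@pickleK rat)).
Qed.

Lemma generic_rep : exists r : rep B (generic p), lo r = 0 /\ hi r = 1.
Proof.
have surj c : gin p c -> exists x : B, sval x = c by move=> gc; exists (exist _ c gc).
have inj_ (x y : B) : sval x = sval y -> x = y.
  by case: x y => [x gx] [y gy] /= E; apply: eq_exist.
have le_ (x y : B) : sle x y <-> sval x = sval y \/ sval x < sval y.
  by rewrite /= le_eqVlt; split=> [/orP [/eqP|]|[->|->]]; rewrite ?eqxx ?orbT; auto.
have lo_ (x : B) : 0 < sval x by case: (svalP x).
have hi_ (x : B) : sval x < 1 by apply: (gin_lt1 vp); apply: svalP.
by exists (@Rep B (generic p) sval 0 1 (fun x => svalP x) surj inj_ le_ lo_ hi_ ltr01).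
Qed.

(** [isolate] works at level al+2 up to [sim2], which [bis_gap] improves to bisimilarity of all
    gaps; [Scott_sentence] adds two levels. *)
Lemma generic_Scott_sentence : has_Pi_Scott_sentence B (oaddn al 4).
Proof.
have [r [Elo Ehi]] := generic_rep; have [s s_surj] := countable_surj generic_countable.
apply: (@Scott_sentence B s (osucc (osucc al)) s_surj (olt0_osup _) (@bisim_env B _ r)).
- move=> k e; have [//|phi [H K S]] := @isolate B _ r s s_surj (osucc (osucc al)) k e.
  exists phi; split=> // e' /S {}S i j; have [E L] := S i j; split=> // ij.
  have M l : matched al (bnd r e l) (bnd r e' l).
    case: l => [l|b]; last by left.
    right; split; [exact: (emb_in r) | exact: (emb_in r) | |].
      move: (proj2 (S (inr false) (inl l)) (lo_emb r _)).
      by rewrite [bnd r e (inr false)]Elo [bnd r e' (inr false)]Elo.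
    move: (proj2 (S (inl l) (inr true)) (emb_hi r _)).
    by rewrite [bnd r e (inr true)]Ehi [bnd r e' (inr true)]Ehi.
  have V (x : 'I_k -> B) i' j' : clt (bnd r x i') (bnd r x j') -> valid_letter (bnd r x i', bnd r x j').
    move=> L'; apply: (valid_gin vp ep _ _ L').
      case: i' L' => [i'|[]] /= L'; [by left; apply: (emb_in r) | | by right].
      by have /(_ L') := @bnd_hi B _ r k x j'.
    case: j' L' => [j'|[]] /= L'; [by left; apply: (emb_in r) | by right |].
    by have /(_ L') := @bnd_lo B _ r k x i'.
  by apply: (bis_gap enum_surj vp ep gen); [apply: V | apply: V; apply/E | apply: M | apply: M | apply: L].
- by move=> k a x; apply: bisim_env_sym.
- by move=> k a x; apply: bisim_env_forth.
- by move=> k a x; apply: bisim_env_atom.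
Qed.

End GenericModel.

Section Construction.
Import Order.TTheory GRing.Theory Num.Theory.
Local Open Scope ring_scope.

Lemma exists_generic_model (a : cord) (T : sentence) (A : structure) (s : nat -> A) :
  is_linear_order A -> (forall x, exists n, s n = x) -> is_Pi a T -> models A T ->
  exists B : structure, [/\ countable_structure B, is_linear_order B, models B T &
    has_Pi_Scott_sentence B (oaddn a 4)].
Proof.
move=> lin s_surj TP AT; have [rA [EloA EhiA]] := order_rep lin.
have [enum enum_surj] := order_enum lin s_surj; have [a0] := carrier_inhabited A.
pose h : rat := 2^-1.
have h0 : 0 < h by rewrite invr_gt0 ltr0n.
(* One point is named at the start so that the model is inhabited. The word of [p0] is a cut of the
   letter of all of [A], which puts [A] below the generic order. *)
pose p0 : items (order_chain lin) := [:: (0, (Bot, Mid a0)); (h, (Mid a0, Top))].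
have v0 : valid p0 by [].
have [p [Ep vp ep gen]] := @generic_sequence a _ requirement (meets a enum) p0 v0.
have gh : gin p h by split=> //; exists 0%N; rewrite Ep !inE eqxx orbT.
have inh : inhabited {x : rat | gin p x} by constructor; exists h.
exists (generic_model inh); split.
- exact: generic_countable.
- exact: generic_linear.
- have [rB [EloB EhiB]] := generic_rep vp inh.
  apply: (@bf_models a A _ _ _ rA rB T TP _ AT); rewrite EloA EhiA EloB EhiB.
  have ok0 : @ok _ p 0%N (0, 1).
    by split; [exact: bd0 | exact: bd1 | exact: ltr01].
  apply: bf_trans (bf_wd enum_surj vp ep gen ok0).
  rewrite /wd Ep /seg /=.
  apply: bf_cut; apply: cut_at => //; last exact: cutw_refl.
  by exists a0.
- exact: (@generic_Scott_sentence a _ enum enum_surj p vp ep gen inh).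
Qed.

End Construction.

Theorem theorem1p5 (a : cord) (T : sentence) :
  is_Pi a T -> satisfiable T -> extends_linear_orders T ->
  exists B : structure,
    countable_structure B /\ is_linear_order B /\ models B T /\
    has_Pi_Scott_sentence B (oaddn a 4) /\
    (exists b : cord, is_Scott_rank B b /\ ole b (oaddn a 3)).
Proof.
move=> TP TS TL; have [A AT [s s_surj]] := countable_model TS.
have [B [cB lB BT SB]] := exists_generic_model (TL A AT) s_surj TP AT.
exists B; do 4 (split=> //).
have [b Sb minb] := @ole_wf_min (fun c => has_Pi_Scott_sentence B (osucc c)) (oaddn a 3) SB.
by exists b; split=> //; apply: minb.
Qed.
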